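(* Let $B(x,y,D_x,D_y)$ be a linear partial differential operator with polynomial coefficients on $\mathbb{R}^2$ and let $P\in\mathbb{R}[\xi,\eta]$ be a polynomial. Define the linear partial differential operator with polynomial coefficients $$\tilde{B}(M_1,M_2,D_1,D_2)=B\left(M_1-\tfrac12D_2-P_1,\;M_1+\tfrac12D_2-P_1,\;\tfrac12D_1+M_2-P_2,\;\tfrac12D_1-M_2+P_2\right),$$ where $P_1=(\partial_\xi P)(D_1,D_2)$ and $P_2=(\partial_\eta P)(D_1,D_2)$. If $B$ is regular, then also $\tilde{B}$ is regular.
   Context: Notation. $M_1w(x,y)=xw(x,y)$, $M_2w(x,y)=yw(x,y)$, $D_1=D_x=-i\partial_x$, $D_2=D_y=-i\partial_y$, acting on $\mathcal{S}'(\mathbb{R}^2)$. If $B(x,y,\xi,\eta)=\sum c_{mnhk}x^my^n\xi^h\eta^k$ is a polynomial with complex coefficients, the associated operator is $B(x,y,D_x,D_y)=B(M_1,M_2,D_1,D_2)=\sum c_{mnhk}M_1^mM_2^nD_1^hD_2^k$. For operators $X_1,X_2,Y_1,Y_2$, $B(X_1,X_2,Y_1,Y_2)$ means $\sum c_{mnhk}X_1^mX_2^nY_1^hY_2^k$, with factors in this order. $(\partial_\xi P)(D_1,D_2)$ is the constant-coefficient operator obtained by substituting $D_1,D_2$ for $\xi,\eta$ in $\partial_\xi P$; similarly for $\partial_\eta P$. Definition. A linear operator $A$ on $\mathcal{S}'(\mathbb{R}^n)$ is regular if for all $u\in\mathcal{S}'(\mathbb{R}^n)$: $Au\in\mathcal{S}(\mathbb{R}^n)$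 implies $u\in\mathcal{S}(\mathbb{R}^n)$. *)

(* Defs.v *)
From HB Require Import structures.
From mathcomp Require Import all_boot all_order all_algebra.
From mathcomp Require Import all_classical all_reals all_analysis.
From mathcomp Require Import complex.
(* The notations of mpoly clash with those of MathComp-Analysis. *)
From mathcomp Require Import -(notations) mpoly.
Set Implicit Arguments.
Unset Strict Implicit.
Unset Printing Implicit Defensive.
Import Order.TTheory GRing.Theory Num.Theory numFieldNormedType.Exports.
Import ComplexField.Normc.
Local Open Scope classical_set_scope.
Local Open Scope ring_scope.

Section Ck.
Context {R : realType}.
Implicit Types (f g : R * R -> R) (p v : R * R).

Definition ex : R * R := (1, 0).
Definition ey : R * R := (0, 1).

(* Ck n g: g is of class C^n on R^2. An inductive type rather than a fixpoint:
   a fixpoint is unfolded when statements about 'D_ex and 'D_ey are compared,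
   which is prohibitively slow. *)
Inductive Ck : nat -> (R * R -> R) -> Prop :=
| Ck_zero g : continuous g -> Ck 0 g
| Ck_succ n g : continuous g ->
    (forall p, derivable g p ex) -> (forall p, derivable g p ey) ->
    Ck n ('D_ex g) -> Ck n ('D_ey g) -> Ck n.+1 g.

Lemma Ck_continuous n g : Ck n g -> continuous g.
Proof. by case. Qed.

Lemma CkSE n g : Ck n.+1 g -> [/\ forall p, derivable g p ex,
  forall p, derivable g p ey, Ck n ('D_ex g) & Ck n ('D_ey g)].
Proof. by move=> H; inversion H; split. Qed.

Lemma CkS n g : Ck n.+1 g -> Ck n g.
Proof.
elim: n g => [|n IH] g Cg; first exact: Ck_zero (Ck_continuous Cg).
have [dx dy Cx Cy] := CkSE Cg.
exact: Ck_succ (Ck_continuous Cg) dx dy (IH _ Cx) (IH _ Cy).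
Qed.

Definition dir v := v = ex \/ v = ey.

Lemma Ck_derivable n g v p : dir v -> Ck n.+1 g -> derivable g p v.
Proof. by move=> [] -> /CkSE[]. Qed.

Lemma Ck_derive n g v : dir v -> Ck n.+1 g -> Ck n ('D_v g).
Proof. by move=> [] -> /CkSE[]. Qed.

Lemma derive_funD f g v : (forall p, derivable f p v) ->
  (forall p, derivable g p v) -> 'D_v (f + g) = 'D_v f + 'D_v g.
Proof. by move=> df dg; apply/funext => p; rewrite deriveD. Qed.

Lemma derive_funZ (k : R) f v : (forall p, derivable f p v) ->
  'D_v (k *: f) = k *: 'D_v f.
Proof. by move=> df; apply/funext => p; rewrite deriveZ. Qed.

Lemma CkD n f g : Ck n f -> Ck n g -> Ck n (f + g).
Proof.
elim: n f g => [|n IH] f g Cf Cg.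
  apply: Ck_zero => p.
  apply: cvgD; [exact: (Ck_continuous Cf)|exact: (Ck_continuous Cg)].
have [fx fy Cfx Cfy] := CkSE Cf; have [gx gy Cgx Cgy] := CkSE Cg.
apply: Ck_succ.
- by move=> p; apply: cvgD; [exact: (Ck_continuous Cf)|exact: (Ck_continuous Cg)].
- by move=> p; exact: derivableD (fx p) (gx p).
- by move=> p; exact: derivableD (fy p) (gy p).
- by rewrite derive_funD//; exact: IH Cfx Cgx.
- by rewrite derive_funD//; exact: IH Cfy Cgy.
Qed.

Lemma CkZ n (k : R) f : Ck n f -> Ck n (k *: f).
Proof.
elim: n f => [|n IH] f Cf.
  by apply: Ck_zero => p; apply: cvgZr; exact: Ck_continuous Cf p.
have [fx fy Cfx Cfy] := CkSE Cf.
apply: Ck_succ.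
- by move=> p; apply: cvgZr; exact: Ck_continuous Cf p.
- by move=> p; exact: derivableZ (fx p).
- by move=> p; exact: derivableZ (fy p).
- by rewrite derive_funZ//; exact: IH Cfx.
- by rewrite derive_funZ//; exact: IH Cfy.
Qed.

Lemma Ck0 n : Ck n (0 : R * R -> R).
Proof.
have D0 v : 'D_v (0 : R * R -> R) = 0.
  by apply/funext => p; exact: derive_cst.
elim: n => [|n IH]; first by apply: Ck_zero => p; exact: cvg_cst.
apply: Ck_succ; rewrite ?D0; try exact: IH.
- by move=> p; exact: cvg_cst.
- by move=> p; exact: derivable_cst.
- by move=> p; exact: derivable_cst.
Qed.

Definition coord (l : R * R -> R) := l = fst \/ l = snd.

Lemma coord_is_derive l p v : coord l -> is_derive p v l (l v).
Proof.
have lim (a b : R) : h^-1 *: (h * a + b - b) @[h --> (0:R)^'] --> a.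
  apply: cvg_near_cst; near=> h; rewrite addrK scalerA mulVf ?scale1r//.
  by near: h; exact: nbhs_dnbhs_neq.
move=> [] ->; split.
- by apply/cvg_ex; exists v.1; exact: (lim v.1 p.1).
- by apply/cvg_lim => //; exact: (lim v.1 p.1).
- by apply/cvg_ex; exists v.2; exact: (lim v.2 p.2).
- by apply/cvg_lim => //; exact: (lim v.2 p.2).
Unshelve. all: by end_near.
Qed.

Lemma coord_continuous l : coord l -> continuous l.
Proof. by move=> [] -> p; [exact: cvg_fst|exact: cvg_snd]. Qed.

Lemma derive_coordM l g v : coord l -> (forall p, derivable g p v) ->
  'D_v (l * g) = l * 'D_v g + l v *: g.
Proof.
move=> cl dg; apply/funext => p.
have dl := coord_is_derive p v cl.
rewrite deriveM//= (@derive_val _ _ _ _ _ _ _ dl).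
by rewrite [g p *: _]mulrC.
Qed.

Lemma Ck_coordM l n g : coord l -> Ck n g -> Ck n (l * g).
Proof.
move=> cl; elim: n g => [|n IH] g Cg.
  apply: Ck_zero => p.
  apply: cvgM; [exact: coord_continuous|exact: (Ck_continuous Cg)].
have [gx gy Cgx Cgy] := CkSE Cg.
have dl v p : derivable l p v by have [] := coord_is_derive p v cl.
apply: Ck_succ.
- by move=> p; apply: cvgM; [exact: coord_continuous|exact: (Ck_continuous Cg)].
- by move=> p; exact: derivableM (dl _ p) (gx p).
- by move=> p; exact: derivableM (dl _ p) (gy p).
- rewrite derive_coordM//; apply: CkD (IH _ Cgx) _.
  exact: CkZ (CkS Cg).
- rewrite derive_coordM//; apply: CkD (IH _ Cgy) _.
  exact: CkZ (CkS Cg).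
Qed.

Lemma is_derive_ex g x y : derivable g (x, y) ex ->
  is_derive x 1 (fun s => g (s, y)) ('D_ex g (x, y)).
Proof.
have E : (fun h : R => h^-1 *: (((fun s => g (s, y)) \o shift x) (h *: 1)
      - g (x, y))) =
    (fun h : R => h^-1 *: ((g \o shift (x, y)) (h *: ex) - g (x, y))).
  apply/funext => h /=; congr (_ *: (g _ - _)).
  by rewrite /shift /= /ex; apply/pair_equal_spec; rewrite /= scaler0 add0r.
by rewrite /derivable /derive -E => dg; split.
Qed.

Lemma is_derive_ey g x y : derivable g (x, y) ey ->
  is_derive y 1 (fun s => g (x, s)) ('D_ey g (x, y)).
Proof.
have E : (fun h : R => h^-1 *: (((fun s => g (x, s)) \o shift y) (h *: 1)
      - g (x, y))) =
    (fun h : R => h^-1 *: ((g \o shift (x, y)) (h *: ey) - g (x, y))).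
  apply/funext => h /=; congr (_ *: (g _ - _)).
  by rewrite /shift /= /ey; apply/pair_equal_spec; rewrite /= scaler0 add0r.
by rewrite /derivable /derive -E => dg; split.
Qed.

Lemma mvt1 (f df : R -> R) (a t : R) : 0 < t ->
  (forall x : R, is_derive x (1 : R) f (df x)) ->
  exists2 c, `|a - c| < t & f (a + t) - f a = t * df c.
Proof.
move=> t0 fdf; have at0 : a < a + t by rewrite ltrDl.
have [|c] := @MVT _ f df a (a + t) at0 (fun x _ => fdf x).
  apply: derivable_within_continuous => x _.
  exact: (@ex_derive _ _ _ _ _ _ _ (fdf x)).
rewrite in_itv/= => /andP[ac ca] ->; exists c; last by rewrite addrAC subrr add0r mulrC.
by rewrite distrC gtr0_norm ?subr_gt0// ltrBlDl.
Qed.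

Lemma eq_of_close (A B : R * R -> R) : continuous A -> continuous B ->
  (forall a b t, 0 < t -> exists2 p, `|(a, b) - p| < t &
    exists2 q, `|(a, b) - q| < t & A p = B q) -> A = B.
Proof.
move=> cA cB key; apply/funext => -[a b]; apply/eqP; apply: contraT => AB.
set e := `|A (a, b) - B (a, b)| / 2.
have e0 : 0 < e by rewrite divr_gt0// normr_gt0 subr_eq0.
have /cvgrPdist_lt/(_ e e0) := cA (a, b).
have /cvgrPdist_lt/(_ e e0) := cB (a, b).
move=> /nbhs_normP[r1 /= r10 H1] /nbhs_normP[r2 /= r20 H2].
have [|p hp [q hq E]] := key a b (Num.min r1 r2).
  by rewrite lt_min r10 r20.
have h1 : `|B (a, b) - B q| < e.
  by apply: H1; rewrite /ball_/=; apply: lt_le_trans hq _; rewrite ge_min lexx.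
have h2 : `|A (a, b) - A p| < e.
  apply: H2; rewrite /ball_/=; apply: lt_le_trans hp _.
  by rewrite ge_min lexx orbT.
suff : `|A (a, b) - B (a, b)| < e + e by rewrite /e -splitr ltxx.
have -> : A (a, b) - B (a, b) = (A (a, b) - A p) - (B (a, b) - B q).
  by rewrite E opprB addrA subrK.
by apply: le_lt_trans (ler_normB _ _) _; exact: ltrD.
Qed.

Lemma schwarz g : Ck 2 g -> 'D_ex ('D_ey g) = 'D_ey ('D_ex g).
Proof.
move=> /CkSE[gx gy /CkSE[gxx gxy _ Cxy] /CkSE[gyx gyy Cyx _]].
apply: eq_of_close (Ck_continuous Cyx) (Ck_continuous Cxy) _ => a b t t0.
have [xi hxi] := @mvt1 (fun s => g (s, b + t) - g (s, b))
  (fun s => 'D_ex g (s, b + t) - 'D_ex g (s, b)) a t t0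
  (fun x => is_deriveB (is_derive_ex (gx _)) (is_derive_ex (gx _))).
have [eta heta ->] := @mvt1 (fun s => 'D_ex g (xi, s))
  (fun s => 'D_ey ('D_ex g) (xi, s)) b t t0
  (fun x => (is_derive_ey (gxy _))).
move=> E1.
have [eta' heta'] := @mvt1 (fun s => g (a + t, s) - g (a, s))
  (fun s => 'D_ey g (a + t, s) - 'D_ey g (a, s)) b t t0
  (fun x => is_deriveB (is_derive_ey (gy _)) (is_derive_ey (gy _))).
have [xi' hxi' ->] := @mvt1 (fun s => 'D_ey g (s, eta'))
  (fun s => 'D_ex ('D_ey g) (s, eta')) a t t0
  (fun x => (is_derive_ex (gyx _))).
move=> E2.
exists (xi', eta'); first by rewrite prod_normE/= gt_max hxi' heta'.
exists (xi, eta); first by rewrite prod_normE/= gt_max hxi heta.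
have tn0 : t != 0 by rewrite gt_eqF.
apply: (mulfI tn0); apply: (mulfI tn0).
apply: etrans (esym E2) _; apply: etrans _ E1.
move: (g (a + t, b + t)) (g (a + t, b)) (g (a, b + t)) (g (a, b)) => p q r s.
by rewrite !opprD !opprK addrACA.
Qed.

End Ck.

Section ComplexValued.
Context {R : realType}.
Local Notation C := R[i].
Implicit Types (f g : R * R -> C) (p v : R * R).
Local Notation CRe := (@complex.Re R).
Local Notation CIm := (@complex.Im R).

(* C is not a normed R-module in the library: a complex-valued function is
   differentiated through its real and imaginary parts. *)
Definition pd v f : R * R -> C :=
  fun p => ('D_v (CRe \o f) p +i* 'D_v (CIm \o f) p)%C.

(* \partial_x^h \partial_y^k f *)
Definition pdn (h k : nat) f : R * R -> C := iter h (pd ex) (iter k (pd ey) f).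

Definition smooth f := forall n, Ck n (CRe \o f) /\ Ck n (CIm \o f).

Lemma smooth_pd v f : dir v -> smooth f -> smooth (pd v f).
Proof.
by move=> dv sf n; have [Cr Ci] := sf n.+1; split;
  [exact: (Ck_derive dv Cr)|exact: (Ck_derive dv Ci)].
Qed.

Lemma smooth_iter v h f : dir v -> smooth f -> smooth (iter h (pd v) f).
Proof. by move=> dv sf; elim: h => // h IH; exact: smooth_pd. Qed.

Lemma dir_ex : dir (@ex R). Proof. by left. Qed.
Lemma dir_ey : dir (@ey R). Proof. by right. Qed.

Lemma Re_lin (c : C) f g : CRe \o (c *: f + g) =
  complex.Re c *: (CRe \o f) + ((- complex.Im c) *: (CIm \o f) + (CRe \o g)).
Proof.
apply/funext => p; change (complex.Re (c * f p + g p) =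
  complex.Re c * complex.Re (f p) +
  ((- complex.Im c) * complex.Im (f p) + complex.Re (g p))).
by case: c (f p) (g p) => [a b] [x y] [z t] /=; rewrite addrA mulNr.
Qed.

Lemma Im_lin (c : C) f g : CIm \o (c *: f + g) =
  complex.Re c *: (CIm \o f) + (complex.Im c *: (CRe \o f) + (CIm \o g)).
Proof.
apply/funext => p; change (complex.Im (c * f p + g p) =
  complex.Re c * complex.Im (f p) +
  (complex.Im c * complex.Re (f p) + complex.Im (g p))).
by case: c (f p) (g p) => [a b] [x y] [z t] /=; rewrite addrA.
Qed.

Lemma smooth_lin (c : C) f g : smooth f -> smooth g -> smooth (c *: f + g).
Proof.
move=> sf sg n; have [fr fi] := sf n; have [gr gi] := sg n.
rewrite Re_lin Im_lin; split.
  exact: CkD (CkZ _ fr) (CkD (CkZ _ fi) gr).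
exact: CkD (CkZ _ fi) (CkD (CkZ _ fr) gi).
Qed.

Lemma smooth0 : smooth (0 : R * R -> C).
Proof. by move=> n; split; exact: Ck0. Qed.

Lemma derive_lin (a b : R) (f g k : R * R -> R) v p : dir v ->
  Ck 1 f -> Ck 1 g -> Ck 1 k ->
  'D_v (a *: f + (b *: g + k)) p =
    a * 'D_v f p + (b * 'D_v g p + 'D_v k p).
Proof.
move=> dv Cf Cg Ck.
have df := Ck_derivable (p:=p) dv Cf; have dg := Ck_derivable (p:=p) dv Cg.
have dk := Ck_derivable (p:=p) dv Ck.
rewrite deriveD; [|exact: derivableZ|by apply: derivableD => //; exact: derivableZ].
by rewrite deriveD//; [rewrite !deriveZ|exact: derivableZ].
Qed.

Lemma pd_lin (c : C) f g v : dir v -> smooth f -> smooth g ->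
  pd v (c *: f + g) = c *: pd v f + pd v g.
Proof.
move=> dv sf sg; have [fr fi] := sf 1; have [gr gi] := sg 1.
apply/funext => p; rewrite /pd Re_lin Im_lin !derive_lin//.
change (((complex.Re c * 'D_v (CRe \o f) p + (- complex.Im c * 'D_v (CIm \o f) p
    + 'D_v (CRe \o g) p)) +i* (complex.Re c * 'D_v (CIm \o f) p +
      (complex.Im c * 'D_v (CRe \o f) p + 'D_v (CIm \o g) p)))%C =
  c * ('D_v (CRe \o f) p +i* 'D_v (CIm \o f) p)%C +
    ('D_v (CRe \o g) p +i* 'D_v (CIm \o g) p)%C).
move: ('D_v (CRe \o f) p) ('D_v (CIm \o f) p) => x y.
move: ('D_v (CRe \o g) p) ('D_v (CIm \o g) p) => z t.
case: c => a b; apply/eqP; rewrite eq_complex.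
by apply/andP; split; apply/eqP; rewrite /= addrA // mulNr.
Qed.

Lemma iter_pd_lin (c : C) f g v h : dir v -> smooth f -> smooth g ->
  iter h (pd v) (c *: f + g) = c *: iter h (pd v) f + iter h (pd v) g.
Proof.
move=> dv sf sg; elim: h => // h IH.
by rewrite !iterS IH pd_lin//; exact: smooth_iter.
Qed.

Lemma pdn_lin (c : C) f g h k : smooth f -> smooth g ->
  pdn h k (c *: f + g) = c *: pdn h k f + pdn h k g.
Proof.
move=> sf sg; have dx := dir_ex; have dy := dir_ey.
by rewrite /pdn iter_pd_lin// iter_pd_lin//; exact: smooth_iter.
Qed.

Lemma pd0 v : pd v 0 = 0 :> (R * R -> C).
Proof.
apply/funext => p; have D0 : 'D_v (cst (0 : R)) p = 0 by exact: derive_cst.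
by change (('D_v (cst (0 : R)) p +i* 'D_v (cst (0 : R)) p)%C = 0); rewrite D0.
Qed.

Lemma pdn0 h k : pdn h k 0 = 0 :> (R * R -> C).
Proof.
have I v n : iter n (pd v) 0 = 0 :> (R * R -> C).
  by elim: n => // n IH; rewrite iterS IH pd0.
by rewrite /pdn !I.
Qed.

Lemma pdC f : smooth f -> pd ex (pd ey f) = pd ey (pd ex f).
Proof.
move=> sf; have [fr fi] := sf 2; apply/funext => p.
change ('D_ex ('D_ey (CRe \o f)) p +i* 'D_ex ('D_ey (CIm \o f)) p =
  'D_ey ('D_ex (CRe \o f)) p +i* 'D_ey ('D_ex (CIm \o f)) p)%C.
exact: (f_equal2 (@Complex R) (congr1 (@^~ p) (schwarz fr))
  (congr1 (@^~ p) (schwarz fi))).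
Qed.

Lemma iter_pdC f k : smooth f ->
  iter k (pd ey) (pd ex f) = pd ex (iter k (pd ey) f).
Proof.
move=> sf; elim: k => // k IH.
by rewrite !iterS IH pdC//; exact: smooth_iter dir_ey sf.
Qed.

Definition cmul (l : R * R -> R) f : R * R -> C := fun p => (l p)%:C%C * f p.

Lemma Re_cmul l f : CRe \o cmul l f = l * (CRe \o f).
Proof.
apply/funext => p; change (complex.Re ((l p)%:C%C * f p) = l p * complex.Re (f p)).
by case: (f p) => x y /=; rewrite mul0r subr0.
Qed.

Lemma Im_cmul l f : CIm \o cmul l f = l * (CIm \o f).
Proof.
apply/funext => p; change (complex.Im ((l p)%:C%C * f p) = l p * complex.Im (f p)).
by case: (f p) => x y /=; rewrite mul0r addr0.
Qed.

Lemma smooth_cmul l f : coord l -> smooth f -> smooth (cmul l f).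
Proof.
move=> cl sf n; have [fr fi] := sf n.
by rewrite Re_cmul Im_cmul; split; exact: Ck_coordM.
Qed.

Lemma pd_cmul l f v : coord l -> dir v -> smooth f ->
  pd v (cmul l f) = (l v)%:C%C *: f + cmul l (pd v f).
Proof.
move=> cl dv sf; have [fr fi] := sf 1%N.
have dr p := Ck_derivable (p:=p) dv fr; have di p := Ck_derivable (p:=p) dv fi.
apply/funext => p; rewrite /pd Re_cmul Im_cmul.
have -> : 'D_v (l * (CRe \o f)) p = l p * 'D_v (CRe \o f) p +
    l v * complex.Re (f p) by exact: (congr1 (@^~ p) (derive_coordM cl dr)).
have -> : 'D_v (l * (CIm \o f)) p = l p * 'D_v (CIm \o f) p +
    l v * complex.Im (f p) by exact: (congr1 (@^~ p) (derive_coordM cl di)).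
change ((l p * 'D_v (CRe \o f) p + l v * complex.Re (f p)) +i*
  (l p * 'D_v (CIm \o f) p + l v * complex.Im (f p)) =
  (l v)%:C * f p +
    (l p)%:C * ('D_v (CRe \o f) p +i* 'D_v (CIm \o f) p))%C.
move: ('D_v (CRe \o f) p) ('D_v (CIm \o f) p) => z t.
case: (f p) => x y; apply/eqP; rewrite eq_complex.
by apply/andP; split; apply/eqP;
  rewrite /= !mul0r ?subr0 ?addr0 addrC.
Qed.

Lemma iter_pd_cmul l f v h : coord l -> dir v -> smooth f ->
  iter h (pd v) (cmul l f) =
  (h%:R * (l v)%:C%C) *: iter h.-1 (pd v) f + cmul l (iter h (pd v) f).
Proof.
move=> cl dv sf; elim: h => [|h IH]; first by rewrite mul0r scale0r add0r.
rewrite iterS IH pd_lin//; last 2 first.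
- exact: smooth_iter.
- by apply: smooth_cmul => //; exact: smooth_iter.
rewrite pd_cmul//; last exact: smooth_iter.
rewrite addrA; congr (_ + _); case: h {IH} => [|h].
  by rewrite mul0r scale0r add0r mul1r.
by rewrite -iterS -scalerDl -[X in _ + X]mul1r -mulrDl natr1.
Qed.

Lemma pdn_mulx f h k : smooth f ->
  pdn h k (cmul fst f) = h%:R *: pdn h.-1 k f + cmul fst (pdn h k f).
Proof.
move=> sf; rewrite /pdn iter_pd_cmul//; [|by left|exact: dir_ey].
rewrite mulr0 scale0r add0r iter_pd_cmul; [|by left|exact: dir_ex|].
  by rewrite mulr1.
exact: smooth_iter dir_ey sf.
Qed.

Lemma pdn_muly f h k : smooth f ->
  pdn h k (cmul snd f) = k%:R *: pdn h k.-1 f + cmul snd (pdn h k f).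
Proof.
move=> sf; rewrite /pdn iter_pd_cmul//; [|by right|exact: dir_ey].
rewrite mulr1 iter_pd_lin; [|exact: dir_ex| |]; last 2 first.
- exact: smooth_iter dir_ey sf.
- by apply: smooth_cmul; [right|exact: smooth_iter dir_ey sf].
rewrite iter_pd_cmul; [|by right|exact: dir_ex|exact: smooth_iter dir_ey sf].
by rewrite mulr0 scale0r add0r.
Qed.

Lemma pdn_pdx f h k : smooth f -> pdn h k (pd ex f) = pdn h.+1 k f.
Proof. by move=> sf; rewrite /pdn iter_pdC// iterSr. Qed.

Lemma pdn_pdy f h k : pdn h k (pd ey f) = pdn h k.+1 f.
Proof. by rewrite /pdn [in RHS]iterSr. Qed.

End ComplexValued.

Section SchwartzSpace.
Context {R : realType}.
Local Notation C := R[i].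
Implicit Types (f g : R * R -> C) (p : R * R).

Definition weighted (a b h k : nat) f : R * R -> R :=
  fun p => `|p.1| ^+ a * `|p.2| ^+ b * normc (pdn h k f p).

Definition is_schwartz f : Prop :=
  smooth f /\ forall a b h k, has_ubound (range (weighted a b h k f)).

Definition seminorm (a b h k : nat) f : R := sup (range (weighted a b h k f)).

Lemma normc_ge0 (z : C) : 0 <= normc z.
Proof. by case: z => x y /=; exact: sqrtr_ge0. Qed.

Lemma normc_triangle (y z : C) : normc (y + z) <= normc y + normc z.
Proof. exact: le_normcD. Qed.

Lemma normc_real (x : R) : normc (x%:C)%C = `|x|.
Proof. by rewrite /= expr0n addr0 sqrtr_sqr. Qed.

Lemma normc_nat n : normc (n%:R : C) = n%:R.
Proof. by rewrite -(rmorph_nat (real_complex R)) normc_real normr_nat. Qed.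

Lemma weighted_ge0 a b h k f p : 0 <= weighted a b h k f p.
Proof. by rewrite !mulr_ge0 ?exprn_ge0 ?normc_ge0. Qed.

Lemma weighted_le_seminorm a b h k f p : is_schwartz f ->
  weighted a b h k f p <= seminorm a b h k f.
Proof. by move=> [_ /(_ a b h k) ub]; apply: ub_le_sup => //; exists p. Qed.

Lemma seminorm_le a b h k f (K : R) :
  (forall p, weighted a b h k f p <= K) -> seminorm a b h k f <= K.
Proof.
move=> le; apply: ge_sup; first by exists (weighted a b h k f 0), 0.
by move=> _ [p _ <-].
Qed.

Lemma seminorm_ge0 a b h k f : is_schwartz f -> 0 <= seminorm a b h k f.
Proof.
move=> sf; apply: le_trans (weighted_ge0 _ _ _ _ _ 0) _.
exact: weighted_le_seminorm sf.
Qed.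

Lemma weighted_lin a b h k (c : C) f g p : smooth f -> smooth g ->
  weighted a b h k (c *: f + g) p <=
  normc c * weighted a b h k f p + weighted a b h k g p.
Proof.
move=> sf sg; rewrite /weighted pdn_lin// mulrCA -mulrDr; apply: ler_wpM2l.
  by rewrite mulr_ge0 ?exprn_ge0.
rewrite -normcM; exact: normc_triangle.
Qed.

Lemma weighted_mulx a b h k f p : smooth f ->
  weighted a b h k (cmul fst f) p <=
  h%:R * weighted a b h.-1 k f p + weighted a.+1 b h k f p.
Proof.
move=> sf; rewrite /weighted pdn_mulx//.
have -> : `|p.1| ^+ a.+1 * `|p.2| ^+ b * normc (pdn h k f p) =
    `|p.1| ^+ a * `|p.2| ^+ b * normc (cmul fst (pdn h k f) p).
  by rewrite /cmul normcM normc_real exprSr -!mulrA; congr (_ * _); rewrite mulrCA.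
rewrite mulrCA -mulrDr; apply: ler_wpM2l; first by rewrite mulr_ge0 ?exprn_ge0.
by rewrite -normc_nat -normcM; exact: normc_triangle.
Qed.

Lemma weighted_muly a b h k f p : smooth f ->
  weighted a b h k (cmul snd f) p <=
  k%:R * weighted a b h k.-1 f p + weighted a b.+1 h k f p.
Proof.
move=> sf; rewrite /weighted pdn_muly//.
have -> : `|p.1| ^+ a * `|p.2| ^+ b.+1 * normc (pdn h k f p) =
    `|p.1| ^+ a * `|p.2| ^+ b * normc (cmul snd (pdn h k f) p).
  by rewrite /cmul normcM normc_real exprSr -!mulrA.
rewrite mulrCA -mulrDr; apply: ler_wpM2l; first by rewrite mulr_ge0 ?exprn_ge0.
by rewrite -normc_nat -normcM; exact: normc_triangle.
Qed.

Lemma is_schwartz_bounded f : smooth f ->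
  (forall a b h k, exists K : R, forall p, weighted a b h k f p <= K) ->
  is_schwartz f.
Proof.
move=> sf H; split => // a b h k; have [K HK] := H a b h k.
by exists K => _ [p _ <-].
Qed.

Lemma is_schwartz0 : is_schwartz 0.
Proof.
apply: is_schwartz_bounded; first exact: smooth0.
move=> a b h k; exists 0 => p.
by rewrite /weighted pdn0 normc0 mulr0.
Qed.

Lemma is_schwartz_lin (c : C) f g :
  is_schwartz f -> is_schwartz g -> is_schwartz (c *: f + g).
Proof.
move=> sf sg; apply: is_schwartz_bounded; first exact: smooth_lin sf.1 sg.1.
move=> a b h k.
exists (normc c * seminorm a b h k f + seminorm a b h k g) => p.
apply: le_trans (weighted_lin _ _ _ _ _ _ sf.1 sg.1) _.
apply: lerD; last exact: weighted_le_seminorm.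
by rewrite ler_wpM2l ?normc_ge0//; exact: weighted_le_seminorm.
Qed.

Lemma seminorm_mulx_bound a b h k f p : is_schwartz f ->
  weighted a b h k (cmul fst f) p <=
  h%:R * seminorm a b h.-1 k f + seminorm a.+1 b h k f.
Proof.
move=> sf; apply: le_trans (weighted_mulx _ _ _ _ _ sf.1) _.
apply: lerD; last exact: weighted_le_seminorm.
by rewrite ler_wpM2l//; exact: weighted_le_seminorm.
Qed.

Lemma seminorm_muly_bound a b h k f p : is_schwartz f ->
  weighted a b h k (cmul snd f) p <=
  k%:R * seminorm a b h k.-1 f + seminorm a b.+1 h k f.
Proof.
move=> sf; apply: le_trans (weighted_muly _ _ _ _ _ sf.1) _.
apply: lerD; last exact: weighted_le_seminorm.
by rewrite ler_wpM2l//; exact: weighted_le_seminorm.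
Qed.

Lemma is_schwartz_mulx f : is_schwartz f -> is_schwartz (cmul fst f).
Proof.
move=> sf; apply: is_schwartz_bounded.
  by apply: smooth_cmul sf.1; left.
by move=> a b h k; eexists => p; exact: seminorm_mulx_bound.
Qed.

Lemma is_schwartz_muly f : is_schwartz f -> is_schwartz (cmul snd f).
Proof.
move=> sf; apply: is_schwartz_bounded.
  by apply: smooth_cmul sf.1; right.
by move=> a b h k; eexists => p; exact: seminorm_muly_bound.
Qed.

Lemma weighted_pdx a b h k f : smooth f ->
  weighted a b h k (pd ex f) = weighted a b h.+1 k f.
Proof. by move=> sf; rewrite /weighted pdn_pdx. Qed.

Lemma weighted_pdy a b h k f : weighted a b h k (pd ey f) = weighted a b h k.+1 f.
Proof. by rewrite /weighted pdn_pdy. Qed.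

Lemma is_schwartz_pdx f : is_schwartz f -> is_schwartz (pd ex f).
Proof.
move=> [sf bf]; split; first exact: smooth_pd dir_ex sf.
by move=> a b h k; rewrite weighted_pdx.
Qed.

Lemma is_schwartz_pdy f : is_schwartz f -> is_schwartz (pd ey f).
Proof.
move=> [sf bf]; split; first exact: smooth_pd dir_ey sf.
by move=> a b h k; rewrite weighted_pdy.
Qed.

Definition schwartz_pred : {pred R * R -> C} := fun f => `[< is_schwartz f >].

Lemma schwartz_submod : submod_closed schwartz_pred.
Proof.
split; first by apply/asboolP; exact: is_schwartz0.
move=> c f g /asboolP sf /asboolP sg; apply/asboolP; exact: is_schwartz_lin.
Qed.

HB.instance Definition _ :=
  GRing.isSubmodClosed.Build C (R * R -> C) schwartz_pred schwartz_submod.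

End SchwartzSpace.

(* The Schwartz space S(R^2) of complex-valued functions. *)
Record schwartz (R : realType) := Schwartz {
  schwartz_fun :> R * R -> R[i] ;
  schwartz_funP : schwartz_fun \in @schwartz_pred R }.

HB.instance Definition _ (R : realType) := [isSub for @schwartz_fun R].
HB.instance Definition _ (R : realType) := [Choice of schwartz R by <:].
HB.instance Definition _ (R : realType) :=
  [SubChoice_isSubLmodule of schwartz R by <:].

Section SchwartzOperators.
Context {R : realType}.
Local Notation C := R[i].
Implicit Types f g : schwartz R.

Lemma schwartzP f : is_schwartz f.
Proof. by have /asboolP := schwartz_funP f. Qed.

Lemma schwartz_inj f g : (forall p, f p = g p) -> f = g.
Proof. by move=> fg; apply: val_inj; exact/funext. Qed.

Definition schwartz_of (f : R * R -> C) (sf : is_schwartz f) : schwartz R :=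
  Schwartz (introT (asboolP _) sf).

Definition smulx f : schwartz R := schwartz_of (is_schwartz_mulx (schwartzP f)).
Definition smuly f : schwartz R := schwartz_of (is_schwartz_muly (schwartzP f)).
Definition spdx f : schwartz R := schwartz_of (is_schwartz_pdx (schwartzP f)).
Definition spdy f : schwartz R := schwartz_of (is_schwartz_pdy (schwartzP f)).

Lemma smulx_linear : linear smulx.
Proof.
move=> c f g; apply: schwartz_inj => p.
change ((p.1)%:C%C * (c * f p + g p) = c * ((p.1)%:C%C * f p) + (p.1)%:C%C * g p).
by rewrite mulrDr mulrCA.
Qed.

Lemma smuly_linear : linear smuly.
Proof.
move=> c f g; apply: schwartz_inj => p.
change ((p.2)%:C%C * (c * f p + g p) = c * ((p.2)%:C%C * f p) + (p.2)%:C%C * g p).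
by rewrite mulrDr mulrCA.
Qed.

Lemma spdx_linear : linear spdx.
Proof.
move=> c f g; apply: val_inj.
exact: (pd_lin c dir_ex (schwartzP f).1 (schwartzP g).1).
Qed.

Lemma spdy_linear : linear spdy.
Proof.
move=> c f g; apply: val_inj.
exact: (pd_lin c dir_ey (schwartzP f).1 (schwartzP g).1).
Qed.

HB.instance Definition _ :=
  GRing.isLinear.Build C (schwartz R) (schwartz R) _ smulx smulx_linear.
HB.instance Definition _ :=
  GRing.isLinear.Build C (schwartz R) (schwartz R) _ smuly smuly_linear.
HB.instance Definition _ :=
  GRing.isLinear.Build C (schwartz R) (schwartz R) _ spdx spdx_linear.
HB.instance Definition _ :=
  GRing.isLinear.Build C (schwartz R) (schwartz R) _ spdy spdy_linear.

Definition snorm (N : nat) (f : R * R -> C) : R :=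
  \sum_(a < N.+1) \sum_(b < N.+1) \sum_(h < N.+1) \sum_(k < N.+1)
    seminorm a b h k f.

Lemma ler_term_sum n (F : 'I_n -> R) i : (forall j, 0 <= F j) ->
  F i <= \sum_(j < n) F j.
Proof. by move=> F0; rewrite (bigD1 i)//= lerDl sumr_ge0. Qed.

Lemma seminorm_le_snorm N a b h k f : (a <= N)%N -> (b <= N)%N ->
  (h <= N)%N -> (k <= N)%N -> seminorm a b h k f <= snorm N f.
Proof.
rewrite -4!(ltnS _ N) => aN bN hN kN.
have s0 a' b' h' k' := @seminorm_ge0 R a' b' h' k' f (schwartzP f).
apply: le_trans (ler_term_sum (Ordinal aN) _) => /=; last first.
  by move=> j; do 3 (apply: sumr_ge0 => ? _).
apply: le_trans (ler_term_sum (Ordinal bN) _) => /=; last first.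
  by move=> j; do 2 (apply: sumr_ge0 => ? _).
apply: le_trans (ler_term_sum (Ordinal hN) _) => /=; last first.
  by move=> j; apply: sumr_ge0 => ? _.
by apply: le_trans (ler_term_sum (Ordinal kN) _) => /=.
Qed.

Lemma snorm_ge0 N f : 0 <= snorm N f.
Proof. by do 4 (apply: sumr_ge0 => ? _); exact: seminorm_ge0 (schwartzP f). Qed.

Lemma ler_sum_const n (F : 'I_n -> R) (K : R) : (forall j, F j <= K) ->
  \sum_(j < n) F j <= n%:R * K.
Proof.
move=> FK; apply: le_trans (ler_sum _ (fun j _ => FK j)) _.
by rewrite sumr_const card_ord mulr_natl.
Qed.

Lemma snorm_le N f (K : R) :
  (forall a b h k, (a <= N)%N -> (b <= N)%N -> (h <= N)%N -> (k <= N)%N ->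
    seminorm a b h k f <= K) -> snorm N f <= N.+1%:R ^+ 4 * K.
Proof.
move=> H; rewrite !exprS expr0 mulr1 -!mulrA.
do 4 (apply: ler_sum_const => ?).
by apply: H; rewrite -ltnS.
Qed.

Definition scontinuous (A : schwartz R -> schwartz R) := forall N,
  exists K M, 0 <= K /\ forall f, snorm N (A f) <= K * snorm M f.

Lemma scontinuous_bound (A : schwartz R -> schwartz R) :
  (forall N, exists2 K : R, 0 <= K &
    forall a b h k f, (a <= N)%N -> (b <= N)%N -> (h <= N)%N -> (k <= N)%N ->
    seminorm a b h k (A f) <= K * snorm N.+1 f) -> scontinuous A.
Proof.
move=> H N; have [K K0 HK] := H N.
exists (N.+1%:R ^+ 4 * K), N.+1; split; first by rewrite mulr_ge0// exprn_ge0.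
by move=> f; rewrite -mulrA; apply: snorm_le => a b h k *; exact: HK.
Qed.

Lemma smulx_continuous : scontinuous smulx.
Proof.
apply: scontinuous_bound => N; exists N.+1%:R => // a b h k f aN bN hN kN.
apply: seminorm_le => p.
apply: le_trans (seminorm_mulx_bound _ _ _ _ _ (schwartzP f)) _.
rewrite -natr1 mulrDl mul1r lerD//; last first.
  by apply: seminorm_le_snorm; rewrite ?ltnS// ltnW// ltnS.
apply: ler_pM => //; first exact: seminorm_ge0 (schwartzP f).
  by rewrite ler_nat.
apply: seminorm_le_snorm; rewrite ?ltnS; try (by rewrite ltnW// ltnS).
by apply: leq_trans (leq_pred _) _; rewrite ltnW// ltnS.
Qed.

Lemma smuly_continuous : scontinuous smuly.
Proof.
apply: scontinuous_bound => N; exists N.+1%:R => // a b h k f aN bN hN kN.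
apply: seminorm_le => p.
apply: le_trans (seminorm_muly_bound _ _ _ _ _ (schwartzP f)) _.
rewrite -natr1 mulrDl mul1r lerD//; last first.
  by apply: seminorm_le_snorm; rewrite ?ltnS// ltnW// ltnS.
apply: ler_pM => //; first exact: seminorm_ge0 (schwartzP f).
  by rewrite ler_nat.
apply: seminorm_le_snorm; rewrite ?ltnS; try (by rewrite ltnW// ltnS).
by apply: leq_trans (leq_pred _) _; rewrite ltnW// ltnS.
Qed.

Lemma spdx_continuous : scontinuous spdx.
Proof.
apply: scontinuous_bound => N; exists 1 => // a b h k f aN bN hN kN.
rewrite mul1r /seminorm /= weighted_pdx; last exact: (schwartzP f).1.
by apply: seminorm_le_snorm; rewrite ?ltnS// ltnW// ltnS.
Qed.

Lemma spdy_continuous : scontinuous spdy.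
Proof.
apply: scontinuous_bound => N; exists 1 => // a b h k f aN bN hN kN.
rewrite mul1r /seminorm /= weighted_pdy.
by apply: seminorm_le_snorm; rewrite ?ltnS// ltnW// ltnS.
Qed.

(* Continuity for the Frechet topology of S(R^2), as a bound by one of the
   increasing norms snorm N that define it. *)
Definition is_tempered (u : schwartz R -> C) : Prop :=
  scalar u /\ exists (K : R) (N : nat), forall f, normc (u f) <= K * snorm N f.

Definition tempered_pred : {pred schwartz R -> C} := fun u => `[< is_tempered u >].

Lemma is_tempered_lin (c : C) (u v : schwartz R -> C) :
  is_tempered u -> is_tempered v -> is_tempered (c *: u + v).
Proof.
move=> [lu [K [N uK]]] [lv [K' [N' vK']]]; split.
  move=> d f g.
  change (c * u (d *: f + g) + v (d *: f + g) =
    d * (c * u f + v f) + (c * u g + v g)).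
  by rewrite lu lv !mulrDr addrACA !mulrA [d * c]mulrC.
have mono n f : (n <= maxn N N')%N ->
    snorm n f <= n.+1%:R ^+ 4 * snorm (maxn N N') f.
  move=> nN; apply: snorm_le => a b h k *.
  by apply: seminorm_le_snorm; apply: leq_trans nN.
exists (normc c * (`|K| * N.+1%:R ^+ 4) + `|K'| * N'.+1%:R ^+ 4), (maxn N N').
move=> f; apply: le_trans (normc_triangle _ _) _.
rewrite mulrDl lerD//.
  rewrite normcM -2!mulrA ler_wpM2l ?normc_ge0//.
  apply: le_trans (uK f) _; apply: le_trans (ler_wpM2r (snorm_ge0 _ _) (ler_norm _)) _.
  by rewrite ler_wpM2l// mono// leq_maxl.
rewrite -mulrA; apply: le_trans (vK' f) _.
apply: le_trans (ler_wpM2r (snorm_ge0 _ _) (ler_norm _)) _.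
by rewrite ler_wpM2l// mono// leq_maxr.
Qed.

Lemma is_tempered0 : is_tempered 0.
Proof.
split; first by move=> c f g; rewrite /= mulr0 addr0.
by exists 0, 0%N => f; rewrite mul0r normc0.
Qed.

Lemma tempered_submod : submod_closed tempered_pred.
Proof.
split; first by apply/asboolP; exact: is_tempered0.
move=> c u v /asboolP tu /asboolP tv; apply/asboolP; exact: is_tempered_lin.
Qed.

HB.instance Definition _ :=
  GRing.isSubmodClosed.Build C (schwartz R -> C) tempered_pred tempered_submod.

Lemma is_tempered_comp (u : schwartz R -> C) (A : {linear schwartz R -> schwartz R}) :
  scontinuous A -> is_tempered u -> is_tempered (u \o A).
Proof.
move=> cA [lu [K [N uK]]]; split.
  by move=> c f g; rewrite /= linearP lu.
have [K' [M [K'0 AK']]] := cA N.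
exists (`|K| * K'), M => f; apply: le_trans (uK _) _.
apply: le_trans (ler_wpM2r (snorm_ge0 _ _) (ler_norm _)) _.
by rewrite -mulrA ler_wpM2l.
Qed.

End SchwartzOperators.

(* S'(R^2) *)
Record tempered (R : realType) := Tempered {
  tempered_fun :> schwartz R -> R[i] ;
  tempered_funP : tempered_fun \in @tempered_pred R }.

HB.instance Definition _ (R : realType) := [isSub for @tempered_fun R].
HB.instance Definition _ (R : realType) := [Choice of tempered R by <:].
HB.instance Definition _ (R : realType) :=
  [SubChoice_isSubLmodule of tempered R by <:].

Section TemperedOperators.
Context {R : realType}.
Local Notation C := R[i].
Implicit Types u v : tempered R.

Lemma temperedP u : is_tempered u.
Proof. by have /asboolP := tempered_funP u. Qed.

Lemma tempered_inj u v : (forall f, u f = v f) -> u = v.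
Proof. by move=> uv; apply: val_inj; exact/funext. Qed.

(* The transpose of a continuous linear operator on S(R^2). *)
Definition transpose (A : {linear schwartz R -> schwartz R})
    (cA : scontinuous A) u : tempered R :=
  Tempered (introT (asboolP _) (is_tempered_comp cA (temperedP u))).

Lemma transpose_linear (A : {linear schwartz R -> schwartz R})
    (cA : scontinuous A) : linear (transpose cA).
Proof. by move=> c u v; exact: tempered_inj. Qed.

HB.instance Definition _ (A : {linear schwartz R -> schwartz R})
    (cA : scontinuous A) :=
  GRing.isLinear.Build C (tempered R) (tempered R) _ (transpose cA)
    (transpose_linear cA).

(* By duality, <x u, f> = <u, x f> and, as D_x = - i \partial_x,
   <D_x u, f> = - <u, D_x f> = i <u, \partial_x f>. *)
Definition M1 : {linear tempered R -> tempered R} := transpose smulx_continuous.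
Definition M2 : {linear tempered R -> tempered R} := transpose smuly_continuous.
Definition D1 : {linear tempered R -> tempered R} :=
  'i%C \*: transpose spdx_continuous.
Definition D2 : {linear tempered R -> tempered R} :=
  'i%C \*: transpose spdy_continuous.

(* S(R^2) is embedded in S'(R^2) by the bilinear pairing f |-> \int g f. *)
Definition in_schwartz u : Prop := exists g : schwartz R, forall f : schwartz R,
  let mu := (@lebesgue_measure R \x @lebesgue_measure R)%E in
  u f = (\int[mu]_p complex.Re (g p * f p)
      +i* \int[mu]_p complex.Im (g p * f p))%C.

Definition regular (A : {linear tempered R -> tempered R}) : Prop :=
  forall u, in_schwartz (A u) -> in_schwartz u.

End TemperedOperators.

Arguments M1 {R}.
Arguments M2 {R}.
Arguments D1 {R}.
Arguments D2 {R}.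

Section PolynomialsInOperators.
Context {K : comNzRingType} {V : lmodType K}.

(* The substitution X_i := A i in B, each monomial being the ordered product
   A_0^(m_0) \o A_1^(m_1) \o ... (the A i need not commute). *)
Definition mpoly_op n (B : mpoly n K) (A : 'I_n -> {linear V -> V}) : V -> V :=
  fun u => \sum_(m <- msupp B)
    mcoeff m B *: (\big[comp/idfun]_(i < n) iter (m i) (A i)) u.

Lemma mpoly_op_linear n (B : mpoly n K) A : linear (mpoly_op B A).
Proof.
have lin_iter (f : {linear V -> V}) k : linear (iter k f).
  by elim: k => // k IH a u v; rewrite !iterS IH linearP.
have lin_mon (m : multinom n) :
    linear (\big[comp/idfun]_(i < n) iter (m i) (A i)).
  apply: (big_ind (fun f : V -> V => linear f)) => //.
  by move=> f g lf lg a u v; rewrite /= lg lf.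
move=> a u v; rewrite /mpoly_op scaler_sumr -big_split/=.
apply: eq_bigr => m _; rewrite lin_mon scalerDr; congr (_ + _).
by rewrite !scalerA mulrC.
Qed.

HB.instance Definition _ n (B : mpoly n K) A :=
  GRing.isLinear.Build K V V _ (mpoly_op B A) (mpoly_op_linear B A).

Definition op2 (B : mpoly 2 K) (A1 A2 : {linear V -> V}) : {linear V -> V} :=
  mpoly_op B (tnth [tuple A1; A2]).

Definition op4 (B : mpoly 4 K) (X1 X2 Y1 Y2 : {linear V -> V}) :
    {linear V -> V} :=
  mpoly_op B (tnth [tuple X1; X2; Y1; Y2]).

End PolynomialsInOperators.

(* Main.v *)
(* If T is a linear bijection of S'(R^2) such that T u is in S(R^2) exactly when u
   is, then T transfers regularity from an operator A to T^-1 A T. Two kinds of T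
   suffice: the Fourier transform F, with F D_j = M_j F and F M_j = - D_j F, and the
   multiplication by exp(iq) for a real polynomial q, which fixes M_j and turns D_j
   into D_j - (d_j q)(M). Applying F and then exp(iP) turns M_j - P_j into - D_j and
   D_j into M_j, which eliminates P. The four operators that remain are linear in
   M_1, M_2, D_1, D_2 and satisfy the canonical commutation relations; quadratic
   phases and three more Fourier transforms bring them to M_1, M_2, D_1, D_2.
   That F is bijective follows from F F f(p) = (2 pi)^2 f(-p), proved by pairing the
   transform of f with modulated Gaussians that become wider and wider. *)
From HB Require Import structures.
Require Import Defs.
From mathcomp Require Import all_boot all_order all_algebra.
From mathcomp Require Import all_classical all_reals all_analysis.
From mathcomp Require Import measurable_realfun complex ring lra.
From mathcomp Require Import -(notations) mpoly.
Set Implicit Arguments.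
Unset Strict Implicit.
Unset Printing Implicit Defensive.
Import Order.TTheory GRing.Theory Num.Theory numFieldNormedType.Exports.
Import ComplexField.Normc.
Local Open Scope classical_set_scope.
Local Open Scope ring_scope.

(** * Complex-valued integrals *)

(** No inverse of T is ever formed: regularity passes from A' to A as soon as T A = A' T and T u
    lies in S(R^2) exactly when u does. For F the harder half of this equivalence comes from F^4 =
    (2 pi)^4, by transforming three more times. Operators on S'(R^2) are transposes, so every
    relation is checked on test functions. This requires exp(iq) and F to map S(R^2) continuously
    into itself, which is the main analytic burden. It is met by one device: in a family of
    functions closed under the two derivatives and the two multiplications by coordinates, every
    Schwartz seminorm of a member is the sup norm of another member, so that boundedness of the
    members suffices. Polynomials times Gaussians, the products exp(iq) f and the transforms of
    Schwartz functions are three such families. P is real, so exp(iP) has modulus one and leaves sup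
    norms unchanged. The last reduction works because the symplectic group is generated by the
    symmetric shears D -> D + S M and the rotation (M, D) -> (-D, M), which are realised by
    quadratic phases and by F. *)

Section Cis.
Context {R : realType}.
Local Notation C := R[i].
Implicit Types (x y s t : R) (z : C).

Lemma normr_Re_le z : `|complex.Re z| <= normc z.
Proof.
case: z => x y /=; rewrite -sqrtr_sqr; apply: ler_wsqrtr; by rewrite lerDl sqr_ge0.
Qed.

Lemma normr_Im_le z : `|complex.Im z| <= normc z.
Proof.
case: z => x y /=; rewrite -sqrtr_sqr; apply: ler_wsqrtr; by rewrite lerDr sqr_ge0.
Qed.

Lemma normc_le_ReIm z : normc z <= `|complex.Re z| + `|complex.Im z|.
Proof.
case: z => x y /=; rewrite -[leRHS]ger0_norm ?addr_ge0// -sqrtr_sqr; apply: ler_wsqrtr.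
rewrite sqrrD !real_normK ?num_real// [leRHS]addrAC lerDl.
by rewrite mulrn_wge0// mulr_ge0.
Qed.

Lemma normr_sin_le x : `|sin x| <= `|x|.
Proof.
wlog x0 : x / 0 < x.
  move=> H; have [x0|/H//|->] := ltgtP x 0; last by rewrite sin0.
  by rewrite -normrN -sinN -(normrN x) H// oppr_gt0.
have [|c _] := @MVT _ sin cos 0 x x0 (fun x _ => is_derive_sin x).
  by apply: continuous_subspaceT; exact: continuous_sin.
by rewrite sin0 !subr0 => ->; rewrite normrM ler_piMl// cos_max.
Qed.

Lemma normr_cosB1_le x : `|cos x - 1| <= `|x|.
Proof.
wlog x0 : x / 0 < x.
  move=> H; have [x0|/H//|->] := ltgtP x 0; last by rewrite cos0 subrr normr0.
  by rewrite -cosN -(normrN x) H// oppr_gt0.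
have [|c _] := @MVT _ cos (- sin) 0 x x0 (fun x _ => is_derive_cos x).
  by apply: continuous_subspaceT; exact: continuous_cos.
rewrite cos0 !subr0 => ->; rewrite normrM ler_piMl//.
by rewrite /= normrN sin_max.
Qed.

Lemma normr_sinB_le x : `|sin x - x| <= x ^+ 2.
Proof.
wlog x0 : x / 0 < x.
  move=> H; have [x0|/H//|->] := ltgtP x 0; last first.
    by rewrite sin0 subr0 normr0 expr0n.
  by rewrite -normrN opprD -sinN -(sqrrN x) H// oppr_gt0.
have [|c] := @MVT _ (sin - id) (fun t => cos t - 1) 0 x x0.
  apply: continuous_subspaceT => t; apply: cvgB; last exact: cvg_id.
  exact: continuous_sin.
rewrite in_itv/= => /andP[c0 cx].
have -> : (sin - id) x - (sin - id) 0 = sin x - x :> R.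
  by rewrite -[(sin - id) x]/(sin x - x) -[(sin - id) 0]/(sin 0 - 0) sin0 !subr0.
rewrite subr0 => ->; rewrite normrM expr2 (gtr0_norm x0).
apply: ler_wpM2r; first exact: ltW.
apply: le_trans (normr_cosB1_le _) _; rewrite gtr0_norm//; exact: ltW.
Qed.

Lemma normr_cosB1_le_sqr x : `|cos x - 1| <= x ^+ 2.
Proof.
wlog x0 : x / 0 < x.
  move=> H; have [x0|/H//|->] := ltgtP x 0; last first.
    by rewrite cos0 subrr normr0 expr0n.
  by rewrite -cosN -(sqrrN x) H// oppr_gt0.
have [|c] := @MVT _ cos (- sin) 0 x x0 (fun x _ => is_derive_cos x).
  by apply: continuous_subspaceT; exact: continuous_cos.
rewrite in_itv/= => /andP[c0 cx].
rewrite cos0 !subr0 => ->; rewrite normrM expr2 (gtr0_norm x0).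
apply: ler_wpM2r; first exact: ltW.
rewrite /= normrN.
apply: le_trans (normr_sin_le _) _; rewrite gtr0_norm//; exact: ltW.
Qed.

Definition cis t : C := (cos t +i* sin t)%C.

Lemma cis0 : cis 0 = 1.
Proof. by rewrite /cis cos0 sin0. Qed.

Lemma cisD s t : cis (s + t) = cis s * cis t.
Proof. by rewrite /cis cosD sinD; apply/eqP; rewrite eq_complex /= eqxx addrC eqxx. Qed.

Lemma normc_cis t : normc (cis t) = 1.
Proof. by rewrite /= cos2Dsin2 sqrtr1. Qed.

Lemma normc_cisB1_le t : normc (cis t - 1) <= 2 * `|t|.
Proof.
apply: le_trans (normc_le_ReIm _) _; rewrite /= oppr0 addr0.
by rewrite mulr_natl mulr2n lerD ?normr_cosB1_le ?normr_sin_le.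
Qed.

(** This second order remainder, integrated against a Schwartz function, is what differentiates the
    Fourier integral: an explicit O(t^2) replaces a limit under the integral sign. *)
Lemma normc_cis_taylor t : normc (cis t - 1 - 'i%C * t%:C%C) <= 2 * t ^+ 2.
Proof.
apply: le_trans (normc_le_ReIm _) _.
rewrite /= !mul0r !mul1r !subr0 add0r mulr_natl mulr2n lerD//.
  exact: normr_cosB1_le_sqr.
exact: normr_sinB_le.
Qed.

End Cis.

Section ComplexIntegral.
Context d (T : measurableType d) (R : realType).
Local Notation C := R[i].
Implicit Types (h k : T -> C).

Definition cmeasurable h := measurable_fun setT (@complex.Re R \o h) /\
  measurable_fun setT (@complex.Im R \o h).

Lemma cmeasurableD h k : cmeasurable h -> cmeasurable k ->
  cmeasurable (fun p => h p + k p).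
Proof.
move=> [hr hi] [kr ki]; split.
  rewrite (_ : _ \o _ = (@complex.Re R \o h) \+ (@complex.Re R \o k)).
    exact: measurable_funD.
  by apply/funext => p /=; case: (h p) (k p) => ? ? [].
rewrite (_ : _ \o _ = (@complex.Im R \o h) \+ (@complex.Im R \o k)).
  exact: measurable_funD.
by apply/funext => p /=; case: (h p) (k p) => ? ? [].
Qed.

Lemma cmeasurableM h k : cmeasurable h -> cmeasurable k ->
  cmeasurable (fun p => h p * k p).
Proof.
move=> [hr hi] [kr ki]; split.
  rewrite (_ : _ \o _ = ((@complex.Re R \o h) \* (@complex.Re R \o k)) \-
     ((@complex.Im R \o h) \* (@complex.Im R \o k))).
    by apply: measurable_funB; exact: measurable_funM.
  by apply/funext => p /=; case: (h p) (k p) => ? ? [].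
rewrite (_ : _ \o _ = ((@complex.Re R \o h) \* (@complex.Im R \o k)) \+
   ((@complex.Im R \o h) \* (@complex.Re R \o k))).
  by apply: measurable_funD; exact: measurable_funM.
by apply/funext => p /=; case: (h p) (k p) => ? ? [].
Qed.

Lemma cmeasurable_cst (c : C) : cmeasurable (fun _ => c).
Proof. by split; exact: measurable_cst. Qed.

Lemma cmeasurable_cis (f : T -> R) : measurable_fun setT f ->
  cmeasurable (fun p => cis (f p)).
Proof.
move=> mf; split; apply: measurableT_comp mf; apply: continuous_measurable_fun.
  exact: continuous_cos.
exact: continuous_sin.
Qed.

Lemma cmeasurable_real (f : T -> R) : measurable_fun setT f ->
  cmeasurable (fun p => (f p)%:C%C).
Proof. by move=> mf; split => //; exact: measurable_cst. Qed.

Variable mu : {measure set T -> \bar R}.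

Definition cintegrable h := mu.-integrable setT (EFin \o (@complex.Re R \o h)) /\
  mu.-integrable setT (EFin \o (@complex.Im R \o h)).

Definition cintegral h : C := (\int[mu]_p complex.Re (h p)
  +i* \int[mu]_p complex.Im (h p))%C.

Lemma eq_cintegral h k : h =1 k -> cintegral h = cintegral k.
Proof. by move=> /funext ->. Qed.

Lemma cintegrable_le h (g : T -> R) : cmeasurable h ->
  mu.-integrable setT (EFin \o g) -> (forall p, normc (h p) <= g p) ->
  cintegrable h.
Proof.
move=> [hr hi] ig hg.
split; apply: le_integrable ig => //.
- exact/measurable_EFinP.
- move=> p _; rewrite lee_fin.
  by rewrite (le_trans (normr_Re_le _))// (le_trans (hg p))// ler_norm.
- exact/measurable_EFinP.
- move=> p _; rewrite lee_fin.
  by rewrite (le_trans (normr_Im_le _))// (le_trans (hg p))// ler_norm.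
Qed.

(** Real and imaginary parts are estimated separately, whence the factor 2. *)
Lemma normc_cintegral_le h (g : T -> R) : cmeasurable h ->
  mu.-integrable setT (EFin \o g) -> (forall p, normc (h p) <= g p) ->
  normc (cintegral h) <= 2 * \int[mu]_p g p.
Proof.
move=> mh ig hg; have [ir ii] := cintegrable_le mh ig hg.
apply: le_trans (normc_le_ReIm _) _; rewrite mulr_natl mulr2n /=.
apply: lerD; (apply: le_trans (le_normr_Rintegral measurableT _) _ => //);
  apply: le_Rintegral => //; try exact: integrable_norm.
  by move=> p _; rewrite (le_trans (normr_Re_le _)).
by move=> p _; rewrite (le_trans (normr_Im_le _)).
Qed.

Lemma cintegralD h k : cintegrable h -> cintegrable k ->
  cintegral (fun p => h p + k p) = cintegral h + cintegral k.
Proof.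
move=> [hr hi] [kr ki].
apply/eqP; rewrite eq_complex /= -!RintegralD//; apply/andP; split; apply/eqP;
  by apply: eq_Rintegral => p _; case: (h p) (k p) => ? ? [].
Qed.

Lemma integrable_lin (a b : R) (f g : T -> R) :
  mu.-integrable setT (EFin \o f) -> mu.-integrable setT (EFin \o g) ->
  mu.-integrable setT (EFin \o (fun p => a * f p + b * g p)).
Proof.
move=> fi gi.
have -> : EFin \o (fun p => a * f p + b * g p) =
  (fun p => a%:E * (EFin \o f) p)%E \+ (fun p => b%:E * (EFin \o g) p)%E.
  by apply/funext => p /=; rewrite -!EFinM -EFinD.
by apply: integrableD => //; exact: integrableZl.
Qed.

Lemma integrable_scale (a : R) (f : T -> R) : mu.-integrable setT (EFin \o f) ->
  mu.-integrable setT (EFin \o (fun p => a * f p)).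
Proof.
move=> fi; have := integrable_lin a 0 fi fi.
by apply: eq_integrable => // p _ /=; rewrite mul0r addr0.
Qed.

Lemma Rintegral_lin (a b : R) (f g : T -> R) :
  mu.-integrable setT (EFin \o f) -> mu.-integrable setT (EFin \o g) ->
  \int[mu]_p (a * f p + b * g p) = a * \int[mu]_p f p + b * \int[mu]_p g p.
Proof.
by move=> fi gi; rewrite RintegralD ?RintegralZl//; exact: integrable_scale.
Qed.

Lemma cintegrableZ (c : C) h : cintegrable h -> cintegrable (fun p => c * h p).
Proof.
case: c => a b [hr hi]; split.
  have := integrable_lin a (- b) hr hi; apply: eq_integrable => // p _ /=.
  by case: (h p) => ? ?; rewrite mulNr.
have := integrable_lin a b hi hr; apply: eq_integrable => // p _ /=.
by case: (h p) => ? ?.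
Qed.

Lemma cintegralZ (c : C) h : cintegrable h ->
  cintegral (fun p => c * h p) = c * cintegral h.
Proof.
case: c => a b [hr hi]; apply/eqP; rewrite eq_complex /=.
rewrite -mulNr -!Rintegral_lin//; apply/andP; split; apply/eqP;
  by apply: eq_Rintegral => p _; case: (h p) => ? ? /=; rewrite ?mulNr.
Qed.

Lemma cintegral_real (f : T -> R) :
  cintegral (fun p => (f p)%:C%C) = (\int[mu]_p f p)%:C%C.
Proof.
rewrite /cintegral; congr (_ +i* _)%C.
by rewrite Rintegral_cst//= mul0r.
Qed.

End ComplexIntegral.

(** * Product measures and Fubini's theorem *)

Section Tensor.
Context d1 d2 (T1 : measurableType d1) (T2 : measurableType d2) (R : realType).
Variables (m1 : {sigma_finite_measure set T1 -> \bar R}).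
Variables (m2 : {sigma_finite_measure set T2 -> \bar R}).

Lemma integrable_tensor (f : T1 -> R) (g : T2 -> R) :
  m1.-integrable setT (EFin \o f) -> m2.-integrable setT (EFin \o g) ->
  (m1 \x m2)%E.-integrable setT (EFin \o (fun p => f p.1 * g p.2)).
Proof.
move=> fi gi; have /integrableP[/measurable_EFinP mf fi'] := fi.
have /integrableP[/measurable_EFinP mg gi'] := gi.
apply/integrable12ltyP.
  apply/measurable_EFinP; apply: measurable_funM.
    by apply: measurableT_comp mf _; exact: measurable_fst.
  by apply: measurableT_comp mg _; exact: measurable_snd.
rewrite /=; set I := (\int[m2]_y `|(g y)%:E|)%E.
have -> : (\int[m1]_x \int[m2]_y `|f x * g y|%:E)%E =
    (\int[m1]_x (I * `|(f x)%:E|))%E.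
  apply: eq_integral => x _; under eq_integral do rewrite normrM EFinM.
  rewrite ge0_integralZl//; last by apply/measurable_EFinP; exact: measurableT_comp.
  by rewrite muleC.
rewrite ge0_integralZl//; last by apply: integral_ge0.
  rewrite lte_mul_pinfty//; first exact: integral_ge0.
  by rewrite ge0_fin_numE//; exact: integral_ge0.
by apply/measurable_EFinP; exact: measurableT_comp.
Qed.

Lemma Rintegral_tensor (f : T1 -> R) (g : T2 -> R) :
  m1.-integrable setT (EFin \o f) -> m2.-integrable setT (EFin \o g) ->
  \int[(m1 \x m2)%E]_p (f p.1 * g p.2) = \int[m1]_x f x * \int[m2]_y g y.
Proof.
move=> fi gi; rewrite /Rintegral -integral12_prod_meas1/=; last first.
  exact: integrable_tensor.
rewrite /fubini_F /=.
have gfin := integrable_fin_num measurableT gi.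
have ffin := integrable_fin_num measurableT fi.
under eq_integral => x _.
  under eq_integral do rewrite EFinM.
  rewrite integralZl//; rewrite -(fineK gfin); over.
by rewrite integralZr// fineM//; rewrite fineK.
Qed.

Variables (u : T1 -> R) (v : T2 -> R).
Hypotheses (iu : m1.-integrable setT (EFin \o u)).
Hypotheses (iv : m2.-integrable setT (EFin \o v)).

(** The majorant u x * v y makes every section of k integrable, not merely almost every one, so the
    inner integrals are finite everywhere and [fine] can be removed from all of them. *)
Lemma Rintegral_fubini (k : T1 * T2 -> R) : measurable_fun setT k ->
  (forall x y, `|k (x, y)| <= u x * v y) ->
  \int[m1]_x \int[m2]_y k (x, y) = \int[m2]_y \int[m1]_x k (x, y).
Proof.
move=> mk kuv; have ik : (m1 \x m2)%E.-integrable setT (EFin \o k).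
  apply: le_integrable (integrable_tensor iu iv) => //.
    exact/measurable_EFinP.
  by move=> [x y] _; rewrite lee_fin (le_trans (kuv x y))// ler_norm.
have i2 x : m2.-integrable setT (fun y => (k (x, y))%:E).
  apply: (@le_integrable _ _ _ _ _ _ _ (fun y => (u x)%:E * (EFin \o v) y)%E) => //.
  - by apply/measurable_EFinP; apply: measurableT_comp mk _; exact: measurable_pair1.
  - by move=> y _; rewrite -EFinM lee_fin (le_trans (kuv x y))// ler_norm.
  - exact: integrableZl.
have i1 y : m1.-integrable setT (fun x => (k (x, y))%:E).
  apply: (@le_integrable _ _ _ _ _ _ _ (fun x => (v y)%:E * (EFin \o u) x)%E) => //.
  - by apply/measurable_EFinP; apply: measurableT_comp mk _; exact: measurable_pair2.
  - move=> x _; rewrite -EFinM lee_fin (le_trans (kuv x y))// mulrC ler_norm//.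
  - exact: integrableZl.
rewrite /Rintegral; congr fine.
under eq_integral do rewrite fineK ?integrable_fin_num//.
rewrite (Fubini ik); apply: eq_integral => y _.
by rewrite fineK// integrable_fin_num.
Qed.

Lemma cintegral_fubini (k : T1 * T2 -> R[i]) : cmeasurable k ->
  (forall x y, normc (k (x, y)) <= u x * v y) ->
  cintegral m1 (fun x => cintegral m2 (fun y => k (x, y))) =
  cintegral m2 (fun y => cintegral m1 (fun x => k (x, y))).
Proof.
move=> [mr mi] kuv; rewrite /cintegral; congr (_ +i* _)%C.
  apply: (Rintegral_fubini mr) => x y.
  exact: le_trans (normr_Re_le _) (kuv x y).
apply: (Rintegral_fubini mi) => x y.
exact: le_trans (normr_Im_le _) (kuv x y).
Qed.

End Tensor.

(** * Measurability and an integrable weight on the plane *)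

Section Plane.
Context {R : realType}.
Local Notation C := R[i].
Local Notation leb := (@lebesgue_measure R).
Local Notation mu := (@lebesgue_measure R \x @lebesgue_measure R)%E.
Implicit Types (p : R * R).

(** Measurability refers to the product sigma-algebra: an open set is the countable union of the
    products of balls with rational centres and radius 1/(n+1) that it contains. *)
Lemma open_measurable_prod (U : set (R * R)) : open U -> measurable U.
Proof.
move=> oU.
pose rect (q r : rat) (n : nat) : set (R * R) :=
  ball (ratr q : R) n.+1%:R^-1 `*` ball (ratr r : R) n.+1%:R^-1.
pose F q r n := if `[< rect q r n `<=` U >] then rect q r n else set0.
have -> : U = \bigcup_q \bigcup_r \bigcup_n F q r n.
  apply/seteqP; split => [[x y] Uxy|p]; last first.
    move=> [q _ [r _ [n _]]]; rewrite /F.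
    by case: ifPn => // /asboolP + H; exact.
  have /nbhs_ballP[e /= e0 He] : nbhs (x, y) U by apply: open_nbhs_nbhs; split.
  have [n] : exists n, 0 + n.+1%:R^-1 < e / 2.
    by apply: ltr_add_invr; rewrite divr_gt0.
  rewrite add0r => ne.
  have n0 : 0 < n.+1%:R^-1 :> R by rewrite invr_gt0 ltr0n.
  have rat_near (z : R) : exists q : rat, ball (ratr q : R) n.+1%:R^-1 z.
    have [|q] := @rat_in_itvoo R (z - n.+1%:R^-1) (z + n.+1%:R^-1).
      by rewrite ltrBlDr -addrA ltrDl addr_gt0.
    rewrite in_itv/= => /andP[q1 q2]; exists q; rewrite /ball/= ltr_norml.
    by move: (n.+1%:R^-1) q1 q2 => d q1 q2; apply/andP; split; lra.
  have [q hq] := rat_near x; have [r hr] := rat_near y.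
  exists q => //; exists r => //; exists n => //; rewrite /F ifT//.
  apply/asboolP => -[a b] [/= ha hb]; apply: He; split => /=.
    apply: (@le_ball _ _ _ (n.+1%:R^-1 + n.+1%:R^-1)); first by move: (n.+1%:R^-1) ne => d; lra.
    exact: ball_triangle (ball_sym hq) ha.
  apply: (@le_ball _ _ _ (n.+1%:R^-1 + n.+1%:R^-1)); first by move: (n.+1%:R^-1) ne => d; lra.
  exact: ball_triangle (ball_sym hr) hb.
apply: bigcupT_measurable_rat => q; apply: bigcupT_measurable_rat => r.
apply: bigcupT_measurable => n; rewrite /F; case: ifP => // _.
by apply: measurableX; exact: measurable_ball.
Qed.

Lemma continuous_measurable_prod (f : R * R -> R) : continuous f ->
  measurable_fun setT f.
Proof.
move=> /continuousP cf; apply: (measurability _ (RGenOpens.measurableE R)).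
move=> _ [_ [a [b ->] <-]]; rewrite setTI; apply: open_measurable_prod.
by apply: cf; exact: interval_open.
Qed.

(** By symmetry the integral is twice that over the half-line, which arctan evaluates. *)
Lemma integrable_oneDsqrV :
  leb.-integrable setT (EFin \o (fun x : R => (oneDsqr x)^-1)).
Proof.
have m : measurable_fun setT (fun x : R => (oneDsqr x)^-1).
  by apply: continuous_measurable_fun; exact: continuous_oneDsqrV.
have ge0 (x : R) : 0 <= (oneDsqr x)^-1.
  by rewrite invr_ge0 (le_trans ler01)// oneDsqr_ge1.
apply/integrableP; split; first exact/measurable_EFinP.
under eq_integral do rewrite /= ger0_norm//.
rewrite ge0_symfun_integralT//; first last.
- by move=> x; rewrite /oneDsqr /= sqrrN.
- exact: continuous_oneDsqrV.
rewrite (_ : [set x | _] = `[0, +oo[%classic); last first.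
  by apply/seteqP; split => x/=; rewrite in_itv/= andbT.
by rewrite integral0y_oneDsqr -EFinM ltry.
Qed.

(** A fixed integrable function that dominates every Schwartz function up to a constant (see
    [schwartz_decay]), and so turns pointwise bounds into bounds of integrals. *)
Definition weight (p : R * R) : R := (oneDsqr p.1)^-1 * (oneDsqr p.2)^-1.

Lemma integrable_weight : mu.-integrable setT (EFin \o weight).
Proof. exact: (integrable_tensor integrable_oneDsqrV integrable_oneDsqrV). Qed.

Lemma weight_gt0 p : 0 < weight p.
Proof. by rewrite mulr_gt0// invr_gt0 (lt_le_trans ltr01)// oneDsqr_ge1. Qed.

End Plane.

(** * Families closed under differentiation and multiplication *)

Section Families.
Context {R : realType}.
Local Notation C := R[i].
Local Notation ReC := (@complex.Re R).
Local Notation ImC := (@complex.Im R).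
Implicit Types (F G : R * R -> C) (p v : R * R).

(** [pd] is total, so the differentiability of both parts has to be recorded beside its value. *)
Definition is_pd v F G := [/\ forall p, derivable (ReC \o F) p v,
  forall p, derivable (ImC \o F) p v & pd v F = G].

(** Dividing the remainder by t leaves an error of at most |K| |t|. *)
Lemma is_derive_taylor (g : R * R -> R) p v (l K : R) :
  (forall t, `|g (t *: v + p) - g p - t * l| <= K * t ^+ 2) ->
  is_derive p v g l.
Proof.
move=> H.
have lim : h^-1 *: ((g \o shift p) (h *: v) - g p) @[h --> (0:R)^'] --> l.
  apply/cvgrPdist_le => e e0; near=> h.
  have h0 : h != 0 by near: h; exact: nbhs_dnbhs_neq.
  rewrite distrC -[X in _ - X](mulKf h0) -mulrBr normrM normfV.
  rewrite ler_pdivrMl ?normr_gt0//; apply: le_trans (H h) _.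
  rewrite -real_normK ?num_real// expr2 mulrCA ler_wpM2l//.
  (* The summand 1 keeps the denominator positive when K = 0. *)
  have K0 : 0 < `|K| + 1 by rewrite ltr_wpDl.
  have hd : `|h| < e / (`|K| + 1) by near: h; apply: dnbhs0_lt; rewrite divr_gt0.
  apply: (@le_trans _ _ ((`|K| + 1) * `|h|)).
    by rewrite ler_wpM2r// (le_trans (ler_norm _))// lerDl.
  by rewrite mulrC -ler_pdivlMr// ltW.
by split; [apply/cvg_ex; exists l|exact/cvg_lim].
Unshelve. all: by end_near. Qed.

Lemma is_pd_taylor v F G : (forall p, exists K, forall t,
    normc (F (t *: v + p) - F p - t%:C%C * G p) <= K * t ^+ 2) -> is_pd v F G.
Proof.
move=> H.
have dr p : is_derive p v (ReC \o F) (ReC (G p)).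
  have [K HK] := H p; apply: (@is_derive_taylor _ _ _ _ K) => t.
  apply: le_trans (HK t); apply: le_trans (normr_Re_le _).
  rewrite le_eqVlt; apply/orP; left; apply/eqP; congr `|_|.
  by rewrite /=; case: (F _) (F p) (G p) => ? ? [? ?] [? ?] /=; ring.
have di p : is_derive p v (ImC \o F) (ImC (G p)).
  have [K HK] := H p; apply: (@is_derive_taylor _ _ _ _ K) => t.
  apply: le_trans (HK t); apply: le_trans (normr_Im_le _).
  rewrite le_eqVlt; apply/orP; left; apply/eqP; congr `|_|.
  by rewrite /=; case: (F _) (F p) (G p) => ? ? [? ?] [? ?] /=; ring.
split=> [p|p|]; [by have [] := dr p|by have [] := di p|].
apply/funext => p; rewrite /pd (@derive_val _ _ _ _ _ _ _ (dr p)).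
by rewrite (@derive_val _ _ _ _ _ _ _ (di p)); case: (G p).
Qed.

Variables (I : Type) (A : I -> R * R -> C) (dx dy mx my : I -> I).
Hypothesis A_cont : forall i, continuous (ReC \o A i) /\ continuous (ImC \o A i).
Hypothesis A_dx : forall i, is_pd ex (A i) (A (dx i)).
Hypothesis A_dy : forall i, is_pd ey (A i) (A (dy i)).

(** Derivatives of members are members, so continuity of all members gives C^n for all of them, by
    induction on n with the index generalised. *)
Lemma smooth_family i : smooth (A i).
Proof.
move=> n; elim: n i => [|n IH] i.
  by have [cr ci] := A_cont i; split; exact: Ck_zero.
have [cr ci] := A_cont i; have [xr xi xE] := A_dx i; have [yr yi yE] := A_dy i.
have [xr' xi'] := IH (dx i); have [yr' yi'] := IH (dy i).
split; apply: Ck_succ => //.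
- by rewrite (_ : 'D_ex _ = ReC \o A (dx i))// -xE.
- by rewrite (_ : 'D_ey _ = ReC \o A (dy i))// -yE.
- by rewrite (_ : 'D_ex _ = ImC \o A (dx i))// -xE.
- by rewrite (_ : 'D_ey _ = ImC \o A (dy i))// -yE.
Qed.

Lemma pdn_family h k i : pdn h k (A i) = A (iter h dx (iter k dy i)).
Proof.
rewrite /pdn; have -> : iter k (pd ey) (A i) = A (iter k dy i).
  by elim: k => //= k ->; have [_ _ ->] := A_dy (iter k dy i).
elim: h => //= h ->.
by have [_ _ ->] := A_dx (iter h dx (iter k dy i)).
Qed.

Hypothesis A_mx : forall i p, (p.1)%:C%C * A i p = A (mx i) p.
Hypothesis A_my : forall i p, (p.2)%:C%C * A i p = A (my i) p.

(** A weighted derivative of a member is, up to absolute values, a member at a shifted index: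
    seminorms become sup norms. *)
Lemma weighted_family a b h k i p : weighted a b h k (A i) p =
  normc (A (iter a mx (iter b my (iter h dx (iter k dy i)))) p).
Proof.
rewrite /weighted pdn_family; set j := iter h dx _.
rewrite -mulrA; have -> : `|p.2| ^+ b * normc (A j p) = normc (A (iter b my j) p).
  elim: b => [|b IH]; first by rewrite mul1r.
  by rewrite exprS -mulrA IH /= -A_my normcM normc_real.
elim: a => [|a IH]; first by rewrite mul1r.
by rewrite exprS -mulrA IH /= -A_mx normcM normc_real.
Qed.

Hypothesis A_bound : forall i, exists K : R, forall p, normc (A i p) <= K.

Lemma schwartz_family i : is_schwartz (A i).
Proof.
apply: is_schwartz_bounded; first exact: smooth_family.
move=> a b h k; have [K HK] := A_bound (iter a mx (iter b my (iter h dx (iter k dy i)))).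
by exists K => p; rewrite weighted_family.
Qed.

End Families.

(** * Continuous operators on the Schwartz space *)

Section SchwartzContinuity.
Context {R : realType}.
Local Notation C := R[i].
Implicit Types f g : schwartz R.

Lemma snorm_mono (m n : nat) f : (m <= n)%N ->
  snorm m f <= m.+1%:R ^+ 4 * snorm n f.
Proof.
move=> mn; apply: snorm_le => a b h k *.
by apply: seminorm_le_snorm; apply: leq_trans mn.
Qed.

Definition sbounded (phi : schwartz R -> R) :=
  exists K M, 0 <= K /\ forall f, phi f <= K * snorm M f.

Lemma sboundedD phi psi : sbounded phi -> sbounded psi ->
  sbounded (fun f => phi f + psi f).
Proof.
move=> [K [M [K0 HK]]] [L [N [L0 HL]]].
exists (K * M.+1%:R ^+ 4 + L * N.+1%:R ^+ 4), (maxn M N); split.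
  by rewrite addr_ge0// mulr_ge0// exprn_ge0.
move=> f; rewrite mulrDl -(mulrA K) -(mulrA L) lerD//.
  by apply: le_trans (HK f) _; rewrite ler_wpM2l// snorm_mono// leq_maxl.
by apply: le_trans (HL f) _; rewrite ler_wpM2l// snorm_mono// leq_maxr.
Qed.

Lemma sbounded_sum n (phi : 'I_n -> schwartz R -> R) :
  (forall i, sbounded (phi i)) -> sbounded (fun f => \sum_(i < n) phi i f).
Proof.
elim: n phi => [|n IH] phi H.
  by exists 0, 0%N; split => // f; rewrite big_ord0 mul0r.
have [K [M [K0 HK]]] := sboundedD (IH _ (fun i => H (lift ord0 i))) (H ord0).
exists K, M; split => // f; apply: le_trans (HK f).
by rewrite big_ord_recl addrC.
Qed.

Lemma scontinuous_seminorm (A : schwartz R -> schwartz R) :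
  (forall a b h k, sbounded (fun f => seminorm a b h k (A f))) -> scontinuous A.
Proof. by move=> H N; do 4 (apply: sbounded_sum => ?); exact: H. Qed.

Lemma scontinuous_id : scontinuous (fun f : schwartz R => f).
Proof. by move=> N; exists 1, N; split=> // f; rewrite mul1r. Qed.

Lemma scontinuous_comp (A B : schwartz R -> schwartz R) :
  scontinuous A -> scontinuous B -> scontinuous (A \o B).
Proof.
move=> cA cB N; have [K [M [K0 HK]]] := cA N; have [L [P [L0 HL]]] := cB M.
exists (K * L), P; split; first exact: mulr_ge0.
by move=> f; apply: le_trans (HK _) _; rewrite -mulrA ler_wpM2l.
Qed.

Lemma scontinuous_iter n (A : schwartz R -> schwartz R) :
  scontinuous A -> scontinuous (iter n A).
Proof.
move=> cA; elim: n => [|n IH]; first exact: scontinuous_id.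
exact: scontinuous_comp cA IH.
Qed.

Lemma seminorm_lin a b h k (c : C) f g : seminorm a b h k (c *: f + g) <=
  normc c * seminorm a b h k f + seminorm a b h k g.
Proof.
apply: seminorm_le => p.
apply: le_trans (weighted_lin _ _ _ _ _ _ (schwartzP f).1 (schwartzP g).1) _.
apply: lerD; last exact: weighted_le_seminorm (schwartzP _).
by rewrite ler_wpM2l ?normc_ge0//; exact: weighted_le_seminorm (schwartzP _).
Qed.

Lemma scontinuous_lin (c : C) (A B : schwartz R -> schwartz R) :
  scontinuous A -> scontinuous B -> scontinuous (fun f => c *: A f + B f).
Proof.
move=> cA cB; apply: scontinuous_seminorm => a b h k.
have seminorm_sbounded (D : schwartz R -> schwartz R) : scontinuous D ->
    sbounded (fun f => seminorm a b h k (D f)).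
  move=> cD; pose N := maxn (maxn a b) (maxn h k).
  have [K [M [K0 HK]]] := cD N; exists K, M; split => // f.
  apply: le_trans (HK f); apply: seminorm_le_snorm.
  - by rewrite /N !leq_max leqnn.
  - by rewrite /N !leq_max leqnn orbT.
  - by rewrite /N !leq_max leqnn !orbT.
  - by rewrite /N !leq_max leqnn !orbT.
have [K [M [K0 HK]]] := seminorm_sbounded A cA.
have : sbounded (fun f => normc c * seminorm a b h k (A f)).
  exists (normc c * K), M; split; first by rewrite mulr_ge0// normc_ge0.
  by move=> f; rewrite -mulrA ler_wpM2l// normc_ge0.
move=> /sboundedD/(_ (seminorm_sbounded B cB))[L [P [L0 HL]]].
exists L, P; split => // f; apply: le_trans (HL f); exact: seminorm_lin.
Qed.

Variables (A : schwartz R -> R * R -> C) (dx dy mx my : schwartz R -> schwartz R).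
Hypothesis A_cont : forall f, continuous (@complex.Re R \o A f) /\
  continuous (@complex.Im R \o A f).
Hypothesis A_dx : forall f, is_pd ex (A f) (A (dx f)).
Hypothesis A_dy : forall f, is_pd ey (A f) (A (dy f)).
Hypothesis A_mx : forall f p, (p.1)%:C%C * A f p = A (mx f) p.
Hypothesis A_my : forall f p, (p.2)%:C%C * A f p = A (my f) p.
Hypothesis A_bound : exists K N, 0 <= K /\ forall f p, normc (A f p) <= K * snorm N f.

(** The index set of the family is now S(R^2) itself; [dx], [dy], [mx], [my] are the operators that
    A intertwines with the derivatives and the multiplications by coordinates. *)
Lemma schwartz_operator f : is_schwartz (A f).
Proof.
apply: (schwartz_family A_cont A_dx A_dy A_mx A_my) => g.
by have [K [N [_ H]]] := A_bound; exists (K * snorm N g).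
Qed.

Hypotheses (cdx : scontinuous dx) (cdy : scontinuous dy).
Hypotheses (cmx : scontinuous mx) (cmy : scontinuous my).

(** A seminorm of A f is the sup norm of A g, where g arises from f by continuous operators; the
    bound of A by one [snorm] then suffices. *)
Lemma schwartz_operator_continuous :
  scontinuous (fun f => schwartz_of (schwartz_operator f)).
Proof.
apply: scontinuous_seminorm => a b h k; have [K [N [K0 HK]]] := A_bound.
have : scontinuous (iter a mx \o (iter b my \o (iter h dx \o iter k dy))).
  by do !apply: scontinuous_comp; exact: scontinuous_iter.
move=> /(_ N)[L [M [L0 HL]]]; exists (K * L), M; split; first exact: mulr_ge0.
move=> f; apply: seminorm_le => p; rewrite (weighted_family A_dx A_dy A_mx A_my).
apply: le_trans (HK _ _) _; rewrite -mulrA ler_wpM2l//; exact: HL.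
Qed.

End SchwartzContinuity.

(** * Decay of Schwartz functions and integrals of derivatives *)

Section Decay.
Context {R : realType}.
Local Notation C := R[i].
Local Notation leb := (@lebesgue_measure R).
Local Notation mu := (@lebesgue_measure R \x @lebesgue_measure R)%E.
Local Notation ReC := (@complex.Re R).
Local Notation ImC := (@complex.Im R).
Implicit Types (f g : schwartz R) (p : R * R).

(** Over [-a, a] the integral is G(a) - G(-a), of size at most 2 K / a as 1 + a^2 >= a; dominated
    convergence passes to the whole line. *)
Lemma integral_derive0 (G G' : R -> R) (K : R) :
  (forall x : R, is_derive x (1 : R) G (G' x)) -> continuous G' ->
  (forall x, `|G x| <= K * (oneDsqr x)^-1) ->
  (forall x, `|G' x| <= K * (oneDsqr x)^-1) ->
  (\int[leb]_x (G' x)%:E = 0)%E.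
Proof.
(* n + 1 rather than n, so that the interval [-a n, a n] is never degenerate. *)
move=> dG cG' bG bG'; pose a (n : nat) : R := n.+1%:R.
have a0 n : 0 < a n by rewrite /a.
pose F n := EFin \o (G' \_ `[- a n, a n]).
have mG' : measurable_fun setT G' by exact: continuous_measurable_fun.
have intF n : (\int[leb]_x F n x = (G (a n) - G (- a n))%:E)%E.
  rewrite /F -restrict_EFin -integral_mkcond (@continuous_FTC2 _ _ G)//.
  - by rewrite -subr_gt0 opprK addr_gt0.
  - exact: continuous_subspaceT.
  - split.
    + by move=> x _; have [] := dG x.
    + apply: cvg_at_right_filter; apply: differentiable_continuous.
      by apply/derivable1_diffP; have [] := dG (- a n).
    + apply: cvg_at_left_filter; apply: differentiable_continuous.
      by apply/derivable1_diffP; have [] := dG (a n).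
  - by move=> x _; rewrite derive1E; exact: (@derive_val _ _ _ _ _ _ _ (dG x)).
have F_cvg x : F ^~ x @ \oo --> (EFin \o G') x.
  apply: cvg_near_cst; near=> n; rewrite /F /= patchE mem_set//=.
  rewrite in_itv/= -ler_norml; near: n.
  exists (Num.truncn `|x|) => // n /= xn.
  apply: le_trans (ltW (truncnS_gt _)) _; rewrite /a ler_nat ltnS//.
have iK : leb.-integrable setT (EFin \o (fun x => K * (oneDsqr x)^-1)).
  exact: integrable_scale integrable_oneDsqrV.
have H1 : (\int[leb]_x F n x)%E @[n --> \oo] --> (\int[leb]_x (G' x)%:E)%E.
  apply: (@dominated_cvg _ _ R leb setT measurableT F (EFin \o G')
    (EFin \o (fun x => K * (oneDsqr x)^-1))) => //.
  - move=> n; apply/measurable_EFinP.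
    apply/(measurable_restrictT _ _).1 => //.
    exact: measurable_funTS.
  - move=> n x _; rewrite /F /= patchE lee_fin; case: ifP => // _.
    by rewrite normr0 (le_trans _ (bG' x)).
have H2 : (\int[leb]_x F n x)%E @[n --> \oo] --> 0%E.
  under eq_fun do rewrite intF.
  apply: cvg_EFin; first exact: nearW.
  apply/cvgrPdist_le => e e0; near=> n; rewrite sub0r normrN /=.
  have K0 : 0 <= K.
    by have := le_trans (normr_ge0 _) (bG 0); rewrite /oneDsqr expr0n addr0 invr1 mulr1.
  have bound x : `|x| = a n -> `|G x| <= K / a n.
    move=> xa; apply: le_trans (bG x) _; rewrite ler_wpM2l// lef_pV2 ?posrE//.
    rewrite /oneDsqr -(real_normK (num_real x)) xa expr2.
    have : 1 <= a n by rewrite /a ler1n.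
    by move: (a n) (a0 n) => b b0 b1; nra.
  apply: le_trans (ler_normB _ _) _.
  apply: (@le_trans _ _ (K / a n + K / a n)).
    by rewrite lerD// bound// ?normrN gtr0_norm.
  rewrite -mulrDl ler_pdivrMr// -ler_pdivrMl//; near: n.
  exists (Num.truncn (e^-1 * (K + K))) => // n /= xn.
  apply: le_trans (ltW (truncnS_gt _)) _; rewrite /a ler_nat ltnS//.
exact: (cvg_unique _ H1 H2).
Unshelve. all: by end_near. Qed.

Lemma schwartz_cont f : continuous (ReC \o f) /\ continuous (ImC \o f).
Proof.
have [cr ci] := (schwartzP f).1 0%N.
by split; [exact: (Ck_continuous cr)|exact: (Ck_continuous ci)].
Qed.

Lemma cmeasurable_schwartz f : cmeasurable f.
Proof.
by have [cr ci] := schwartz_cont f; split; exact: continuous_measurable_prod.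
Qed.

(** Multiplied by (1 + x^2)(1 + y^2), |f| becomes a sum of four terms, each a weighted value bounded
    by [snorm 2 f]. *)
Lemma schwartz_decay f p : normc (f p) <= 4 * snorm 2 f * weight p.
Proof.
have o0 (x : R) : 0 < oneDsqr x by rewrite (lt_le_trans ltr01)// oneDsqr_ge1.
rewrite /weight -invfM ler_pdivlMr ?mulr_gt0//.
have W (a b : nat) : (a <= 2)%N -> (b <= 2)%N ->
    `|p.1| ^+ a * `|p.2| ^+ b * normc (f p) <= snorm 2 f.
  move=> a2 b2; apply: le_trans (weighted_le_seminorm a b 0 0 p (schwartzP f)) _.
  exact: seminorm_le_snorm.
have := W 0%N 0%N isT isT; have := W 2%N 0%N isT isT; have := W 0%N 2%N isT isT.
have := W 2%N 2%N isT isT; rewrite !expr0 !mul1r !mulr1.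
rewrite /oneDsqr.
rewrite !real_normK ?num_real//.
move: (normc _) (snorm _ _) (p.1 ^+ 2) (p.2 ^+ 2) => n s x y; lra.
Qed.

Lemma cintegrable_schwartzM f (h : R * R -> C) : cmeasurable h ->
  (forall p, normc (h p) <= 1) -> cintegrable mu (fun p => f p * h p).
Proof.
move=> mh h1; apply: (@cintegrable_le _ _ R mu _ (fun p => 4 * snorm 2 f * weight p)).
- by apply: cmeasurableM mh; exact: cmeasurable_schwartz.
- exact: integrable_scale integrable_weight.
- move=> p; rewrite normcM; apply: le_trans (schwartz_decay f p).
  by rewrite ler_piMr ?normc_ge0.
Qed.

Lemma cintegrable_schwartz f : cintegrable mu f.
Proof.
have -> : schwartz_fun f = (fun p => f p * 1) by apply/funext => p; rewrite mulr1.
apply: cintegrable_schwartzM => [|p]; first exact: cmeasurable_cst.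
by rewrite normc1.
Qed.

Definition weight_mass : R := \int[mu]_p weight p.

Lemma normc_cintegral_weight (h : R * R -> C) (K : R) : cmeasurable h ->
  (forall p, normc (h p) <= K * weight p) ->
  normc (cintegral mu h) <= 2 * weight_mass * K.
Proof.
move=> mh hK; rewrite -mulrA [weight_mass * K]mulrC.
have iw := @integrable_weight R.
have := @normc_cintegral_le _ _ R mu h _ mh _ hK.
by rewrite RintegralZl//; apply; exact: integrable_scale.
Qed.

Lemma weight_mass_ge0 : 0 <= weight_mass.
Proof. by apply: Rintegral_ge0 => p _; exact/ltW/weight_gt0. Qed.

Lemma weight_le1 (x y : R) : weight (x, y) <= (oneDsqr x)^-1.
Proof.
have o0 (z : R) : 0 < oneDsqr z by rewrite (lt_le_trans ltr01)// oneDsqr_ge1.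
by apply: ler_piMr; [rewrite invr_ge0 ltW|exact: oneDsqrV_le1].
Qed.

Lemma weight_le2 (x y : R) : weight (x, y) <= (oneDsqr y)^-1.
Proof.
have o0 (z : R) : 0 < oneDsqr z by rewrite (lt_le_trans ltr01)// oneDsqr_ge1.
by apply: ler_piMl; [rewrite invr_ge0 ltW|exact: oneDsqrV_le1].
Qed.

Lemma continuous_line1 (h : R * R -> R) (y : R) : continuous h ->
  continuous (fun x => h (x, y)).
Proof.
move=> ch x; apply: (@continuous_comp _ _ _ (fun x => (x, y)) h); last exact: ch.
by apply: (@cvg_pair _ _ _ _ (nbhs x) (nbhs y)); [exact: cvg_id|exact: cvg_cst].
Qed.

Lemma continuous_line2 (h : R * R -> R) (x : R) : continuous h ->
  continuous (fun y => h (x, y)).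
Proof.
move=> ch y; apply: (@continuous_comp _ _ _ (fun y => (x, y)) h); last exact: ch.
by apply: (@cvg_pair _ _ _ _ (nbhs x) (nbhs y)); [exact: cvg_cst|exact: cvg_id].
Qed.

(** Here c is Re or Im. Integrating in x first, the integral along each horizontal line vanishes by
    [integral_derive0]. *)
Lemma Rintegral_spdx f (c : C -> R) : (forall z, `|c z| <= normc z) ->
  Ck 1 (c \o f) -> 'D_ex (c \o f) = c \o spdx f ->
  mu.-integrable setT (EFin \o (c \o spdx f)) -> \int[mu]_p c (spdx f p) = 0.
Proof.
move=> cn c1 cE ic; have cc : continuous (c \o spdx f).
  by rewrite -cE; exact: (Ck_continuous (Ck_derive dir_ex c1)).
pose K := Num.max (4 * snorm 2 f) (4 * snorm 2 (spdx f)).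
have K0 : 0 <= K by rewrite /K le_max mulr_ge0// snorm_ge0.
have bound g x y : 4 * snorm 2 g <= K ->
    `|c (g (x, y))| <= K * (oneDsqr x)^-1.
  move=> gK; apply: le_trans (cn _) _; apply: le_trans (schwartz_decay _ _) _.
  apply: (@le_trans _ _ (K * weight (x, y))).
    by apply: ler_wpM2r gK; exact/ltW/weight_gt0.
  by rewrite ler_wpM2l// weight_le1.
rewrite /Rintegral -(integral21_prod_meas1 ic).
rewrite (_ : fubini_G _ _ = cst 0%E) ?integral0//; apply/funext => y.
apply: (@integral_derive0 (fun x => c (f (x, y))) _ K) => [x||x|x].
- exact: (eq_rect _ (is_derive _ _ _) (@is_derive_ex _ (c \o f) x y (Ck_derivable dir_ex c1)) _
    (congr1 (@^~ (x, y)) cE)).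
- exact: (@continuous_line1 (c \o spdx f)).
- by apply: bound; rewrite /K le_max lexx.
- by apply: bound; rewrite /K le_max lexx orbT.
Qed.

(** Integration by parts without boundary term: applied to exp(-i p.xi) f, it gives
    [fourier_mulx]. *)
Lemma cintegral_spdx f : cintegral mu (spdx f) = 0.
Proof.
have [ir ii] := cintegrable_schwartz (spdx f); have [fr fi] := (schwartzP f).1 1%N.
rewrite /cintegral (Rintegral_spdx _ fr)//; last exact: normr_Re_le.
by rewrite (Rintegral_spdx _ fi)//; exact: normr_Im_le.
Qed.

Lemma Rintegral_spdy f (c : C -> R) : (forall z, `|c z| <= normc z) ->
  Ck 1 (c \o f) -> 'D_ey (c \o f) = c \o spdy f ->
  mu.-integrable setT (EFin \o (c \o spdy f)) -> \int[mu]_p c (spdy f p) = 0.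
Proof.
move=> cn c1 cE ic; have cc : continuous (c \o spdy f).
  by rewrite -cE; exact: (Ck_continuous (Ck_derive dir_ey c1)).
pose K := Num.max (4 * snorm 2 f) (4 * snorm 2 (spdy f)).
have K0 : 0 <= K by rewrite /K le_max mulr_ge0// snorm_ge0.
have bound g x y : 4 * snorm 2 g <= K ->
    `|c (g (x, y))| <= K * (oneDsqr y)^-1.
  move=> gK; apply: le_trans (cn _) _; apply: le_trans (schwartz_decay _ _) _.
  apply: (@le_trans _ _ (K * weight (x, y))).
    by apply: ler_wpM2r gK; exact/ltW/weight_gt0.
  by rewrite ler_wpM2l// weight_le2.
rewrite /Rintegral -(integral12_prod_meas1 ic).
rewrite (_ : fubini_F _ _ = cst 0%E) ?integral0//; apply/funext => x.
apply: (@integral_derive0 (fun y => c (f (x, y))) _ K) => [y||y|y].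
- exact: (eq_rect _ (is_derive _ _ _) (@is_derive_ey _ (c \o f) x y (Ck_derivable dir_ey c1)) _
    (congr1 (@^~ (x, y)) cE)).
- exact: (@continuous_line2 (c \o spdy f)).
- by apply: bound; rewrite /K le_max lexx.
- by apply: bound; rewrite /K le_max lexx orbT.
Qed.

Lemma cintegral_spdy f : cintegral mu (spdy f) = 0.
Proof.
have [ir ii] := cintegrable_schwartz (spdy f); have [fr fi] := (schwartzP f).1 1%N.
rewrite /cintegral (Rintegral_spdy _ fr)//; last exact: normr_Re_le.
by rewrite (Rintegral_spdy _ fi)//; exact: normr_Im_le.
Qed.

End Decay.

(** * Multiplication by exp(iq) *)

Section Lines.
Context {R : realType}.

Lemma is_derive_ex_line (g : R * R -> R) (x y l : R) :
  is_derive x (1 : R) (fun s => g (s, y)) l -> is_derive (x, y) ex g l.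
Proof.
have E : (fun h : R => h^-1 *: (((fun s => g (s, y)) \o shift x) (h *: 1)
      - g (x, y))) =
    (fun h : R => h^-1 *: ((g \o shift (x, y)) (h *: ex) - g (x, y))).
  apply/funext => h /=; congr (_ *: (g _ - _)).
  by rewrite /shift /= /ex; apply/pair_equal_spec; rewrite /= scaler0 add0r.
by move=> [dg gl]; move: dg gl; rewrite /derivable /derive E => dg gl; split.
Qed.

Lemma is_derive_ey_line (g : R * R -> R) (x y l : R) :
  is_derive y (1 : R) (fun s => g (x, s)) l -> is_derive (x, y) ey g l.
Proof.
have E : (fun h : R => h^-1 *: (((fun s => g (x, s)) \o shift y) (h *: 1)
      - g (x, y))) =
    (fun h : R => h^-1 *: ((g \o shift (x, y)) (h *: ey) - g (x, y))).
  apply/funext => h /=; congr (_ *: (g _ - _)).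
  by rewrite /shift /= /ey; apply/pair_equal_spec; rewrite /= scaler0 add0r.
by move=> [dg gl]; move: dg gl; rewrite /derivable /derive E => dg gl; split.
Qed.

Lemma is_derive_line_ex (g : R * R -> R) (x y l : R) :
  is_derive (x, y) ex g l -> is_derive x (1 : R) (fun s => g (s, y)) l.
Proof.
by move=> [dg gl]; have := is_derive_ex dg; rewrite gl.
Qed.

Lemma is_derive_line_ey (g : R * R -> R) (x y l : R) :
  is_derive (x, y) ey g l -> is_derive y (1 : R) (fun s => g (x, s)) l.
Proof.
by move=> [dg gl]; have := is_derive_ey dg; rewrite gl.
Qed.

(** Restriction to the coordinate line through p reduces this to the chain rule in one variable. *)
Lemma is_derive_dir_comp (h : R -> R) (g : R * R -> R) (p v : R * R) (l m : R) :
  dir v -> is_derive p v g l -> is_derive (g p) (1 : R) h m ->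
  is_derive p v (h \o g) (m * l).
Proof.
case: p => x y [] -> dg dh.
  apply: is_derive_ex_line.
  change (is_derive x (1 : R) (h \o (fun s => g (s, y))) (m * l)).
  by apply: is_derive1_comp; exact: is_derive_line_ex.
apply: is_derive_ey_line.
change (is_derive y (1 : R) (h \o (fun s => g (x, s))) (m * l)).
by apply: is_derive1_comp; exact: is_derive_line_ey.
Qed.

End Lines.

(* [phase_fun] is a real function whose gradient acts on S(R^2) by
   multiplication, so that multiplication by [cis phase_fun] acts as well. *)
Record phase (R : realType) := Phase {
  phase_fun :> R * R -> R;
  phase_gx : R * R -> R;
  phase_gy : R * R -> R;
  phase_mulx : {linear schwartz R -> schwartz R};
  phase_muly : {linear schwartz R -> schwartz R};
  phase_cont : continuous phase_fun;
  phase_derx : forall p, is_derive p ex phase_fun (phase_gx p);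
  phase_dery : forall p, is_derive p ey phase_fun (phase_gy p);
  phase_mulxE : forall f p, phase_mulx f p = (phase_gx p)%:C%C * f p;
  phase_mulyE : forall f p, phase_muly f p = (phase_gy p)%:C%C * f p;
  phase_mulx_cont : scontinuous phase_mulx;
  phase_muly_cont : scontinuous phase_muly }.

Section PhaseOperator.
Context {R : realType}.
Local Notation C := R[i].
Local Notation ReC := (@complex.Re R).
Local Notation ImC := (@complex.Im R).
Variable q : phase R.
Implicit Types f g : schwartz R.

Definition cis_mul f : R * R -> C := fun p => cis (q p) * f p.

Lemma Re_cis_mul f : ReC \o cis_mul f =
  (cos \o q) * (ReC \o f) - (sin \o q) * (ImC \o f).
Proof.
apply/funext => p; rewrite /cis_mul /cis.
by change (complex.Re ((cos (q p) +i* sin (q p))%C * f p) =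
  cos (q p) * complex.Re (f p) - sin (q p) * complex.Im (f p)); case: (f p).
Qed.

Lemma Im_cis_mul f : ImC \o cis_mul f =
  (cos \o q) * (ImC \o f) + (sin \o q) * (ReC \o f).
Proof.
apply/funext => p; rewrite /cis_mul /cis.
by change (complex.Im ((cos (q p) +i* sin (q p))%C * f p) =
  cos (q p) * complex.Im (f p) + sin (q p) * complex.Re (f p)); case: (f p).
Qed.

Lemma cis_mul_cont f : continuous (ReC \o cis_mul f) /\ continuous (ImC \o cis_mul f).
Proof.
have [cr ci] := schwartz_cont f.
have cc : continuous (cos \o q).
  by move=> p; apply: continuous_comp; [exact: phase_cont|exact: continuous_cos].
have cs : continuous (sin \o q).
  by move=> p; apply: continuous_comp; [exact: phase_cont|exact: continuous_sin].
rewrite Re_cis_mul Im_cis_mul; split => p.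
  by apply: cvgB; apply: cvgM; [exact: cc|exact: cr|exact: cs|exact: ci].
by apply: cvgD; apply: cvgM; [exact: cc|exact: ci|exact: cs|exact: cr].
Qed.

(** The product rule for exp(iq) f gives exp(iq) (f_v + i q_v f). The factor in brackets is supplied
    as a Schwartz function f', so that the derivative is again of the form [cis_mul]. *)
Lemma cis_mul_pd v (gv : R * R -> R) f f' :
  dir v -> (forall p, is_derive p v q (gv p)) ->
  (forall p, f' p = pd v f p + 'i%C * ((gv p)%:C%C * f p)) ->
  is_pd v (cis_mul f) (cis_mul f').
Proof.
move=> dv dq f'E; have [fr fi] := (schwartzP f).1 1%N.
have dr p := DeriveDef (Ck_derivable (p:=p) dv fr) erefl.
have di p := DeriveDef (Ck_derivable (p:=p) dv fi) erefl.
have dc p := is_derive_dir_comp dv (dq p) (is_derive_cos (q p)).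
have ds p := is_derive_dir_comp dv (dq p) (is_derive_sin (q p)).
have Dr p := is_deriveB (is_deriveM (dc p) (dr p)) (is_deriveM (ds p) (di p)).
have Di p := is_deriveD (is_deriveM (dc p) (di p)) (is_deriveM (ds p) (dr p)).
split=> [p|p|].
- by rewrite Re_cis_mul; have [] := Dr p.
- by rewrite Im_cis_mul; have [] := Di p.
apply/funext => p; rewrite /pd Re_cis_mul Im_cis_mul.
rewrite (@derive_val _ _ _ _ _ _ _ (Dr p)) (@derive_val _ _ _ _ _ _ _ (Di p)).
rewrite /cis_mul f'E /pd /cis /=.
move: ('D_v _ p) ('D_v _ p) => a b; rewrite /GRing.scale /=.
by case: (f p) => x y; apply/eqP; rewrite eq_complex /=; apply/andP; split;
  apply/eqP; ring.
Qed.

End PhaseOperator.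

Section PhaseContinuous.
Context {R : realType}.
Local Notation C := R[i].
Implicit Types (q : phase R) (f g : schwartz R).

Lemma schwartzE (c : C) f g p : (c *: f + g : schwartz R) p = c * f p + g p.
Proof. by []. Qed.

Lemma spdxE f p : spdx f p = pd ex f p. Proof. by []. Qed.
Lemma spdyE f p : spdy f p = pd ey f p. Proof. by []. Qed.
Lemma smulxE f p : smulx f p = (p.1)%:C%C * f p. Proof. by []. Qed.
Lemma smulyE f p : smuly f p = (p.2)%:C%C * f p. Proof. by []. Qed.

(** The conjugate exp(-iq) d_x exp(iq) of the derivative. *)
Definition phase_pdx q f : schwartz R := 'i%C *: phase_mulx q f + spdx f.
Definition phase_pdy q f : schwartz R := 'i%C *: phase_muly q f + spdy f.

Lemma cis_mul_pdx q f : is_pd ex (cis_mul q f) (cis_mul q (phase_pdx q f)).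
Proof.
apply: (cis_mul_pd dir_ex (phase_derx q)) => p.
by rewrite /phase_pdx schwartzE phase_mulxE addrC.
Qed.

Lemma cis_mul_pdy q f : is_pd ey (cis_mul q f) (cis_mul q (phase_pdy q f)).
Proof.
apply: (cis_mul_pd dir_ey (phase_dery q)) => p.
by rewrite /phase_pdy schwartzE phase_mulyE addrC.
Qed.

Lemma cis_mul_mulx q f p : (p.1)%:C%C * cis_mul q f p = cis_mul q (smulx f) p.
Proof. by rewrite /cis_mul mulrCA. Qed.

Lemma cis_mul_muly q f p : (p.2)%:C%C * cis_mul q f p = cis_mul q (smuly f) p.
Proof. by rewrite /cis_mul mulrCA. Qed.

Lemma normc_le_snorm0 f p : normc (f p) <= snorm 0 f.
Proof.
have := weighted_le_seminorm 0 0 0 0 p (schwartzP f).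
rewrite /weighted !expr0 !mul1r => /le_trans; apply.
exact: seminorm_le_snorm.
Qed.

Lemma cis_mul_bound q : exists (K : R) N, 0 <= K /\
  forall f p, normc (cis_mul q f p) <= K * snorm N f.
Proof.
exists 1, 0%N; split => // f p.
by rewrite /cis_mul normcM normc_cis !mul1r normc_le_snorm0.
Qed.

Definition scis q f : schwartz R := schwartz_of (schwartz_operator (cis_mul_cont q)
  (cis_mul_pdx q) (cis_mul_pdy q) (cis_mul_mulx q) (cis_mul_muly q)
  (cis_mul_bound q) f).

Lemma scisE q f p : scis q f p = cis (q p) * f p.
Proof. by []. Qed.

Lemma scis_linear q : linear (scis q).
Proof.
move=> c f g; apply: schwartz_inj => p.
by rewrite schwartzE !scisE schwartzE mulrDr mulrCA.
Qed.

HB.instance Definition _ q :=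
  GRing.isLinear.Build C (schwartz R) (schwartz R) _ (scis q) (scis_linear q).

Lemma scis_continuous q : scontinuous (scis q).
Proof.
apply: schwartz_operator_continuous.
- by apply: scontinuous_lin; [exact: phase_mulx_cont|exact: spdx_continuous].
- by apply: scontinuous_lin; [exact: phase_muly_cont|exact: spdy_continuous].
- exact: smulx_continuous.
- exact: smuly_continuous.
Qed.

Lemma spdx_scis q f : spdx (scis q f) = scis q ('i%C *: phase_mulx q f + spdx f).
Proof. by apply: val_inj; have [_ _] := cis_mul_pdx q f. Qed.

Lemma spdy_scis q f : spdy (scis q f) = scis q ('i%C *: phase_muly q f + spdy f).
Proof. by apply: val_inj; have [_ _] := cis_mul_pdy q f. Qed.

Lemma smulx_scis q f : smulx (scis q f) = scis q (smulx f).
Proof. by apply: schwartz_inj => p; exact: cis_mul_mulx. Qed.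

Lemma smuly_scis q f : smuly (scis q f) = scis q (smuly f).
Proof. by apply: schwartz_inj => p; exact: cis_mul_muly. Qed.

End PhaseContinuous.

(** * Linear and quadratic phases *)

Section LinearQuadraticPhases.
Context {R : realType}.
Local Notation C := R[i].
Definition affine_mul (a b c : R) (f : schwartz R) : schwartz R :=
  a%:C%C *: smulx f + (b%:C%C *: smuly f + c%:C%C *: f).

Lemma affine_mulE (a b c : R) f p :
  affine_mul a b c f p = (a * p.1 + b * p.2 + c)%:C%C * f p.
Proof.
rewrite /affine_mul 2!schwartzE smulxE smulyE.
change (a%:C%C * ((p.1)%:C%C * f p) + (b%:C%C * ((p.2)%:C%C * f p) + c%:C%C * f p) =
  (a * p.1 + b * p.2 + c)%:C%C * f p).
by rewrite !rmorphD !rmorphM; ring.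
Qed.

Lemma affine_mul_linear (a b c : R) : linear (affine_mul a b c).
Proof.
move=> k f g; apply: schwartz_inj => p.
rewrite affine_mulE (schwartzE k f g) (schwartzE k (affine_mul a b c f)).
by rewrite !affine_mulE; ring.
Qed.

HB.instance Definition _ (a b c : R) := GRing.isLinear.Build C (schwartz R)
  (schwartz R) _ (affine_mul a b c) (affine_mul_linear a b c).

Lemma affine_mul_continuous (a b c : R) : scontinuous (affine_mul a b c).
Proof.
apply: scontinuous_lin smulx_continuous _.
(* The splitting c = (c - 1) + 1 leaves a last summand with coefficient one, the form that
   [scontinuous_lin] accepts. *)
have -> : (fun f : schwartz R => b%:C%C *: smuly f + c%:C%C *: f) =
    (fun f : schwartz R => b%:C%C *: smuly f + ((c - 1)%:C%C *: f + f)).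
  apply/funext => f; congr (_ + _).
  by rewrite rmorphB rmorph1 scalerBl scale1r subrK.
apply: scontinuous_lin smuly_continuous _.
by apply: scontinuous_lin; exact: scontinuous_id.
Qed.

Variables a b c d e : R.

(** The Hessian has entries a, b, b, c and the linear part is (d, e). The linear part yields the
    Fourier characters, the quadratic part the shears. *)
Definition quadratic (p : R * R) : R :=
  (a * (p.1 * p.1) + c * (p.2 * p.2)) / 2 + b * (p.1 * p.2) + (d * p.1 + e * p.2).

Lemma quadratic_cont : continuous quadratic.
Proof.
move=> p; have c1 : {for p, continuous (fst : R * R -> R)} by exact: cvg_fst.
have c2 : {for p, continuous (snd : R * R -> R)} by exact: cvg_snd.
have cM (k : R) (f g : R * R -> R) : {for p, continuous f} ->
    {for p, continuous g} -> {for p, continuous (fun p => k * (f p * g p))}.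
  by move=> cf cg; apply: cvgM; [exact: cvg_cst|apply: cvgM].
have cZ (k : R) (f : R * R -> R) : {for p, continuous f} ->
    {for p, continuous (fun p => k * f p)}.
  by move=> cf; apply: cvgM; [exact: cvg_cst|].
apply: cvgD; last by apply: cvgD; exact: cZ.
apply: cvgD; last exact: cM.
by apply: cvgM; [apply: cvgD; exact: cM|exact: cvg_cst].
Qed.

(** The Taylor expansion of order two is exact, with remainder (a / 2) t^2. *)
Lemma quadratic_derx p : is_derive p ex quadratic (a * p.1 + b * p.2 + d).
Proof.
apply: (@is_derive_taylor _ _ _ _ _ `|a / 2|) => t.
rewrite -[t ^+ 2]ger0_norm ?sqr_ge0// -normrM le_eqVlt; apply/orP; left.
by case: p => x y; apply/eqP; congr `|_|; rewrite /quadratic /ex /=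
  /GRing.scale /=; field.
Qed.

Lemma quadratic_dery p : is_derive p ey quadratic (b * p.1 + c * p.2 + e).
Proof.
apply: (@is_derive_taylor _ _ _ _ _ `|c / 2|) => t.
rewrite -[t ^+ 2]ger0_norm ?sqr_ge0// -normrM le_eqVlt; apply/orP; left.
by case: p => x y; apply/eqP; congr `|_|; rewrite /quadratic /ex /=
  /GRing.scale /=; field.
Qed.

Definition quadratic_phase : phase R := Phase quadratic_cont quadratic_derx
  quadratic_dery (affine_mulE a b d) (affine_mulE b c e)
  (affine_mul_continuous a b d) (affine_mul_continuous b c e).

End LinearQuadraticPhases.

(** * The Fourier transform *)

Section Fourier.
Context {R : realType}.
Local Notation C := R[i].
Local Notation mu := (@lebesgue_measure R \x @lebesgue_measure R)%E.
Local Notation ReC := (@complex.Re R).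
Local Notation ImC := (@complex.Im R).
Implicit Types (f g : schwartz R) (p xi v : R * R).

Definition sint f : C := cintegral mu f.

Lemma sint_lin (c : C) f g : sint (c *: f + g) = c * sint f + sint g.
Proof.
rewrite /sint -cintegralZ; last exact: cintegrable_schwartz.
rewrite -cintegralD//; last exact: cintegrable_schwartz.
exact/cintegrableZ/cintegrable_schwartz.
Qed.

HB.instance Definition _ := GRing.isLinear.Build C (schwartz R) C _ sint sint_lin.

Lemma normc_sint f (K : R) : (forall p, normc (f p) <= K * weight p) ->
  normc (sint f) <= 2 * weight_mass * K.
Proof. by apply: normc_cintegral_weight; exact: cmeasurable_schwartz. Qed.

Definition dot p v : R := p.1 * v.1 + p.2 * v.2.

Lemma dotDr p v w : dot p (v + w) = dot p v + dot p w.
Proof. by rewrite /dot /=; ring. Qed.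

Lemma dotZr p (t : R) v : dot p (t *: v) = t * dot p v.
Proof. by rewrite /dot /= /GRing.scale /=; ring. Qed.

(** Taking the character as a phase makes modulation by exp(-i p.xi) an operator on S(R^2), with its
    commutation rules already proved. *)
Definition character xi : phase R := quadratic_phase 0 0 0 (- xi.1) (- xi.2).

Lemma characterE xi p : character xi p = - dot p xi.
Proof.
change (quadratic 0 0 0 (- xi.1) (- xi.2) p = - dot p xi).
by rewrite /quadratic /dot; field.
Qed.

(* \hat f (xi) = \int f(p) e^{-i p.xi} dp *)
Definition fourier f xi : C := sint (scis (character xi) f).

Lemma fourier_lin (c : C) f g xi :
  fourier (c *: f + g) xi = c * fourier f xi + fourier g xi.
Proof. by rewrite /fourier !linearP. Qed.

Lemma fourierZ (c : C) f xi : fourier (c *: f) xi = c * fourier f xi.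
Proof. by rewrite /fourier !linearZ. Qed.

Lemma fourier_bound : exists (K : R) N, 0 <= K /\
  forall f xi, normc (fourier f xi) <= K * snorm N f.
Proof.
exists (2 * weight_mass * 4), 2%N; split.
  by rewrite !mulr_ge0// weight_mass_ge0.
move=> f xi; rewrite -mulrA; apply: normc_sint => p.
by rewrite scisE normcM normc_cis mul1r schwartz_decay.
Qed.

(** With s = p.v, the integrand is exp(-i p.xi) f(p) times the second order remainder of exp(-its),
    hence at most 2 t^2 s^2 |f(p)|, and s^2 f is the Schwartz function [mv (mv f)]. *)
Lemma fourier_taylor v (mv : schwartz R -> schwartz R) f xi (t : R) :
  (forall f p, mv f p = (dot p v)%:C%C * f p) ->
  normc (fourier f (t *: v + xi) - fourier f xi -
    t%:C%C * fourier (- 'i%C *: mv f) xi) <=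
  2 * weight_mass * (2 * (4 * snorm 2 (mv (mv f)))) * t ^+ 2.
Proof.
move=> mvE.
rewrite -[leRHS]mulrA.
have -> : fourier f (t *: v + xi) - fourier f xi -
    t%:C%C * fourier (- 'i%C *: mv f) xi =
    sint ((-1) *: scis (character xi) f + ((t%:C%C * 'i%C) *:
      scis (character xi) (mv f) + scis (character (t *: v + xi)) f)).
  rewrite sint_lin sint_lin fourierZ /fourier.
  by move: (sint _) (sint _) (sint _) => x y z; ring.
apply: normc_sint => p; rewrite 2!schwartzE !scisE mvE !characterE.
rewrite dotDr dotZr (opprD (t * _)) (cisD (- (t * _))); set s := dot p v.
have -> : -1 * (cis (- dot p xi) * f p) +
    (t%:C%C * 'i%C * (cis (- dot p xi) * (s%:C%C * f p)) +
    cis (- (t * s)) * cis (- dot p xi) * f p) =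
    cis (- dot p xi) * (f p * (cis (- (t * s)) - 1 - 'i%C * (- (t * s))%:C%C)).
  by rewrite rmorphN rmorphM; ring.
rewrite normcM normc_cis mul1r normcM.
apply: (le_trans (ler_wpM2l (normc_ge0 _) (normc_cis_taylor _))).
have := schwartz_decay (mv (mv f)) p.
rewrite !mvE !normcM !normc_real -/s => H.
have := ler_wpM2r (sqr_ge0 t) H.
have -> : `|s| * (`|s| * normc (f p)) = s ^+ 2 * normc (f p).
  by rewrite mulrA -expr2 real_normK// num_real.
move: (normc _) (weight p) (snorm _ _) => n w m; rewrite sqrrN exprMn; lra.
Qed.

Lemma dot_ex p : dot p ex = p.1. Proof. by rewrite /dot mulr1 mulr0 addr0. Qed.
Lemma dot_ey p : dot p ey = p.2. Proof. by rewrite /dot mulr1 mulr0 add0r. Qed.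

Lemma fourier_pdx f : is_pd ex (fourier f) (fourier (- 'i%C *: smulx f)).
Proof.
apply: is_pd_taylor => xi; eexists => t.
by apply: fourier_taylor => g p; rewrite dot_ex smulxE.
Qed.

Lemma fourier_pdy f : is_pd ey (fourier f) (fourier (- 'i%C *: smuly f)).
Proof.
apply: is_pd_taylor => xi; eexists => t.
by apply: fourier_taylor => g p; rewrite dot_ey smulyE.
Qed.

(** Here |exp(-is) - 1| <= 2 |s| with s = p.(xi - eta), and |s| <= (|x| + |y|) |xi - eta| for the
    maximum norm; x f and y f are Schwartz functions. *)
Lemma fourier_lipschitz f : exists2 K : R, 0 <= K &
  forall xi eta, normc (fourier f xi - fourier f eta) <= K * `|xi - eta|.
Proof.
exists (2 * weight_mass * (2 * (4 * (snorm 2 (smulx f) + snorm 2 (smuly f))))).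
  by rewrite !(mulr_ge0, addr_ge0)// ?weight_mass_ge0 ?snorm_ge0.
move=> xi eta; set d := `|xi - eta|; rewrite -[leRHS]mulrA.
have -> : fourier f xi - fourier f eta =
    sint ((-1) *: scis (character eta) f + scis (character xi) f).
  by rewrite sint_lin /fourier mulN1r addrC.
apply: normc_sint => p; rewrite schwartzE !scisE !characterE.
have -> : - dot p xi = - dot p (xi - eta) + - dot p eta.
  by rewrite -opprD -dotDr subrK.
rewrite (cisD (- dot p (xi - eta))); set s := dot p (xi - eta).
have -> : -1 * (cis (- dot p eta) * f p) + cis (- s) * cis (- dot p eta) * f p =
    cis (- dot p eta) * (f p * (cis (- s) - 1)) by ring.
rewrite normcM normc_cis mul1r normcM.
apply: (le_trans (ler_wpM2l (normc_ge0 _) (normc_cisB1_le _))).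
have s_le : `|s| <= (`|p.1| + `|p.2|) * d.
  rewrite /s /dot (le_trans (ler_normD _ _))// !normrM mulrDl.
  by rewrite lerD// ler_wpM2l// /d prod_normE/= le_max lexx ?orbT.
have d0 : 0 <= d by rewrite /d normr_ge0.
have := ler_wpM2r d0 (schwartz_decay (smulx f) p).
have := ler_wpM2r d0 (schwartz_decay (smuly f) p).
have := ler_wpM2l (normc_ge0 (f p)) s_le.
rewrite smulxE smulyE !normcM !normc_real normrN.
move: (normc _) (weight p) (snorm _ _) (snorm _ _) => n w m m'; lra.
Qed.

Lemma fourier_cont f : continuous (ReC \o fourier f) /\
  continuous (ImC \o fourier f).
Proof.
have [K K0 HK] := fourier_lipschitz f.
have K1 : 0 < K + 1 by rewrite ltr_wpDl.
have cont (c : C -> R) : (forall z, `|c z| <= normc z) ->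
    (forall z w, c (z - w) = c z - c w) -> continuous (c \o fourier f).
  move=> cn cB xi; apply/cvgrPdist_le => e e0; near=> eta.
  rewrite /= -cB; apply: le_trans (cn _) _; apply: le_trans (HK _ _) _.
  apply: (@le_trans _ _ ((K + 1) * `|xi - eta|)).
    by rewrite ler_wpM2r// lerDl.
  rewrite mulrC -ler_pdivlMr//; near: eta.
  by apply: cvgr_dist_le; [exact: cvg_id|exact: divr_gt0].
split; apply: cont => //.
- exact: normr_Re_le.
- by move=> [? ?] [? ?].
- exact: normr_Im_le.
- by move=> [? ?] [? ?].
Unshelve. all: by end_near. Qed.

(** The integral of d_x (exp(-i z.p) f(z)) = exp(-i z.p) (d_x f - i p.1 f) over z vanishes. *)
Lemma fourier_mulx f p : (p.1)%:C%C * fourier f p = fourier (- 'i%C *: spdx f) p.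
Proof.
have : sint (spdx (scis (character p) f)) = 0 by exact: cintegral_spdx.
rewrite spdx_scis linearP sint_lin fourierZ /fourier.
have -> : phase_mulx (character p) f = (- p.1)%:C%C *: f.
  apply: schwartz_inj => z; rewrite phase_mulxE.
  change ((0 * z.1 + 0 * z.2 + - p.1)%:C%C * f z = (- p.1)%:C%C * f z).
  by rewrite !mul0r !add0r.
rewrite !linearZ /= rmorphN.
move: (sint _) (sint _) => x y /eqP; rewrite addrC addr_eq0 => /eqP ->.
rewrite /GRing.scale /=.
have ii : 'i%C * 'i%C = -1 :> C by rewrite -expr2 sqr_i.
transitivity (- ('i%C * 'i%C) * ((p.1)%:C%C * y)); last by ring.
by rewrite ii opprK mul1r.
Qed.

Lemma fourier_muly f p : (p.2)%:C%C * fourier f p = fourier (- 'i%C *: spdy f) p.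
Proof.
have : sint (spdy (scis (character p) f)) = 0 by exact: cintegral_spdy.
rewrite spdy_scis linearP sint_lin fourierZ /fourier.
have -> : phase_muly (character p) f = (- p.2)%:C%C *: f.
  apply: schwartz_inj => z; rewrite phase_mulyE.
  change ((0 * z.1 + 0 * z.2 + - p.2)%:C%C * f z = (- p.2)%:C%C * f z).
  by rewrite !mul0r !add0r.
rewrite !linearZ /= rmorphN.
move: (sint _) (sint _) => x y /eqP; rewrite addrC addr_eq0 => /eqP ->.
rewrite /GRing.scale /=.
have ii : 'i%C * 'i%C = -1 :> C by rewrite -expr2 sqr_i.
transitivity (- ('i%C * 'i%C) * ((p.2)%:C%C * y)); last by ring.
by rewrite ii opprK mul1r.
Qed.

Definition sfourier f : schwartz R := schwartz_of (schwartz_operator fourier_cont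
  fourier_pdx fourier_pdy fourier_mulx fourier_muly fourier_bound f).

Lemma sfourierE f p : sfourier f p = fourier f p. Proof. by []. Qed.

Lemma sfourier_linear : linear sfourier.
Proof.
by move=> c f g; apply: schwartz_inj => p; rewrite schwartzE !sfourierE fourier_lin.
Qed.

HB.instance Definition _ :=
  GRing.isLinear.Build C (schwartz R) (schwartz R) _ sfourier sfourier_linear.

Lemma scontinuousZ (c : C) (A : schwartz R -> schwartz R) :
  scontinuous A -> scontinuous (fun f => c *: A f).
Proof.
move=> cA; have -> : (fun f => c *: A f) = (fun f => (c - 1) *: A f + A f).
  by apply/funext => f; rewrite scalerBl scale1r subrK.
exact: scontinuous_lin.
Qed.

Lemma sfourier_continuous : scontinuous sfourier.
Proof.
apply: schwartz_operator_continuous; apply: scontinuousZ.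
- exact: smulx_continuous.
- exact: smuly_continuous.
- exact: spdx_continuous.
- exact: spdy_continuous.
Qed.

Lemma spdx_sfourier f : spdx (sfourier f) = sfourier (- 'i%C *: smulx f).
Proof. by apply: val_inj; have [_ _] := fourier_pdx f. Qed.

Lemma spdy_sfourier f : spdy (sfourier f) = sfourier (- 'i%C *: smuly f).
Proof. by apply: val_inj; have [_ _] := fourier_pdy f. Qed.

Lemma smulx_sfourier f : smulx (sfourier f) = sfourier (- 'i%C *: spdx f).
Proof. by apply: schwartz_inj => p; exact: fourier_mulx. Qed.

Lemma smuly_sfourier f : smuly (sfourier f) = sfourier (- 'i%C *: spdy f).
Proof. by apply: schwartz_inj => p; exact: fourier_muly. Qed.

End Fourier.

(** * Gaussians and Fourier inversion *)

Section Gaussian.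
Context {R : realType}.
Local Notation C := R[i].
Local Notation leb := (@lebesgue_measure R).
Local Notation mu := (@lebesgue_measure R \x @lebesgue_measure R)%E.
Implicit Types (p m : R * R).

Lemma is_pd_real v (h h' : R * R -> R) : (forall p, is_derive p v h (h' p)) ->
  is_pd v (fun p => (h p)%:C%C) (fun p => (h' p)%:C%C).
Proof.
move=> dh; have E : @complex.Re R \o (fun p => (h p)%:C%C) = h by apply/funext.
have E0 : @complex.Im R \o (fun p => (h p)%:C%C) = cst 0 by apply/funext.
split=> [p|p|]; first by rewrite E; have [] := dh p.
  by rewrite E0; exact: derivable_cst.
apply/funext => p; rewrite /pd E E0 (@derive_val _ _ _ _ _ _ _ (dh p)).
by rewrite derive_cst.
Qed.

Lemma is_derive_funM (f g : R -> R) (x df dg l : R) :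
  is_derive x (1 : R) f df -> is_derive x (1 : R) g dg ->
  f x * dg + g x * df = l -> is_derive x (1 : R) (fun x => f x * g x) l.
Proof. by move=> hf hg <-; exact: (is_deriveM hf hg). Qed.

Lemma normal_fun_le1 (m s x : R) : normal_fun m s x <= 1.
Proof.
rewrite /normal_fun -[leRHS]expR0 ler_expR mulNr oppr_le0.
by rewrite mulr_ge0 ?sqr_ge0// invr_ge0 mulrn_wge0// sqr_ge0.
Qed.

Lemma is_derive_normal_fun (m s x : R) : s != 0 ->
  is_derive x (1 : R) (normal_fun m s) (- ((x - m) / s ^+ 2) * normal_fun m s x).
Proof.
move=> s0.
have d1 : is_derive x (1 : R) (fun x => - (x - m) ^+ 2 / (s ^+ 2 *+ 2))
    (- ((x - m) / s ^+ 2)).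
  have E : (fun x => - (x - m) ^+ 2 / (s ^+ 2 *+ 2)) =
    horner (- (s ^+ 2 *+ 2)^-1 *: ('X - m%:P) ^+ 2).
    apply/funext => z; rewrite hornerZ horner_exp hornerXsubC.
    by rewrite !mulNr mulrC.
  rewrite E; apply: is_derive_eq.
  rewrite expr2 derivZ derivM derivXsubC mul1r mulr1 hornerZ hornerD hornerXsubC.
  by rewrite -[s ^+ 2 *+ 2]mulr_natl; field.
by rewrite mulrC; exact: is_derive1_comp.
Qed.

(** With t = x^2 / (2 s^2), exp(t) >= t^(n+1) / (n+1)!, and |x|^n <= |x|^(2(n+1)) where |x| > 1. For
    |x| <= 1 the summand 1 of the constant suffices. *)
Lemma normal_fun_moment (s : R) n : s != 0 ->
  exists2 K : R, 0 <= K & forall x, `|x| ^+ n * normal_fun 0 s x <= K.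
Proof.
move=> s0; have s2 : 0 < s ^+ 2 *+ 2 by rewrite pmulrn_lgt0// exprn_even_gt0.
exists (1 + (s ^+ 2 *+ 2) ^+ n.+1 * n.+1`!%:R).
  by rewrite addr_ge0// mulr_ge0// exprn_ge0// ltW.
move=> x; set t := x ^+ 2 / (s ^+ 2 *+ 2).
have t0 : 0 <= t by rewrite mulr_ge0 ?sqr_ge0 ?invr_ge0 ?ltW.
have nE : normal_fun 0 s x = (expR t)^-1.
  by rewrite /normal_fun subr0 mulNr expRN.
have e1 := normal_fun_le1 0 s x; have e0 := normal_fun_ge0 0 s x.
have [x1|x1] := leP `|x| 1.
  apply: (@le_trans _ _ 1); last first.
    by rewrite lerDl mulr_ge0// exprn_ge0// ltW.
  by apply: (@le_trans _ _ (1 * 1)); [apply: ler_pM => //; rewrite exprn_ile1|rewrite mulr1].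
apply: (@le_trans _ _ ((s ^+ 2 *+ 2) ^+ n.+1 * n.+1`!%:R)); last by rewrite lerDr.
rewrite nE ler_pdivrMr ?expR_gt0//.
apply: (@le_trans _ _ ((s ^+ 2 *+ 2) ^+ n.+1 * t ^+ n.+1)).
  rewrite -exprMn /t mulrC divfK ?gt_eqF//.
  rewrite -(real_normK (num_real x)).
  rewrite -exprM; apply: ler_weXn2l; first exact: ltW.
  by rewrite mul2n -addnn (leq_trans (leqnSn n))// leq_addr.
rewrite -mulrA; apply: ler_wpM2l; first by rewrite exprn_ge0// ltW.
have F0 : 0 < n.+1`!%:R :> R by rewrite ltr0n fact_gt0.
rewrite -ler_pdivrMl// mulrC; apply: le_trans (expR_ge1Dxn n t0).
by rewrite lerDr.
Qed.

Lemma poly_normal_fun_bounded (s : R) (q : {poly R}) : s != 0 ->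
  exists2 K : R, 0 <= K & forall x, `|q.[x] * normal_fun 0 s x| <= K.
Proof.
(* The power |x|^n is added because the induction step from q to q X + c moves a factor x from the
   polynomial to it. *)
move=> s0; suff H n : exists2 K : R, 0 <= K &
    forall x, `|q.[x]| * (`|x| ^+ n * normal_fun 0 s x) <= K.
  have [K K0 HK] := H 0%N; exists K => // x.
  by rewrite normrM (ger0_norm (normal_fun_ge0 _ _ _)) -[normal_fun _ _ _]mul1r HK.
elim/poly_ind: q n => [|q c IH] n.
  by exists 0 => // x; rewrite horner0 normr0 mul0r.
have [K K0 HK] := IH n.+1; have [L L0 HL] := normal_fun_moment n s0.
exists (K + `|c| * L); first by rewrite addr_ge0// mulr_ge0.
move=> x; rewrite hornerMXaddC.
have g0 : 0 <= `|x| ^+ n * normal_fun 0 s x by rewrite mulr_ge0// normal_fun_ge0.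
apply: le_trans (ler_wpM2r g0 (ler_normD _ _)) _.
rewrite mulrDl; apply: lerD; last by rewrite ler_wpM2l.
by have := HK x; rewrite normrM exprS !mulrA.
Qed.

Variable s : R.
Hypothesis s0 : s != 0.

(** Polynomial times Gaussian in each variable, indexed by the two polynomials: the smallest
    convenient family that contains the Gaussian and is closed under derivatives and coordinates. *)
Definition hermite (qr : {poly R} * {poly R}) : R * R -> C := fun p =>
  ((qr.1.[p.1] * normal_fun 0 s p.1) * (qr.2.[p.2] * normal_fun 0 s p.2))%:C%C.

Definition hermite_deriv (q : {poly R}) : {poly R} :=
  q^`() - (s ^- 2) *: (q * 'X).

Lemma hermite_derivE (q : {poly R}) (x : R) :
  (hermite_deriv q).[x] = q^`().[x] - s ^- 2 * (q.[x] * x).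
Proof. by rewrite /hermite_deriv hornerD hornerN hornerZ hornerMX. Qed.

Lemma is_derive_hermite (q : {poly R}) (x : R) :
  is_derive x (1 : R) (fun x => q.[x] * normal_fun 0 s x)
    ((hermite_deriv q).[x] * normal_fun 0 s x).
Proof.
apply: (is_derive_funM (is_derive_poly q x) (is_derive_normal_fun 0 x s0)).
by rewrite hermite_derivE subr0; field.
Qed.

Lemma hermite_cont qr : continuous (@complex.Re R \o hermite qr) /\
  continuous (@complex.Im R \o hermite qr).
Proof.
have c1 (q : {poly R}) : continuous (fun x => q.[x] * normal_fun 0 s x).
  move=> x; apply/differentiable_continuous/derivable1_diffP.
  by have [] := is_derive_hermite q x.
split => p; last exact: cvg_cst.
apply: cvgM.
  apply: (@continuous_comp _ _ _ fst (fun x => qr.1.[x] * normal_fun 0 s x)).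
    exact: cvg_fst.
  exact: c1.
apply: (@continuous_comp _ _ _ snd (fun x => qr.2.[x] * normal_fun 0 s x)).
  exact: cvg_snd.
exact: c1.
Qed.

Lemma hermite_pdx qr : is_pd ex (hermite qr) (hermite (hermite_deriv qr.1, qr.2)).
Proof.
apply: is_pd_real => -[x y]; apply: is_derive_ex_line => /=.
set k := qr.2.[y] * _.
apply: (is_derive_funM (is_derive_hermite qr.1 x) (is_derive_cst k x 1)).
by rewrite mulr0 add0r mulrC.
Qed.

Lemma hermite_pdy qr : is_pd ey (hermite qr) (hermite (qr.1, hermite_deriv qr.2)).
Proof.
apply: is_pd_real => -[x y]; apply: is_derive_ey_line => /=.
set k := qr.1.[x] * _.
apply: (is_derive_funM (is_derive_cst k y 1) (is_derive_hermite qr.2 y)).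
by rewrite mulr0 addr0.
Qed.

Lemma hermite_mulx qr p : (p.1)%:C%C * hermite qr p = hermite (qr.1 * 'X, qr.2) p.
Proof. by rewrite /hermite -rmorphM /= hornerMX; congr (_ %:C)%C; ring. Qed.

Lemma hermite_muly qr p : (p.2)%:C%C * hermite qr p = hermite (qr.1, qr.2 * 'X) p.
Proof. by rewrite /hermite -rmorphM /= hornerMX; congr (_ %:C)%C; ring. Qed.

Lemma hermite_bound qr : exists K : R, forall p, normc (hermite qr p) <= K.
Proof.
have [K K0 HK] := poly_normal_fun_bounded qr.1 s0.
have [L L0 HL] := poly_normal_fun_bounded qr.2 s0.
by exists (K * L) => p; rewrite normc_real normrM ler_pM.
Qed.

(** Not normalised: the value at the centre m is 1 and the mass is 2 pi s^2. *)
Definition gaussian m p : R := normal_fun m.1 s p.1 * normal_fun m.2 s p.2.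

Lemma gaussian_schwartz : is_schwartz (fun p => (gaussian 0 p)%:C%C).
Proof.
have -> : (fun p => (gaussian 0 p)%:C%C) = hermite (1, 1).
  by apply/funext => p; rewrite /hermite /= -[1]polyC1 !hornerC !mul1r.
exact: (schwartz_family hermite_cont hermite_pdx hermite_pdy hermite_mulx
  hermite_muly hermite_bound).
Qed.

Definition sgaussian : schwartz R := schwartz_of gaussian_schwartz.

Lemma sgaussianE p : sgaussian p = (gaussian 0 p)%:C%C. Proof. by []. Qed.

(** Together with [spdy_sgaussian], this equation determines the Gaussian up to a constant factor,
    see [ode_gaussian]. *)
Lemma spdx_sgaussian : spdx sgaussian = (- s ^- 2)%:C%C *: smulx sgaussian.
Proof.
apply: schwartz_inj => p; rewrite spdxE.
have E : sgaussian = hermite (1, 1) :> (R * R -> C).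
  by apply/funext => z; rewrite sgaussianE /hermite /= -[1]polyC1 !hornerC !mul1r.
rewrite E; have [_ _ ->] := hermite_pdx (1, 1).
change (hermite (hermite_deriv 1, 1) p = (- s ^- 2)%:C%C * ((p.1)%:C%C * sgaussian p)).
rewrite E /hermite /= -!rmorphM hermite_derivE -[1]polyC1 derivC !hornerC.
by congr (_ %:C)%C; ring.
Qed.

Lemma spdy_sgaussian : spdy sgaussian = (- s ^- 2)%:C%C *: smuly sgaussian.
Proof.
apply: schwartz_inj => p; rewrite spdyE.
have E : sgaussian = hermite (1, 1) :> (R * R -> C).
  by apply/funext => z; rewrite sgaussianE /hermite /= -[1]polyC1 !hornerC !mul1r.
rewrite E; have [_ _ ->] := hermite_pdy (1, 1).
change (hermite (1, hermite_deriv 1) p = (- s ^- 2)%:C%C * ((p.2)%:C%C * sgaussian p)).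
rewrite E /hermite /= -!rmorphM hermite_derivE -[1]polyC1 derivC !hornerC.
by congr (_ %:C)%C; ring.
Qed.

Lemma integrable_normal_fun (m : R) : leb.-integrable setT (EFin \o normal_fun m s).
Proof.
have peak := normal_peak_gt0 s0.
have := integrable_scale (normal_peak s)^-1 (integrable_normal_pdf m s).
by apply: eq_integrable => // x _ /=; rewrite normal_pdfE// mulKf// gt_eqF.
Qed.

Lemma Rintegral_normal_fun (m : R) :
  \int[leb]_x normal_fun m s x = (normal_peak s)^-1.
Proof.
have peak := normal_peak_gt0 s0.
transitivity (\int[leb]_x ((normal_peak s)^-1 * normal_pdf m s x)).
  apply: eq_Rintegral => x _.
  by rewrite normal_pdfE// mulKf// gt_eqF.
rewrite RintegralZl//; last exact: integrable_normal_pdf.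
by rewrite /Rintegral integral_normal_pdf mulr1.
Qed.

Lemma integrable_gaussian m : mu.-integrable setT (EFin \o gaussian m).
Proof.
exact: (integrable_tensor (integrable_normal_fun _) (integrable_normal_fun _)).
Qed.

(** The normal density has mass one, so each factor contributes 1 / [normal_peak s], the square root
    of 2 pi s^2. *)
Lemma Rintegral_gaussian m : \int[mu]_p gaussian m p = 2 * pi * s ^+ 2.
Proof.
rewrite (Rintegral_tensor (integrable_normal_fun _) (integrable_normal_fun _)).
rewrite !Rintegral_normal_fun /normal_peak invrK -expr2 sqr_sqrtr.
  by rewrite -mulr_natl; ring.
by rewrite mulrn_wge0// mulr_ge0 ?sqr_ge0 ?pi_ge0.
Qed.

End Gaussian.

(* For a product measure the library only infers the sigma-finite structure of a
   product of subprobabilities, whose canonical instance shadows the general one. *)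
Definition plane_measure (R : realType) :
    set (measurableTypeR R * measurableTypeR R) -> \bar R :=
  (@lebesgue_measure R \x @lebesgue_measure R)%E.

HB.instance Definition _ (R : realType) := measure_function.Measure.on (@plane_measure R).

(** The squares F n x F n of an exhaustion of the line cover the plane because F is
    nondecreasing. *)
Lemma sigma_finite_plane_measure (R : realType) :
  sigma_finite setT (@plane_measure R).
Proof.
have /sigma_finiteP[F [TF ndF Foo]] := sigma_finiteT (@lebesgue_measure R).
exists (fun n => F n `*` F n).
  rewrite -setXTT TF predeqE => -[x y]; split.
    move=> [/= [n _ Fnx] [k _ Fky]]; exists (maxn n k) => //; split.
    - by move: x Fnx; exact/subsetPset/ndF/leq_maxl.
    - by move: y Fky; exact/subsetPset/ndF/leq_maxr.
  by move=> [n _ []/= ? ?]; split; exists n.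
move=> k; have [? ?] := Foo k; split; first exact: measurableX.
rewrite /plane_measure product_measure1E// lte_mul_pinfty// ge0_fin_numE//.
Qed.

HB.instance Definition _ (R : realType) := Measure_isSigmaFinite.Build _ _ _
  (@plane_measure R) (@sigma_finite_plane_measure R).

(** * The Fourier transform is its own transpose *)

Section FourierTranspose.
Context {R : realType}.
Local Notation C := R[i].
Local Notation mu := (@lebesgue_measure R \x @lebesgue_measure R)%E.
Implicit Types (f g : schwartz R) (p m xi : R * R).

Lemma fourierE f xi : fourier f xi = cintegral mu (fun p => cis (- dot p xi) * f p).
Proof. by apply: eq_cintegral => p; rewrite scisE characterE. Qed.

Lemma dotC p xi : dot p xi = dot xi p.
Proof. by rewrite /dot; ring. Qed.

Lemma measurable_dot : measurable_fun setT (fun z : (R * R) * (R * R) => dot z.2 z.1).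
Proof.
apply: measurable_funD; apply: measurable_funM.
- by apply: measurableT_comp measurable_fst _; exact: measurable_snd.
- by apply: measurableT_comp measurable_fst _; exact: measurable_fst.
- by apply: measurableT_comp measurable_snd _; exact: measurable_snd.
- by apply: measurableT_comp measurable_snd _; exact: measurable_fst.
Qed.

Lemma cintegral_plane (h : R * R -> C) :
  cintegral (@plane_measure R) h = cintegral mu h.
Proof. by []. Qed.

(** Fubini for g(p) exp(-i p.q) f(q), whose kernel is symmetric in p and q. It is used twice: to
    move the transform onto a Gaussian in the inversion formula, and to see that [tfourier] extends
    the transform of functions. *)
Lemma fourier_transpose f g :
  cintegral mu (fun p => g p * fourier f p) =
  cintegral mu (fun p => fourier g p * f p).
Proof.
pose k (z : (R * R) * (R * R)) : C := g z.1 * (cis (- dot z.2 z.1) * f z.2).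
have iw (K : R) : mu.-integrable setT (EFin \o (fun p => K * weight p)).
  exact: integrable_scale integrable_weight.
have mk : cmeasurable k.
  have mc h : cmeasurable (schwartz_fun h \o (fst : (R * R) * (R * R) -> _)) /\
      cmeasurable (schwartz_fun h \o (snd : (R * R) * (R * R) -> _)).
    have [mr mi] := cmeasurable_schwartz h; split; split.
    - exact: measurableT_comp mr measurable_fst.
    - exact: measurableT_comp mi measurable_fst.
    - exact: measurableT_comp mr measurable_snd.
    - exact: measurableT_comp mi measurable_snd.
  apply: cmeasurableM; first exact: (mc g).1.
  apply: cmeasurableM; last exact: (mc f).2.
  by apply: cmeasurable_cis; apply: measurableT_comp measurable_dot.
have kb p q : normc (k (p, q)) <= (4 * snorm 2 g * weight p) * (4 * snorm 2 f * weight q).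
  rewrite /k !normcM normc_cis mul1r.
  by apply: ler_pM; rewrite ?normc_ge0 ?schwartz_decay.
have := @cintegral_fubini _ _ _ _ R (@plane_measure R) (@plane_measure R)
  _ _ (iw _) (iw _) k mk kb.
under eq_cintegral do rewrite cintegral_plane.
rewrite cintegral_plane.
under [X in _ = X -> _]eq_cintegral do rewrite cintegral_plane.
rewrite cintegral_plane.
have int1 (h : schwartz R) xi : cintegrable mu (fun p => cis (- dot p xi) * h p).
  have -> : (fun p => cis (- dot p xi) * h p) = scis (character xi) h.
    by apply/funext => p; rewrite scisE characterE.
  exact: cintegrable_schwartz.
move=> fub.
have E1 p : g p * fourier f p = cintegral mu (fun q => k (p, q)).
  by rewrite fourierE -cintegralZ; [|exact: (int1 f p)].
have E2 p : fourier g p * f p = cintegral mu (fun q => k (q, p)).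
  rewrite fourierE mulrC -cintegralZ; last exact: (int1 g p).
  by apply: eq_cintegral => q; rewrite /k /= dotC; ring.
rewrite (eq_cintegral mu E1) (eq_cintegral mu E2).
exact: fub.
Qed.

End FourierTranspose.

(** * The Fourier transform of a Gaussian *)

Section FourierGaussian.
Context {R : realType}.
Local Notation C := R[i].
Local Notation mu := (@lebesgue_measure R \x @lebesgue_measure R)%E.
Implicit Types (f g : schwartz R) (p m xi : R * R).

(** The quotient of phi by the Gaussian has derivative zero. *)
Lemma ode_normal_fun (phi : R -> R) (s : R) : s != 0 ->
  (forall x : R, is_derive x (1 : R) phi (- (x / s ^+ 2) * phi x)) ->
  forall x, phi x = phi 0 * normal_fun 0 s x.
Proof.
move=> s0 dphi x.
have d1 (z : R) : is_derive z (1 : R) (fun z => (normal_fun 0 s z)^-1)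
    ((z / s ^+ 2) * (normal_fun 0 s z)^-1).
  have n0 : normal_fun 0 s z != 0 by rewrite /normal_fun gt_eqF// expR_gt0.
  have H := is_deriveV n0 (is_derive_normal_fun 0 z s0).
  refine (@trigger_derive R _ z _ _ H _).
  by rewrite /GRing.scale /= subr0; field; rewrite s0 n0.
have d0 (z : R) : is_derive z (1 : R) (fun z => phi z * (normal_fun 0 s z)^-1) 0.
  by apply: (is_derive_funM (dphi z) (d1 z)); ring.
have := @is_derive_0_is_cst R (fun z => phi z * (normal_fun 0 s z)^-1) x 0 d0.
have n0 : normal_fun 0 s x != 0 by rewrite /normal_fun gt_eqF// expR_gt0.
have -> : normal_fun 0 s 0 = 1.
  by rewrite /normal_fun subr0 expr0n oppr0 mul0r expR0.
by rewrite invr1 mulr1 => <-; rewrite divfK.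
Qed.

(** The coefficients are real, so Re and Im (the two values of c) solve the equations separately;
    they are integrated from (0, 0) to (0, y) and from there to (x, y). *)
Lemma ode_gaussian f (s : R) : s != 0 ->
  spdx f = (- s ^- 2)%:C%C *: smulx f -> spdy f = (- s ^- 2)%:C%C *: smuly f ->
  forall p, f p = f 0 * (gaussian s 0 p)%:C%C.
Proof.
move=> s0 fx fy [x y]; have [fr fi] := (schwartzP f).1 1%N.
have key (c : C -> R) : Ck 1 (c \o f) -> (forall (a : R) z, c (a%:C%C * z) = a * c z) ->
    'D_ex (c \o f) = c \o spdx f -> 'D_ey (c \o f) = c \o spdy f ->
    c (f (x, y)) = c (f 0) * gaussian s 0 (x, y).
  move=> c1 cM cx cy.
  have hx (u v : R) : is_derive u (1 : R) (fun u => c (f (u, v)))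
      (- (u / s ^+ 2) * c (f (u, v))).
    have := is_derive_ex (Ck_derivable (p:=(u, v)) dir_ex c1).
    rewrite (congr1 (@^~ (u, v)) cx) => H; refine (@trigger_derive R _ u _ _ H _).
    rewrite fx; change (c ((- s ^- 2)%:C%C * (u%:C%C * f (u, v))) =
      - (u / s ^+ 2) * c (f (u, v))).
    by rewrite !cM; ring.
  have hy (u v : R) : is_derive v (1 : R) (fun v => c (f (u, v)))
      (- (v / s ^+ 2) * c (f (u, v))).
    have := is_derive_ey (Ck_derivable (p:=(u, v)) dir_ey c1).
    rewrite (congr1 (@^~ (u, v)) cy) => H; refine (@trigger_derive R _ v _ _ H _).
    rewrite fy; change (c ((- s ^- 2)%:C%C * (v%:C%C * f (u, v))) =
      - (v / s ^+ 2) * c (f (u, v))).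
    by rewrite !cM; ring.
  rewrite (ode_normal_fun s0 (fun u => hx u y) x).
  rewrite (ode_normal_fun s0 (fun v => hy 0 v) y).
  by rewrite /gaussian /=; ring.
apply/eqP; rewrite eq_complex; apply/andP; split; apply/eqP.
  rewrite (key (@complex.Re R))//.
    by case: (f 0) => a b /=; rewrite mulr0 subr0.
  by move=> a [u v] /=; rewrite mul0r subr0.
rewrite (key (@complex.Im R))//.
  by case: (f 0) => a b /=; rewrite mulr0 add0r mulrC.
by move=> a [u v] /=; rewrite mul0r addr0.
Qed.

Lemma sint_sgaussian (s : R) (s0 : s != 0) :
  sint (sgaussian s0) = (2 * pi * s ^+ 2)%:C%C.
Proof.
transitivity (cintegral mu (fun p => (gaussian s 0 p)%:C%C)).
  by apply: eq_cintegral => p.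
by rewrite cintegral_real (Rintegral_gaussian s0).
Qed.

Lemma fourier_at0 f : fourier f 0 = sint f.
Proof.
rewrite fourierE; apply: eq_cintegral => p.
by rewrite /dot /= !mulr0 addr0 oppr0 cis0 mul1r.
Qed.

(** The transform exchanges derivatives and multiplications, so it turns the differential equations
    of the Gaussian of width s into those of width 1/s. The constant is the value at 0, that is the
    mass. *)
Lemma fourier_sgaussian (s : R) (s0 : s != 0) xi :
  fourier (sgaussian s0) xi = (2 * pi * s ^+ 2 * gaussian s^-1 0 xi)%:C%C.
Proof.
have s1 : s^-1 != 0 by rewrite invr_eq0.
have sc : (- s ^- 2)%:C%C * (- s^-1 ^- 2)%:C%C = 1 :> C.
  by rewrite -rmorphM -(rmorph1 (real_complex R)); congr (_ %:C)%C; field.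
rewrite -sfourierE (@ode_gaussian (sfourier (sgaussian s0)) _ s1).
- by rewrite sfourierE fourier_at0 sint_sgaussian -rmorphM.
- rewrite spdx_sfourier smulx_sfourier spdx_sgaussian !linearZ /= !scalerA.
  by congr (_ *: _); rewrite -mulrA sc mulr1.
- rewrite spdy_sfourier smuly_sfourier spdy_sgaussian !linearZ /= !scalerA.
  by congr (_ *: _); rewrite -mulrA sc mulr1.
Qed.

Lemma fourier_modulation f m xi :
  fourier (scis (character m) f) xi = fourier f (xi + m).
Proof.
rewrite !fourierE; apply: eq_cintegral => p.
by rewrite scisE characterE dotDr (opprD (dot p xi)) (cisD (- dot p xi)) mulrA.
Qed.

Lemma gaussian_shift (s : R) p m : gaussian s 0 (p + m) = gaussian s (- m) p.
Proof.
have E (x y : R) : normal_fun 0 s (x + y) = normal_fun (- y) s x.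
  by rewrite /normal_fun subr0 opprK.
case: p m => [a b] [c d].
change (normal_fun 0 s (a + c) * normal_fun 0 s (b + d) =
  normal_fun (- c) s a * normal_fun (- d) s b).
by rewrite !E.
Qed.

(** With t = u^2 / (2 s^2), |u| <= 2 s (1 + t/2) <= 2 s exp(t/2), and exp(t/2) exp(-t) <= exp(-t/4),
    which is the Gaussian of width 2 s. *)
Lemma normal_fun_abs_le (m s x : R) : 0 < s ->
  `|x - m| * normal_fun m s x <= 2 * s * normal_fun m (2 * s) x.
Proof.
move=> s0; set u := x - m; set t := u ^+ 2 / (s ^+ 2 *+ 2).
have t0 : 0 <= t by rewrite mulr_ge0 ?sqr_ge0// invr_ge0 mulrn_wge0// sqr_ge0.
have -> : normal_fun m s x = expR (- t) by rewrite /normal_fun mulNr.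
have -> : normal_fun m (2 * s) x = expR (- (t / 4)).
  have e : u ^+ 2 / ((2 * s) ^+ 2 *+ 2) = t / 4.
    by rewrite /t; field; exact: lt0r_neq0.
  by rewrite /normal_fun mulNr e.
have ut : `|u| <= 2 * s * expR (t / 2).
  apply: (@le_trans _ _ (2 * s * (1 + t / 2))); last first.
    by apply: ler_wpM2l; [rewrite mulr_ge0// ltW|exact: expR_ge1Dx].
  have -> : t = `|u| ^+ 2 / (2 * s ^+ 2).
    by rewrite /t real_normK ?num_real// mulr_natl.
  move: `|u| (normr_ge0 u) => w w0.
  rewrite -subr_ge0.
  (* Completing the square shows that the difference is nonnegative. *)
  have -> : 2 * s * (1 + w ^+ 2 / (2 * s ^+ 2) / 2) - w =
    ((w - s) ^+ 2 + 3 * s ^+ 2) / (2 * s).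
    by field; exact: lt0r_neq0.
  apply: divr_ge0; last by rewrite mulr_ge0// ltW.
  by rewrite addr_ge0 ?sqr_ge0// mulr_ge0// sqr_ge0.
apply: (@le_trans _ _ (2 * s * expR (t / 2) * expR (- t))).
  by apply: ler_wpM2r ut; exact: expR_ge0.
rewrite -mulrA -expRD; apply: ler_wpM2l; first by rewrite mulr_ge0// ltW.
by rewrite ler_expR; lra.
Qed.

Lemma normal_fun_widen (m s x : R) : 0 < s ->
  normal_fun m s x <= normal_fun m (2 * s) x.
Proof.
move=> s0; rewrite /normal_fun ler_expR !mulNr lerN2; apply: ler_wpM2l.
  exact: sqr_ge0.
rewrite lef_pV2 ?posrE ?pmulrn_lgt0 ?exprn_gt0 ?mulr_gt0//.
rewrite exprMn lerMn2r /=; have := sqr_ge0 s; lra.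
Qed.

Lemma gaussian_abs_le (s : R) m p : 0 < s ->
  (`|p.1 - m.1| + `|p.2 - m.2|) * gaussian s m p <= 4 * s * gaussian (2 * s) m p.
Proof.
move=> s0; rewrite /gaussian.
have a1 := normal_fun_abs_le m.1 p.1 s0; have a2 := normal_fun_abs_le m.2 p.2 s0.
have b1 := normal_fun_widen m.1 p.1 s0; have b2 := normal_fun_widen m.2 p.2 s0.
have g (n t x : R) : 0 <= normal_fun n t x by exact: normal_fun_ge0.
have h1 : `|p.1 - m.1| * normal_fun m.1 s p.1 * normal_fun m.2 s p.2 <=
    2 * s * normal_fun m.1 (2 * s) p.1 * normal_fun m.2 (2 * s) p.2.
  by apply: ler_pM => //; rewrite mulr_ge0.
have h2 : `|p.2 - m.2| * normal_fun m.2 s p.2 * normal_fun m.1 s p.1 <=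
    2 * s * normal_fun m.2 (2 * s) p.2 * normal_fun m.1 (2 * s) p.1.
  by apply: ler_pM => //; rewrite mulr_ge0.
lra.
Qed.

End FourierGaussian.

(** * The inversion formula *)

Section Inversion.
Context {R : realType}.
Local Notation C := R[i].
Local Notation mu := (@lebesgue_measure R \x @lebesgue_measure R)%E.
Implicit Types (f g : schwartz R) (p m xi : R * R).

Lemma derive_bounded_lipschitz (phi dphi : R -> R) (L x y : R) :
  (forall x : R, is_derive x (1 : R) phi (dphi x)) -> (forall x, `|dphi x| <= L) ->
  `|phi x - phi y| <= L * `|x - y|.
Proof.
move=> d b; wlog xy : x y / y < x.
  move=> H; have [/H//|xy|->] := ltgtP y x; last by rewrite !subrr normr0 mulr0.
  by rewrite distrC [in leRHS]distrC; exact: H.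
have [|z _ ->] := @MVT R phi dphi y x xy (fun x _ => d x).
  apply: derivable_within_continuous => z _.
  exact: (@ex_derive _ _ _ _ _ _ _ (d z)).
by rewrite normrM ler_wpM2r.
Qed.

(** Mean value theorem along x and then along y; the factor 2 accounts for Re and Im. *)
Lemma schwartz_lipschitz f : exists2 L : R, 0 <= L & forall p q,
  normc (f p - f q) <= L * (`|p.1 - q.1| + `|p.2 - q.2|).
Proof.
pose L := snorm 0 (spdx f) + snorm 0 (spdy f).
have L0 : 0 <= L by rewrite addr_ge0// snorm_ge0.
exists (2 * L); first by rewrite mulr_ge0.
move=> [x y] [x' y']; have [fr fi] := (schwartzP f).1 1%N.
have key (c : C -> R) : Ck 1 (c \o f) -> (forall z, `|c z| <= normc z) ->
    'D_ex (c \o f) = c \o spdx f -> 'D_ey (c \o f) = c \o spdy f ->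
    `|c (f (x, y)) - c (f (x', y'))| <= L * (`|x - x'| + `|y - y'|).
  move=> c1 cn cx cy.
  have hx (u v : R) : is_derive u (1 : R) (fun u => c (f (u, v)))
      (c (spdx f (u, v))).
    have := is_derive_ex (Ck_derivable (p:=(u, v)) dir_ex c1).
    by rewrite (congr1 (@^~ (u, v)) cx).
  have hy (u v : R) : is_derive v (1 : R) (fun v => c (f (u, v)))
      (c (spdy f (u, v))).
    have := is_derive_ey (Ck_derivable (p:=(u, v)) dir_ey c1).
    by rewrite (congr1 (@^~ (u, v)) cy).
  have bx (u v : R) : `|c (spdx f (u, v))| <= L.
    apply: le_trans (cn _) _; apply: le_trans (normc_le_snorm0 _ _) _.
    by rewrite lerDl snorm_ge0.
  have byy (u v : R) : `|c (spdy f (u, v))| <= L.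
    apply: le_trans (cn _) _; apply: le_trans (normc_le_snorm0 _ _) _.
    by rewrite lerDr snorm_ge0.
  have -> : c (f (x, y)) - c (f (x', y')) =
      (c (f (x, y)) - c (f (x', y))) + (c (f (x', y)) - c (f (x', y'))).
    by rewrite addrA subrK.
  apply: le_trans (ler_normD _ _) _; rewrite mulrDr; apply: lerD.
    exact: derive_bounded_lipschitz (fun u => hx u y) (fun u => bx u y).
  exact: derive_bounded_lipschitz (fun v => hy x' v) (fun v => byy x' v).
apply: le_trans (normc_le_ReIm _) _.
rewrite -mulrA mulr_natl mulr2n; apply: lerD.
  have -> : complex.Re (f (x, y) - f (x', y')) =
    complex.Re (f (x, y)) - complex.Re (f (x', y')).
    by case: (f (x, y)) (f (x', y')) => [? ?] [? ?].
  by apply: key => //; exact: normr_Re_le.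
have -> : complex.Im (f (x, y) - f (x', y')) =
  complex.Im (f (x, y)) - complex.Im (f (x', y')).
  by case: (f (x, y)) (f (x', y')) => [? ?] [? ?].
by apply: key => //; exact: normr_Im_le.
Qed.

Lemma gaussian_ge0 (s : R) m p : 0 <= gaussian s m p.
Proof. by rewrite mulr_ge0// normal_fun_ge0. Qed.

Lemma gaussian_le1 (s : R) m p : gaussian s m p <= 1.
Proof.
by apply: mulr_ile1; rewrite ?normal_fun_ge0 ?normal_fun_le1.
Qed.

(** In each variable 1 - exp(-z) <= z, and 1 - a b <= (1 - a) + (1 - b) for a, b in [0, 1]. *)
Lemma gaussianB1_le (e : R) p : 0 < e ->
  1 - gaussian e^-1 0 p <= e ^+ 2 * (p.1 ^+ 2 + p.2 ^+ 2).
Proof.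
move=> e0.
have key (x : R) : 1 - normal_fun 0 e^-1 x <= e ^+ 2 * x ^+ 2.
  have E : - x ^+ 2 / (e^-1 ^+ 2 *+ 2) = - (e ^+ 2 * x ^+ 2 / 2).
    by field; exact: lt0r_neq0.
  have := expR_ge1Dx (- (e ^+ 2 * x ^+ 2 / 2)).
  rewrite /normal_fun subr0 E; have := mulr_ge0 (sqr_ge0 e) (sqr_ge0 x).
  by move: (expR _) => a; lra.
have := key p.1; have := key p.2; rewrite /gaussian.
have := normal_fun_le1 0 e^-1 p.1; have := normal_fun_le1 0 e^-1 p.2.
have := normal_fun_ge0 0 e^-1 p.1; have := normal_fun_ge0 0 e^-1 p.2.
change (normal_fun (0 : R * R).1 e^-1 p.1) with (normal_fun 0 e^-1 p.1).
change (normal_fun (0 : R * R).2 e^-1 p.2) with (normal_fun 0 e^-1 p.2).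
by move: (normal_fun _ _ _) (normal_fun _ _ _) => a b a0 b0 a1 b1; nra.
Qed.

(** A Gaussian of width 1/e inserted as a convergence factor changes the integral of the second
    transform by O(e^2), since 1 minus the Gaussian is at most e^2 |xi|^2 and the transform of f
    stays Schwartz after multiplication by |xi|^2. *)
Lemma fourier_gaussian_mean f p : exists2 K : R, 0 <= K &
  forall (e : R) (e1 : e^-1 != 0), 0 < e -> normc (fourier (sfourier f) p - cintegral mu (fun xi =>
    scis (character p) (sgaussian e1) xi
      * fourier f xi)) <= K * e ^+ 2.
Proof.
pose F := sfourier f.
exists (2 * weight_mass * (4 * (snorm 2 (smulx (smulx F)) + snorm 2 (smuly (smuly F))))).
  by rewrite !mulr_ge0 ?weight_mass_ge0// addr_ge0// snorm_ge0.
move=> e e1 e0; set g := sgaussian _.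
have gE xi : g xi = (gaussian e^-1 0 xi)%:C%C by [].
pose h1 := scis (character p) F.
pose h2 (xi : R * R) : C := F xi * scis (character p) g xi.
have i2 : cintegrable mu h2.
  apply: cintegrable_schwartzM; first exact: cmeasurable_schwartz.
  move=> xi; rewrite scisE normcM normc_cis mul1r gE normc_real.
  by rewrite ger0_norm ?gaussian_ge0// gaussian_le1.
have -> : fourier (sfourier f) p - cintegral mu (fun xi =>
    scis (character p) g xi * fourier f xi) =
    cintegral mu (fun xi => h1 xi + -1 * h2 xi).
  rewrite cintegralD; [|exact: cintegrable_schwartz|exact: cintegrableZ].
  rewrite cintegralZ// mulN1r; congr (_ - _).
  by apply: eq_cintegral => xi; rewrite mulrC.
rewrite -mulrA; apply: normc_cintegral_weight.
  apply: cmeasurableD; first exact: cmeasurable_schwartz.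
  apply: cmeasurableM; first exact: cmeasurable_cst.
  by apply: cmeasurableM; exact: cmeasurable_schwartz.
move=> xi; rewrite /h1 /h2 !scisE gE.
have -> : cis (character p xi) * F xi + -1 * (F xi * (cis (character p xi) *
    (gaussian e^-1 0 xi)%:C%C)) =
    cis (character p xi) * (F xi * (1 - gaussian e^-1 0 xi)%:C%C).
  by rewrite rmorphB rmorph1; ring.
rewrite normcM normc_cis mul1r normcM normc_real ger0_norm; last first.
  by rewrite subr_ge0 gaussian_le1.
apply: le_trans (ler_wpM2l (normc_ge0 _) (gaussianB1_le xi e0)) _.
have := schwartz_decay (smulx (smulx F)) xi.
have := schwartz_decay (smuly (smuly F)) xi.
move: (weight xi) => w; rewrite !smulxE !smulyE !normcM !normc_real.
rewrite !mulrA -!expr2 !real_normK ?num_real// => H1 H2.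
have := ler_wpM2r (sqr_ge0 e) (lerD H1 H2).
move: (normc _) (snorm _ _) (snorm _ _) => n a b; lra.
Qed.

(* The error |f p - f m| <= L |p - m|_1 is absorbed into a Gaussian of twice the
   width, whose mass is known. *)
Lemma gaussian_approximate_identity f m : exists2 K : R, 0 <= K &
  forall e : R, 0 < e -> normc (cintegral mu (fun p =>
    (2 * pi * e^-1 ^+ 2 * gaussian e m p)%:C%C * f p) -
    ((2 * pi) ^+ 2)%:C%C * f m) <= K * e.
Proof.
have [L L0 HL] := schwartz_lipschitz f.
(* The product of c = 2 pi / e^2, the bound 4 e L, the mass 8 pi e^2 of the Gaussian of width 2 e,
   and the factor 2 for Re and Im, divided by e. *)
exists (128 * pi ^+ 2 * L).
  by rewrite !mulr_ge0 ?pi_ge0.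
move=> e e0; have en0 : e != 0 by exact: lt0r_neq0.
have e2 : 2 * e != 0 by rewrite mulf_neq0.
pose c := 2 * pi * e^-1 ^+ 2.
have c0 : 0 <= c by rewrite /c !mulr_ge0 ?pi_ge0 ?invr_ge0 ?ltW.
pose D p : C := (c * gaussian e m p)%:C%C * (f p - f m).
have iG (k t : R) : t != 0 -> mu.-integrable setT (EFin \o (fun p => k * gaussian t m p)).
  by move=> t0; exact: integrable_scale (integrable_gaussian t0 m).
have mG : measurable_fun setT (fun p => c * gaussian e m p).
  by have /integrableP[/measurable_EFinP] := iG c e en0.
have cG : cintegrable mu (fun p => (c * gaussian e m p)%:C%C).
  apply: (@cintegrable_le _ _ R mu _ (fun p => c * gaussian e m p)).
  - exact: cmeasurable_real.
  - exact: iG.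
  - by move=> p; rewrite normc_real ger0_norm// mulr_ge0// gaussian_ge0.
have mD : cmeasurable D.
  apply: cmeasurableM; first exact: cmeasurable_real.
  by apply: cmeasurableD; [exact: cmeasurable_schwartz|exact: cmeasurable_cst].
have bD p : normc (D p) <= c * L * (4 * e) * gaussian (2 * e) m p.
  rewrite normcM normc_real ger0_norm; last by rewrite mulr_ge0// gaussian_ge0.
  apply: (@le_trans _ _ (c * gaussian e m p * (L * (`|p.1 - m.1| + `|p.2 - m.2|)))).
    by apply: ler_wpM2l (HL p m); rewrite mulr_ge0// gaussian_ge0.
  have := ler_wpM2l (mulr_ge0 c0 L0) (gaussian_abs_le m p e0).
  lra.
have iD : cintegrable mu D.
  apply: (@cintegrable_le _ _ R mu _ _ mD _ bD); exact: iG.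
have -> : ((2 * pi) ^+ 2)%:C%C * f m = cintegral mu (fun p => f m * (c * gaussian e m p)%:C%C).
  rewrite cintegralZ// cintegral_real RintegralZl//; last exact: integrable_gaussian.
  rewrite Rintegral_gaussian// mulrC; congr (_ * _ %:C)%C.
  by rewrite /c; field.
have -> : cintegral mu (fun p => (2 * pi * e^-1 ^+ 2 * gaussian e m p)%:C%C * f p) =
    cintegral mu (fun p => f m * (c * gaussian e m p)%:C%C + D p).
  by apply: eq_cintegral => p; rewrite /D /c; ring.
rewrite cintegralD//; last exact: cintegrableZ.
rewrite addrC addrA addNr add0r.
apply: le_trans (@normc_cintegral_le _ _ R mu _ _ mD (iG _ _ e2) bD) _.
rewrite RintegralZl//; last exact: integrable_gaussian.
rewrite Rintegral_gaussian// le_eqVlt; apply/orP; left; apply/eqP.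
by rewrite /c; field.
Qed.

(** Both sides are close to one integral: that of the transform of f against a Gaussian of width 1/e
    modulated by p. It is within K e^2 of the left side. Moving the transform onto the Gaussian
    gives (2 pi)^2 times the mean of f for a normal density of width e centred at -p, within L e of
    the right side. *)
Lemma fourier_inversion f p :
  fourier (sfourier f) p = ((2 * pi) ^+ 2)%:C%C * f (- p).
Proof.
have [K K0 HK] := fourier_gaussian_mean f p.
have [L L0 HL] := gaussian_approximate_identity f (- p).
apply/eqP; rewrite -subr_eq0; apply/eqP/eq0_normc/eqP.
rewrite eq_le normc_ge0 andbT; apply/ler_addgt0Pr => d d0; rewrite add0r.
(* e <= 1 bounds K e^2 by K e, and then (K + L) e <= d; the summand 1 keeps the denominator
   positive. *)
pose e := Num.min 1 (d / (K + L + 1)).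
have KL : 0 < K + L + 1 by rewrite ltr_wpDl// addr_ge0.
have e0 : 0 < e by rewrite lt_min ltr01 divr_gt0.
have e1 : e^-1 != 0 by rewrite invr_eq0 lt0r_neq0.
have := HK e e1 e0; have := HL e e0.
set T := cintegral mu _; set T' := cintegral mu _.
(* Under the transform, modulation by p becomes translation to the centre -p, and the width 1/e
   becomes e. *)
have -> : T' = T.
  rewrite /T' fourier_transpose; apply: eq_cintegral => q.
  rewrite fourier_modulation fourier_sgaussian gaussian_shift invrK.
  by [].
move=> h1 h2.
have -> : fourier (sfourier f) p - ((2 * pi) ^+ 2)%:C%C * f (- p) =
  (fourier (sfourier f) p - T) + (T - ((2 * pi) ^+ 2)%:C%C * f (- p)).
  by rewrite addrA subrK.
apply: le_trans (normc_triangle _ _) _; apply: le_trans (lerD h2 h1) _.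
have el1 : e <= 1 by rewrite ge_min lexx.
have ed : e * (K + L + 1) <= d by rewrite -ler_pdivlMr// ge_min lexx orbT.
have ee : K * e ^+ 2 <= K * e.
  by apply: ler_wpM2l => //; rewrite expr2 ler_piMr// ltW.
lra.
Qed.

Lemma sfourier_iter4 f :
  sfourier (sfourier (sfourier (sfourier f))) = ((2 * pi) ^+ 4)%:C%C *: f.
Proof.
apply: schwartz_inj => p.
rewrite sfourierE fourier_inversion sfourierE fourier_inversion opprK.
by rewrite mulrA -rmorphM -exprD.
Qed.

End Inversion.

(** * Polynomial phases *)

Section PolynomialPhase.
Context {R : realType}.
Local Notation C := R[i].
Implicit Types (P Q : mpoly 2 R) (f g : schwartz R) (p : R * R).

Definition peval P p : R := meval (tnth [tuple p.1; p.2]) P.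

(** Continuity and both derivative formulas pass together through sums and products, because
    [mderiv] obeys the same Leibniz rule; it then suffices to treat constants and variables. *)
Let good P := [/\ continuous (peval P),
  forall p, is_derive p ex (peval P) (peval (mderiv ord0 P) p) &
  forall p, is_derive p ey (peval P) (peval (mderiv ord_max P) p)].

Let goodD P Q : good P -> good Q -> good (P + Q).
Proof.
move=> [cP xP yP] [cQ xQ yQ].
have E T S : peval (T + S) = peval T + peval S.
  by apply/funext => p; rewrite /peval mevalD.
rewrite /good !mderivD !E; split=> p.
- by apply: cvgD; [exact: cP|exact: cQ].
- exact: is_deriveD (xP p) (xQ p).
- exact: is_deriveD (yP p) (yQ p).
Qed.

Let goodM P Q : good P -> good Q -> good (P * Q).
Proof.
move=> [cP xP yP] [cQ xQ yQ].
have E T S : peval (T * S) = peval T * peval S.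
  by apply/funext => p; rewrite /peval mevalM.
have D T S : peval (T + S) = peval T + peval S.
  by apply/funext => p; rewrite /peval mevalD.
rewrite /good !mderivM !D !E; split=> p.
- by apply: cvgM; [exact: cP|exact: cQ].
- apply: is_derive_eq (is_deriveM (xP p) (xQ p)) _.
  by rewrite addrC [in RHS]/GRing.add /=; congr (_ + _); rewrite mulrC.
- apply: is_derive_eq (is_deriveM (yP p) (yQ p)) _.
  by rewrite addrC [in RHS]/GRing.add /=; congr (_ + _); rewrite mulrC.
Qed.

Let goodC (c : R) : good (mpolyC 2 c).
Proof.
have E (d : R) : peval (mpolyC 2 d) = cst d.
  by apply/funext => p; rewrite /peval mevalC.
have E0 : peval 0 = cst 0 by apply/funext => p; rewrite /peval meval0.
rewrite /good !mderivC E !E0; split=> p.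
- exact: cvg_cst.
- exact: is_derive_cst.
- exact: is_derive_cst.
Qed.

Let goodX (i : 'I_2) : good (mpolyX R (mnm1 i)).
Proof.
have E : peval (mpolyX R (mnm1 i)) = if i == ord0 then fst else snd.
  apply/funext => p; rewrite /peval mevalXU.
  by case: i => [[|[|//]] Hi]; rewrite (tnth_nth 0).
have E' (j : 'I_2) : peval (mderiv j (mpolyX R (mnm1 i))) = cst (i == j)%:R.
  apply/funext => p; rewrite /peval mderivX mevalZ mnm1E.
  case: eqP => [->|_]; last by rewrite mul0r.
  by rewrite mul1r mevalX big1// => k _; rewrite mnmBE subnn expr0.
rewrite /good !E' !E; case: i {E E'} => [[|[|//]] Hi] /=; split=> p.
- exact: cvg_fst.
- exact: (coord_is_derive p ex (or_introl erefl)).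
- exact: (coord_is_derive p ey (or_introl erefl)).
- exact: cvg_snd.
- exact: (coord_is_derive p ex (or_intror erefl)).
- exact: (coord_is_derive p ey (or_intror erefl)).
Qed.

Lemma peval_is_derive P : [/\ continuous (peval P),
  forall p, is_derive p ex (peval P) (peval (mderiv ord0 P) p) &
  forall p, is_derive p ey (peval P) (peval (mderiv ord_max P) p)].
Proof.
rewrite -/(good P); elim/mpolyind: P => [|c m P _ _ IH].
  by rewrite -mpolyC0; exact: goodC.
apply: goodD IH; rewrite -mul_mpolyC; apply: goodM (goodC c) _.
rewrite mpolyXE_id; apply: (big_ind good).
- by rewrite -mpolyC1; exact: goodC.
- exact: goodM.
- move=> i _; elim: (m i) => [|k IHk]; first by rewrite expr0 -mpolyC1; exact: goodC.
  by rewrite exprS; exact: goodM.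
Qed.

Lemma schwartz_sumE (I : Type) (s : seq I) (F : I -> schwartz R) p :
  (\sum_(i <- s) F i) p = \sum_(i <- s) F i p.
Proof.
elim: s => [|i s IH]; first by rewrite !big_nil.
by rewrite !big_cons -IH.
Qed.

(** Multiplication by P is built as a polynomial in [smulx] and [smuly]: continuity follows from
    theirs, and its transpose can be matched with the same polynomial in [M1] and [M2]. *)
Definition poly_mul P : {linear schwartz R -> schwartz R} :=
  op2 (map_mpoly (real_complex R) P) smulx smuly.

Lemma op2E (V : lmodType C) (B : mpoly 2 C) (X Y : {linear V -> V}) u :
  op2 B X Y u = \sum_(m <- msupp B)
    mcoeff m B *: iter (m ord0) X (iter (m ord_max) Y u).
Proof.
apply: eq_bigr => m _; congr (_ *: _).
rewrite !big_ord_recl big_ord0 /=.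
have -> : lift ord0 ord0 = ord_max :> 'I_2 by exact: val_inj.
by [].
Qed.

Lemma iter_smulxE k f p : iter k smulx f p = (p.1 ^+ k)%:C%C * f p.
Proof.
elim: k => [|k IH]; first by rewrite expr0 mul1r.
by rewrite iterS smulxE IH mulrA -rmorphM -exprS.
Qed.

Lemma iter_smulyE k f p : iter k smuly f p = (p.2 ^+ k)%:C%C * f p.
Proof.
elim: k => [|k IH]; first by rewrite expr0 mul1r.
by rewrite iterS smulyE IH mulrA -rmorphM -exprS.
Qed.

Lemma poly_mulE P f p : poly_mul P f p = (peval P p)%:C%C * f p.
Proof.
rewrite /poly_mul op2E schwartz_sumE /peval mevalE rmorph_sum mulr_suml.
have inj : injective (real_complex R) by move=> x y [].
rewrite (perm_big _ (msupp_map_mpoly P inj)) /=; apply: eq_bigr => m _.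
rewrite mcoeff_map_mpoly.
change ((mcoeff m P)%:C%C * iter (m ord0) smulx (iter (m ord_max) smuly f) p =
  (mcoeff m P * \prod_(i < 2) tnth [tuple p.1; p.2] i ^+ m i)%:C%C * f p).
rewrite iter_smulxE iter_smulyE !big_ord_recl big_ord0 !(tnth_nth 0) /= mulr1.
have -> : lift ord0 ord0 = ord_max :> 'I_2 by exact: val_inj.
by rewrite !rmorphM /= !mulrA.
Qed.

Lemma scontinuous_op2 (B : mpoly 2 C) (X Y : {linear schwartz R -> schwartz R}) :
  scontinuous X -> scontinuous Y -> scontinuous (op2 B X Y).
Proof.
move=> cX cY.
have -> : (op2 B X Y : schwartz R -> schwartz R) = (fun u => \sum_(m <- msupp B)
    mcoeff m B *: iter (m ord0) X (iter (m ord_max) Y u)).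
  by apply/funext => u; exact: op2E.
elim: (msupp B) => [|m s IH].
  have -> : (fun u : schwartz R => \sum_(m <- [::])
    mcoeff m B *: iter (m ord0) X (iter (m ord_max) Y u)) = (fun u => 0 *: u).
    by apply/funext => u; rewrite big_nil scale0r.
  by apply: scontinuousZ; exact: scontinuous_id.
have -> : (fun u => \sum_(m <- m :: s)
    mcoeff m B *: iter (m ord0) X (iter (m ord_max) Y u)) =
  (fun u => mcoeff m B *: iter (m ord0) X (iter (m ord_max) Y u) + \sum_(m <- s)
    mcoeff m B *: iter (m ord0) X (iter (m ord_max) Y u)).
  by apply/funext => u; rewrite big_cons.
apply: scontinuous_lin IH.
exact: scontinuous_comp (scontinuous_iter _ cX) (scontinuous_iter _ cY).
Qed.

Lemma poly_mul_continuous P : scontinuous (poly_mul P).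
Proof. by apply: scontinuous_op2; [exact: smulx_continuous|exact: smuly_continuous]. Qed.

Lemma peval_continuous P : continuous (peval P).
Proof. by have [] := peval_is_derive P. Qed.

Lemma peval_derx P p : is_derive p ex (peval P) (peval (mderiv ord0 P) p).
Proof. by have [_ + _] := peval_is_derive P; exact. Qed.

Lemma peval_dery P p : is_derive p ey (peval P) (peval (mderiv ord_max P) p).
Proof. by have [_ _] := peval_is_derive P; exact. Qed.

Definition poly_phase P : phase R :=
  Phase (@peval_continuous P) (peval_derx P) (peval_dery P)
    (poly_mulE (mderiv ord0 P)) (poly_mulE (mderiv ord_max P))
    (poly_mul_continuous _) (poly_mul_continuous _).

End PolynomialPhase.

(** * Conjugation on tempered distributions *)

Section Conjugation.
Context {R : realType}.
Local Notation C := R[i].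
Local Notation mu := (@lebesgue_measure R \x @lebesgue_measure R)%E.
Implicit Types (u v : tempered R) (f g : schwartz R).

Definition preserves_schwartz (T : tempered R -> tempered R) :=
  forall u, in_schwartz (T u) <-> in_schwartz u.

Lemma preserves_schwartz_comp (S T : tempered R -> tempered R) :
  preserves_schwartz S -> preserves_schwartz T -> preserves_schwartz (S \o T).
Proof. by move=> pS pT u; split=> [/pS/pT|/pT/pS]. Qed.

Lemma temperedE (c : C) u v f : (c *: u + v : tempered R) f = c * u f + v f.
Proof. by []. Qed.

Lemma temperedNE u f : (- u : tempered R) f = - u f.
Proof. by []. Qed.

Lemma temperedBE u v f : (u - v : tempered R) f = u f - v f.
Proof. by []. Qed.

Lemma temperedZE (c : C) u f : (c *: u : tempered R) f = c * u f.
Proof. by []. Qed.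

Lemma schwartzZE (c : C) f p : (c *: f : schwartz R) p = c * f p.
Proof. by []. Qed.

Lemma tempered_linE u (c : C) f g : u (c *: f + g) = c * u f + u g.
Proof. exact: (temperedP u).1. Qed.

Lemma tempered_scaleE u (c : C) f : u (c *: f) = c * u f.
Proof.
have u0 : u 0 = 0.
  have := tempered_linE u 1 0 0; rewrite scale1r addr0 mul1r => /eqP.
  by rewrite -subr_eq0 opprD addrA subrr sub0r oppr_eq0 => /eqP.
by have := tempered_linE u c f 0; rewrite addr0 u0 addr0.
Qed.

Lemma in_schwartzE u : in_schwartz u <-> exists g : schwartz R, forall f,
  u f = cintegral mu (fun p => g p * f p).
Proof. by []. Qed.

Lemma in_schwartzZ (c : C) u : in_schwartz u -> in_schwartz (c *: u).
Proof.
move=> /in_schwartzE[g ug]; apply/in_schwartzE; exists (c *: g) => f.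
rewrite temperedZE ug -cintegralZ.
  by apply: eq_cintegral => p; rewrite mulrA.
(* The integrability lemma asks for a second factor bounded by 1, so f is divided by a bound K. *)
have [K K0] : exists2 K : R, 0 < K & forall p, normc (f p) <= K.
  exists (snorm 0 f + 1); first by rewrite ltr_wpDl// snorm_ge0.
  by move=> p; rewrite (le_trans (normc_le_snorm0 f p))// lerDl.
move=> fK; have -> : (fun p => g p * f p) = (fun p => K%:C%C * (g p * (K^-1%:C%C * f p))).
  apply/funext => p; rewrite [RHS]mulrCA; congr (_ * _); rewrite mulrA.
  by rewrite -rmorphM mulfV ?gt_eqF// rmorph1 mul1r.
apply: cintegrableZ; apply: cintegrable_schwartzM.
  by apply: cmeasurableM; [exact: cmeasurable_cst|exact: cmeasurable_schwartz].
move=> p; rewrite normcM normc_real gtr0_norm ?invr_gt0// ler_pdivrMl//.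
by rewrite mulr1.
Qed.

Definition tfourier : {linear tempered R -> tempered R} :=
  transpose (@sfourier_continuous R).

Definition tcis (q : phase R) : {linear tempered R -> tempered R} :=
  transpose (scis_continuous q).

Lemma tfourierE u f : tfourier u f = u (sfourier f). Proof. by []. Qed.
Lemma tcisE q u f : tcis q u f = u (scis q f). Proof. by []. Qed.

Lemma tfourier_in_schwartz u : in_schwartz u -> in_schwartz (tfourier u).
Proof.
move=> /in_schwartzE[g ug]; apply/in_schwartzE; exists (sfourier g) => f.
by rewrite tfourierE ug; exact: fourier_transpose.
Qed.

(** If F u is in S(R^2), three more transforms show that F^4 u = (2 pi)^4 u is, and the scalar can
    be divided out. *)
Lemma tfourier_preserves : preserves_schwartz tfourier.
Proof.
move=> u; split; last exact: tfourier_in_schwartz.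
move=> /tfourier_in_schwartz/tfourier_in_schwartz/tfourier_in_schwartz.
have -> : tfourier (tfourier (tfourier (tfourier u))) = ((2 * pi) ^+ 4)%:C%C *: u.
  apply: tempered_inj => f.
  by rewrite !tfourierE sfourier_iter4 tempered_scaleE.
move=> /(in_schwartzZ ((2 * pi) ^- 4)%:C%C).
rewrite scalerA -rmorphM mulVf ?scale1r//.
by rewrite expf_neq0// mulf_neq0// gt_eqF// pi_gt0.
Qed.

Definition phase_opp_mulx (q : phase R) : {linear schwartz R -> schwartz R} :=
  (-1) \*: phase_mulx q.
Definition phase_opp_muly (q : phase R) : {linear schwartz R -> schwartz R} :=
  (-1) \*: phase_muly q.

Lemma phase_opp_mulxE q f p :
  phase_opp_mulx q f p = (- phase_gx q p)%:C%C * f p.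
Proof.
have -> : phase_opp_mulx q f = -1 *: phase_mulx q f by [].
by rewrite schwartzZE phase_mulxE mulN1r rmorphN mulNr.
Qed.

Lemma phase_opp_mulyE q f p :
  phase_opp_muly q f p = (- phase_gy q p)%:C%C * f p.
Proof.
have -> : phase_opp_muly q f = -1 *: phase_muly q f by [].
by rewrite schwartzZE phase_mulyE mulN1r rmorphN mulNr.
Qed.

Lemma phase_opp_cont (q : phase R) : continuous (- (q : R * R -> R)).
Proof. by move=> p; apply: cvgN; exact: phase_cont. Qed.

Definition phase_opp (q : phase R) : phase R := Phase (@phase_opp_cont q)
  (fun p => is_deriveN (phase_derx q p)) (fun p => is_deriveN (phase_dery q p))
  (phase_opp_mulxE q) (phase_opp_mulyE q)
  (scontinuousZ (-1) (phase_mulx_cont q)) (scontinuousZ (-1) (phase_muly_cont q)).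

Lemma scis_oppK q f : scis q (scis (phase_opp q) f) = f.
Proof.
apply: schwartz_inj => p; rewrite !scisE mulrA -cisD.
by rewrite [X in cis X]addrN cis0 mul1r.
Qed.

(** The pairing is bilinear, without conjugation, so multiplication by exp(iq) is its own
    transpose. *)
Lemma tcis_in_schwartz q u : in_schwartz u -> in_schwartz (tcis q u).
Proof.
move=> /in_schwartzE[g ug]; apply/in_schwartzE; exists (scis q g) => f.
by rewrite tcisE ug; apply: eq_cintegral => p; rewrite !scisE mulrCA mulrA.
Qed.

Lemma tcis_preserves q : preserves_schwartz (tcis q).
Proof.
move=> u; split; last exact: tcis_in_schwartz.
move=> /(tcis_in_schwartz (phase_opp q)); congr in_schwartz.
by apply: tempered_inj => f; rewrite !tcisE scis_oppK.
Qed.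

Lemma M1E u f : M1 u f = u (smulx f). Proof. by []. Qed.
Lemma M2E u f : M2 u f = u (smuly f). Proof. by []. Qed.
Lemma D1E u f : D1 u f = 'i%C * u (spdx f). Proof. by []. Qed.
Lemma D2E u f : D2 u f = 'i%C * u (spdy f). Proof. by []. Qed.

Lemma mul_ii : 'i%C * 'i%C = -1 :> C.
Proof. by rewrite -expr2 sqr_i. Qed.

(** On a test function f: i u(d_x F f) = i u(F (-i x f)) = u(F (x f)). *)
Lemma tfourier_D1 u : tfourier (D1 u) = M1 (tfourier u).
Proof.
apply: tempered_inj => f; rewrite tfourierE D1E M1E tfourierE spdx_sfourier.
by rewrite linearZ tempered_scaleE mulrA mulrN mul_ii opprK mul1r.
Qed.

Lemma tfourier_D2 u : tfourier (D2 u) = M2 (tfourier u).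
Proof.
apply: tempered_inj => f; rewrite tfourierE D2E M2E tfourierE spdy_sfourier.
by rewrite linearZ tempered_scaleE mulrA mulrN mul_ii opprK mul1r.
Qed.

Lemma tfourier_M1 u : tfourier (M1 u) = - D1 (tfourier u).
Proof.
apply: tempered_inj => f; rewrite tfourierE M1E smulx_sfourier.
rewrite linearZ tempered_scaleE mulNr.
by rewrite temperedNE D1E tfourierE.
Qed.

Lemma tfourier_M2 u : tfourier (M2 u) = - D2 (tfourier u).
Proof.
apply: tempered_inj => f; rewrite tfourierE M2E smuly_sfourier.
rewrite linearZ tempered_scaleE mulNr.
by rewrite temperedNE D2E tfourierE.
Qed.

Lemma tcis_M1 q u : tcis q (M1 u) = M1 (tcis q u).
Proof. by apply: tempered_inj => f; rewrite tcisE M1E smulx_scis. Qed.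

Lemma tcis_M2 q u : tcis q (M2 u) = M2 (tcis q u).
Proof. by apply: tempered_inj => f; rewrite tcisE M2E smuly_scis. Qed.

Lemma tcis_D1 q u :
  tcis q (D1 u) = D1 (tcis q u) - transpose (phase_mulx_cont q) (tcis q u).
Proof.
apply: tempered_inj => f; rewrite tcisE D1E spdx_scis.
rewrite linearP tempered_linE mulrDr mulrA mul_ii mulN1r.
by rewrite temperedBE addrC.
Qed.

Lemma tcis_D2 q u :
  tcis q (D2 u) = D2 (tcis q u) - transpose (phase_muly_cont q) (tcis q u).
Proof.
apply: tempered_inj => f; rewrite tcisE D2E spdy_scis.
rewrite linearP tempered_linE mulrDr mulrA mul_ii mulN1r.
by rewrite temperedBE addrC.
Qed.

Lemma iter_M1E k u f : iter k M1 u f = u (iter k smulx f).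
Proof. by elim: k f => // k IH f; rewrite iterS M1E IH iterSr. Qed.

Lemma iter_M2E k u f : iter k M2 u f = u (iter k smuly f).
Proof. by elim: k f => // k IH f; rewrite iterS M2E IH iterSr. Qed.

(** Transposition reverses the order of each monomial, which is harmless because multiplications by
    coordinates commute. *)
Lemma op2_multiplication (B : mpoly 2 C) u f :
  op2 B M1 M2 u f = u (op2 B smulx smuly f).
Proof.
rewrite !op2E; elim: (msupp B) => [|m s IH].
  rewrite !big_nil -(scale0r f) tempered_scaleE mul0r.
  by rewrite -(scale0r u) temperedZE mul0r.
rewrite !big_cons temperedE tempered_linE IH; congr (_ * _ + _).
rewrite iter_M1E iter_M2E; congr (u _); apply: schwartz_inj => p.
by rewrite iter_smulxE !iter_smulyE iter_smulxE mulrCA.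
Qed.

Lemma mpoly_op_conj n (B : mpoly n C) (A A' : 'I_n -> {linear tempered R -> tempered R})
    (T : {linear tempered R -> tempered R}) :
  (forall i u, T (A i u) = A' i (T u)) ->
  forall u, T (mpoly_op B A u) = mpoly_op B A' (T u).
Proof.
move=> TA u; rewrite /mpoly_op linear_sum; apply: eq_bigr => m _.
rewrite linearZ; congr (_ *: _).
elim/big_ind2: _ u => // [F F' G G' HF HG u|i _ u].
  by rewrite /= HF HG.
by elim: (m i) => // k IH; rewrite !iterS TA IH.
Qed.

(** If A u is in S(R^2), so is T A u = A' T u; regularity of A' gives T u, and then u. Noncommuting
    arguments cause no trouble, since T passes through each monomial factor by factor. *)
Lemma regular_conj (B : mpoly 4 C) (T : {linear tempered R -> tempered R})
    (X1 X2 Y1 Y2 X1' X2' Y1' Y2' : {linear tempered R -> tempered R}) :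
  preserves_schwartz T ->
  (forall u, T (X1 u) = X1' (T u)) -> (forall u, T (X2 u) = X2' (T u)) ->
  (forall u, T (Y1 u) = Y1' (T u)) -> (forall u, T (Y2 u) = Y2' (T u)) ->
  regular (op4 B X1' X2' Y1' Y2') -> regular (op4 B X1 X2 Y1 Y2).
Proof.
move=> pT hX1 hX2 hY1 hY2 reg u /pT; rewrite /op4 (@mpoly_op_conj _ _ _
  (tnth [tuple X1'; X2'; Y1'; Y2'])) => [/reg/pT//|].
by move=> [[|[|[|[|//]]]] Hi] w; rewrite !(tnth_nth X1) /=.
Qed.

End Conjugation.

(** * Symplectic moves on linear operators *)

Section MetaplecticMoves.
Context {R : realType}.
Local Notation C := R[i].
Implicit Types (u v : tempered R) (B : mpoly 4 C).

(** Operators linear in M1, M2, D1, D2 are represented by their coefficient rows, so that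
    conjugation becomes arithmetic on quadruples. *)
Definition lin4 (z : C * C * C * C) : {linear tempered R -> tempered R} :=
  (z.1.1.1 \*: M1 \+ z.1.1.2 \*: M2) \+ (z.1.2 \*: D1 \+ z.2 \*: D2).

Lemma lin4E (a b c d : C) u :
  lin4 (a, b, c, d) u = (a *: M1 u + b *: M2 u) + (c *: D1 u + d *: D2 u).
Proof. by []. Qed.

Lemma temperedDE u v f : (u + v : tempered R) f = u f + v f.
Proof. by []. Qed.

Lemma tempered_linearZ (T : {linear tempered R -> tempered R}) (c : C) u :
  T (c *: u) = c *: T u.
Proof. exact: linearZ. Qed.

Definition fourier_row (z : C * C * C * C) : C * C * C * C :=
  (z.1.2, z.2, - z.1.1.1, - z.1.1.2).

Definition shear_row (p q r : R) (z : C * C * C * C) : C * C * C * C :=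
  (z.1.1.1 + z.1.2 * p%:C%C + z.2 * q%:C%C,
   z.1.1.2 + z.1.2 * q%:C%C + z.2 * r%:C%C, z.1.2, z.2).

Lemma tfourier_lin4 z u : tfourier (lin4 z u) = lin4 (fourier_row z) (tfourier u).
Proof.
case: z => [[[a b] c] d]; rewrite lin4E !(linearD tfourier).
rewrite (tempered_linearZ tfourier a) (tempered_linearZ tfourier b)
  (tempered_linearZ tfourier c) (tempered_linearZ tfourier d).
rewrite tfourier_M1 tfourier_M2 tfourier_D1 tfourier_D2 addrC !scalerN -!scaleNr.
by [].
Qed.

(** The signs offset the one in [tcis_D1]: conjugation adds the symmetric matrix with entries p, q,
    q, r, applied to M, to D. *)
Definition shear_phase (p q r : R) := quadratic_phase (- p) (- q) (- r) 0 0.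

Lemma tcis_shear_D1 (p q r : R) u : tcis (shear_phase p q r) (D1 u) =
  D1 (tcis (shear_phase p q r) u) + (p%:C%C *: M1 (tcis (shear_phase p q r) u)
    + q%:C%C *: M2 (tcis (shear_phase p q r) u)).
Proof.
rewrite tcis_D1; congr (_ + _); set v := tcis _ u.
apply: tempered_inj => f; rewrite temperedNE temperedE temperedZE M1E M2E.
change (- v (affine_mul (- p) (- q) 0 f) =
  p%:C%C * v (smulx f) + q%:C%C * v (smuly f)).
by rewrite /affine_mul !tempered_linE tempered_scaleE !rmorphN rmorph0; ring.
Qed.

Lemma tcis_shear_D2 (p q r : R) u : tcis (shear_phase p q r) (D2 u) =
  D2 (tcis (shear_phase p q r) u) + (q%:C%C *: M1 (tcis (shear_phase p q r) u)
    + r%:C%C *: M2 (tcis (shear_phase p q r) u)).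
Proof.
rewrite tcis_D2; congr (_ + _); set v := tcis _ u.
apply: tempered_inj => f; rewrite temperedNE temperedE temperedZE M1E M2E.
change (- v (affine_mul (- q) (- r) 0 f) =
  q%:C%C * v (smulx f) + r%:C%C * v (smuly f)).
by rewrite /affine_mul !tempered_linE tempered_scaleE !rmorphN rmorph0; ring.
Qed.

Lemma tcis_lin4 (p q r : R) z u : tcis (shear_phase p q r) (lin4 z u) =
  lin4 (shear_row p q r z) (tcis (shear_phase p q r) u).
Proof.
case: z => [[[a b] c] d]; rewrite lin4E !(linearD (tcis _)).
rewrite (tempered_linearZ _ a) (tempered_linearZ _ b) (tempered_linearZ _ c)
  (tempered_linearZ _ d).
rewrite tcis_M1 tcis_M2 tcis_shear_D1 tcis_shear_D2; set v := tcis _ u.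
have -> : shear_row p q r (a, b, c, d) =
  (a + c * p%:C%C + d * q%:C%C, b + c * q%:C%C + d * r%:C%C, c, d) by [].
rewrite lin4E; move: (M1 v) (M2 v) (D1 v) (D2 v) => m1 m2 d1 d2.
by apply: tempered_inj => f; rewrite !(temperedDE, temperedZE); ring.
Qed.

Definition regular_rows B (z1 z2 w1 w2 : C * C * C * C) :=
  regular (op4 B (lin4 z1) (lin4 z2) (lin4 w1) (lin4 w2)).

Lemma regular_fourier B z1 z2 w1 w2 :
  regular_rows B (fourier_row z1) (fourier_row z2) (fourier_row w1) (fourier_row w2) ->
  regular_rows B z1 z2 w1 w2.
Proof.
by apply: (regular_conj tfourier_preserves) => u; exact: tfourier_lin4.
Qed.

Lemma regular_shear (p q r : R) B z1 z2 w1 w2 :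
  regular_rows B (shear_row p q r z1) (shear_row p q r z2)
    (shear_row p q r w1) (shear_row p q r w2) ->
  regular_rows B z1 z2 w1 w2.
Proof.
by apply: (regular_conj (tcis_preserves (shear_phase p q r))) => u; exact: tcis_lin4.
Qed.

(* The linear symplectic map of the Wigner transform, factored into shears
   D |-> D + c M and Fourier rotations (M, D) |-> (-D, M), so that no change of
   variables is needed. *)
Definition moves (z : C * C * C * C) : C * C * C * C :=
  shear_row (-1) 0 1 (fourier_row (shear_row (-1) (-1) 0 (fourier_row
    (shear_row 1 (-1) 1 (fourier_row (shear_row 1 2^-1 1 z)))))).

Lemma regular_moves B z1 z2 w1 w2 :
  regular_rows B (moves z1) (moves z2) (moves w1) (moves w2) ->
  regular_rows B z1 z2 w1 w2.
Proof.
move=> reg; apply: (@regular_shear 1 2^-1 1); apply: regular_fourier.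
apply: (@regular_shear 1 (-1) 1); apply: regular_fourier.
by apply: (@regular_shear (-1) (-1) 0); apply: regular_fourier; apply: regular_shear reg.
Qed.

(** On operators this reads M1 -> D1 + D2, D1 -> -(M1 + M2)/2, M2 -> M2 - M1, D2 -> (D2 - D1)/2: a
    passage to mean and difference coordinates combined with a quarter turn in the mean
    coordinate. *)
Lemma movesE (a b c d : C) :
  moves (a, b, c, d) = (- b - c / 2, b - c / 2, a - d / 2, a + d / 2).
Proof.
have h2 : (2^-1)%:C%C = 2^-1 :> C by rewrite fmorphV rmorph_nat.
have h0 : 0%:C%C = 0 :> C by [].
have h1 : 1%:C%C = 1 :> C by [].
have hN : (-1)%:C%C = -1 :> C by rewrite rmorphN.
have shearE (p q r : R) (p' q' r' x y z t x' y' : C) :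
    p%:C%C = p' -> q%:C%C = q' -> r%:C%C = r' ->
    x + z * p' + t * q' = x' -> y + z * q' + t * r' = y' ->
    shear_row p q r (x, y, z, t) = (x', y', z, t).
  by move=> <- <- <- <- <-.
have fourierE (x y z t x' y' : C) : - x = x' -> - y = y' ->
  fourier_row (x, y, z, t) = (z, t, x', y') by move=> <- <-.
rewrite /moves (shearE _ _ _ _ _ _ a b c d (a + c + d / 2) (b + c / 2 + d) h1 h2 h1);
  [|by field..].
rewrite (fourierE _ _ c d (- (a + c + d / 2)) (- (b + c / 2 + d)) erefl erefl).
rewrite (shearE _ _ _ _ _ _ c d _ _
  (b - a + c / 2 + d / 2) (a - b + c / 2 + d / 2) h1 hN h1); [|by field..].
rewrite (fourierE (b - a + c / 2 + d / 2) (a - b + c / 2 + d / 2) _ _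
  (a - b - c / 2 - d / 2) (b - a - c / 2 - d / 2)); [|by field..].
rewrite (shearE _ _ _ _ _ _ (- (a + c + d / 2)) (- (b + c / 2 + d)) _ _
  (- a + d / 2) (- a - d / 2) hN hN h0); [|by field..].
rewrite (fourierE (- a + d / 2) (- a - d / 2) _ _ (a - d / 2) (a + d / 2));
  [|by field..].
by rewrite (shearE _ _ _ _ _ _ (a - b - c / 2 - d / 2) (b - a - c / 2 - d / 2) _ _
  (- b - c / 2) (b - c / 2) hN h0 h1) //; field.
Qed.

(** The rows are the four arguments of the transformed operator once P is eliminated: -D1 - M2/2,
    -D1 + M2/2, M1/2 - D2, M1/2 + D2. The moves send them to the unit rows. *)
Lemma regular_metaplectic B : regular (op4 B M1 M2 D1 D2) ->
  regular_rows B (0, - 2^-1, -1, 0) (0, 2^-1, -1, 0)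
    (2^-1, 0, 0, -1) (2^-1, 0, 0, 1).
Proof.
move=> reg; apply: regular_moves.
have -> : moves (0, - 2^-1, -1, 0) = (1, 0, 0, 0).
  by rewrite movesE; congr (_, _, _, _); field.
have -> : moves (0, 2^-1, -1, 0) = (0, 1, 0, 0).
  by rewrite movesE; congr (_, _, _, _); field.
have -> : moves (2^-1, 0, 0, -1) = (0, 0, 1, 0).
  by rewrite movesE; congr (_, _, _, _); field.
have -> : moves (2^-1, 0, 0, 1) = (0, 0, 0, 1).
  by rewrite movesE; congr (_, _, _, _); field.
(* Conjugation by the identity replaces [lin4] of the unit rows by M1, M2, D1, D2, with which they
   agree pointwise. *)
have pid : preserves_schwartz (@idfun (tempered R)) by move=> u; split.
apply: (@regular_conj _ B idfun _ _ _ _ M1 M2 D1 D2 pid _ _ _ _ reg) => u.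
- by rewrite lin4E scale1r !scale0r !addr0.
- by rewrite lin4E scale1r !scale0r !addr0 add0r.
- by rewrite lin4E scale1r !scale0r !addr0 add0r.
- by rewrite lin4E scale1r !scale0r !add0r.
Qed.

Lemma op2_conj (S : mpoly 2 C) (X Y X' Y' T : {linear tempered R -> tempered R}) :
  (forall u, T (X u) = X' (T u)) -> (forall u, T (Y u) = Y' (T u)) ->
  forall u, T (op2 S X Y u) = op2 S X' Y' (T u).
Proof.
move=> hX hY; apply: mpoly_op_conj => -[[|[|//]] Hi] w; rewrite !(tnth_nth X) /=.
  exact: hX.
exact: hY.
Qed.

End MetaplecticMoves.

(** * Elimination of the gradient of P *)

Section GradientConjugation.
Context {R : realType}.
Local Notation C := R[i].
Variable P : mpoly 2 R.
Implicit Types u v : tempered R.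

Let dP (i : 'I_2) : mpoly 2 C := map_mpoly (real_complex R) (mderiv i P).
Let E := tcis (poly_phase P).

(** F turns M_j - P_j into -(D_j + (d_j P)(M)), where the gradient acts by multiplication; exp(iP)
    then subtracts d_j P from D_j, which cancels it. *)
Definition gradient_conj : {linear tempered R -> tempered R} := E \o tfourier.

Lemma gradient_conj_preserves : preserves_schwartz gradient_conj.
Proof.
by apply: preserves_schwartz_comp; [exact: tcis_preserves|exact: tfourier_preserves].
Qed.

Let gradient_conjE u : gradient_conj u = E (tfourier u). Proof. by []. Qed.

Lemma gradient_conj_D1 u : gradient_conj (D1 u) = M1 (gradient_conj u).
Proof. by rewrite !gradient_conjE tfourier_D1 tcis_M1. Qed.

Lemma gradient_conj_D2 u : gradient_conj (D2 u) = M2 (gradient_conj u).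
Proof. by rewrite !gradient_conjE tfourier_D2 tcis_M2. Qed.

Let tcis_op2 (S : mpoly 2 C) u : E (op2 S M1 M2 u) = op2 S M1 M2 (E u).
Proof. by apply: op2_conj => v; [exact: tcis_M1|exact: tcis_M2]. Qed.

Let tfourier_op2 (S : mpoly 2 C) u : tfourier (op2 S D1 D2 u) = op2 S M1 M2 (tfourier u).
Proof. by apply: op2_conj => v; [exact: tfourier_D1|exact: tfourier_D2]. Qed.

(** The multiplication by the derivative of P that the phase creates is expressed as the image of
    P_1 u, so that in M1 - P1 it cancels as an opaque term. *)
Lemma gradient_conj_M1 u : gradient_conj (M1 u) =
  - D1 (gradient_conj u) + gradient_conj (op2 (dP ord0) D1 D2 u).
Proof.
rewrite !gradient_conjE tfourier_op2 tcis_op2 tfourier_M1 linearN tcis_D1.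
rewrite opprB addrC; congr (_ + _); apply: tempered_inj => f.
by rewrite op2_multiplication.
Qed.

Lemma gradient_conj_M2 u : gradient_conj (M2 u) =
  - D2 (gradient_conj u) + gradient_conj (op2 (dP ord_max) D1 D2 u).
Proof.
rewrite !gradient_conjE tfourier_op2 tcis_op2 tfourier_M2 linearN tcis_D2.
rewrite opprB addrC; congr (_ + _); apply: tempered_inj => f.
by rewrite op2_multiplication.
Qed.

End GradientConjugation.

Theorem theorem3p7 (R : realType) (B : mpoly 4 R[i]) (P : mpoly 2 R) :
  let P1 := op2 (map_mpoly (real_complex R) (mderiv ord0 P)) D1 D2 in
  let P2 := op2 (map_mpoly (real_complex R) (mderiv ord_max P)) D1 D2 in
  regular (op4 B M1 M2 D1 D2) ->
  regular (op4 B
    (M1 \- (2^-1 : R[i]) \*: D2 \- P1)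
    (M1 \+ (2^-1 : R[i]) \*: D2 \- P1)
    ((2^-1 : R[i]) \*: D1 \+ M2 \- P2)
    ((2^-1 : R[i]) \*: D1 \- M2 \+ P2)).
Proof.
move=> P1 P2 /regular_metaplectic reg.
have linear_comb (T : {linear tempered R -> tempered R}) (k l m : R[i]) x y z :
    T (k *: x + l *: y + m *: z) = k *: T x + l *: T y + m *: T z.
  by rewrite !linearD !linearZ.
(* In each of the four cases the images of P1 or P2 cancel, leaving a row of
   [regular_metaplectic]. *)
apply: (regular_conj (gradient_conj_preserves P) _ _ _ _ reg) => u.
- have E : (M1 \- 2^-1 \*: D2 \- P1) u = 1 *: M1 u + (- 2^-1) *: D2 u + (-1) *: P1 u.
    by rewrite !scaleNr !scale1r.
  apply: etrans (congr1 (gradient_conj P) E) _; rewrite linear_comb gradient_conj_M1 gradient_conj_D2 lin4E.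
  move: (gradient_conj P (P1 u)) (gradient_conj P u) => v w.
  move: (D1 w) (M1 w) (M2 w) (D2 w) => a b c d.
  by apply: tempered_inj => f; rewrite !(temperedDE, temperedZE, temperedNE); ring.
- have E : (M1 \+ 2^-1 \*: D2 \- P1) u = 1 *: M1 u + 2^-1 *: D2 u + (-1) *: P1 u.
    by rewrite !scaleNr !scale1r.
  apply: etrans (congr1 (gradient_conj P) E) _; rewrite linear_comb gradient_conj_M1 gradient_conj_D2 lin4E.
  move: (gradient_conj P (P1 u)) (gradient_conj P u) => v w.
  move: (D1 w) (M1 w) (M2 w) (D2 w) => a b c d.
  by apply: tempered_inj => f; rewrite !(temperedDE, temperedZE, temperedNE); ring.
- have E : (2^-1 \*: D1 \+ M2 \- P2) u = 2^-1 *: D1 u + 1 *: M2 u + (-1) *: P2 u.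
    by rewrite !scaleNr !scale1r.
  apply: etrans (congr1 (gradient_conj P) E) _; rewrite linear_comb gradient_conj_M2 gradient_conj_D1 lin4E.
  move: (gradient_conj P (P2 u)) (gradient_conj P u) => v w.
  move: (D1 w) (M1 w) (M2 w) (D2 w) => a b c d.
  by apply: tempered_inj => f; rewrite !(temperedDE, temperedZE, temperedNE); ring.
- have E : (2^-1 \*: D1 \- M2 \+ P2) u = 2^-1 *: D1 u + (-1) *: M2 u + 1 *: P2 u.
    by rewrite !scaleNr !scale1r.
  apply: etrans (congr1 (gradient_conj P) E) _; rewrite linear_comb gradient_conj_M2 gradient_conj_D1 lin4E.
  move: (gradient_conj P (P2 u)) (gradient_conj P u) => v w.
  move: (D1 w) (M1 w) (M2 w) (D2 w) => a b c d.
  by apply: tempered_inj => f; rewrite !(temperedDE, temperedZE, temperedNE); ring.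
Qed.
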